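(* Let $N_1,N_2,N_3\ge1$ be integers and let $Z_{N_1,N_2,N_3}(\lambda;\mathbf t)$ be the topological vertex partition function $$Z_{N_1,N_2,N_3}(\lambda;\mathbf t)=\sum_{\mu^{i,j}}(-1)^{\sum_{i=1}^3|\mu^{i,1}|}e^{-\sum_{i=1}^3|\mu^{i,1}|t_{i,1}}q^{\sum_{i=1}^3\kappa_{\mu^{i,1}}/2}\,\mathcal W_{(\mu^{3,1})^t,(\mu^{2,1})^t,(\mu^{1,1})^t}(q)\prod_{i=1}^3\prod_{j=2}^{N_i+1}q^{-\kappa_{\mu^{i,j-1}}/2}\,\mathcal W_{\mu^{i,j-1}\mu^{i,j}}(q)\,q^{-\kappa_{\mu^{i,j}}/2}e^{-|\mu^{i,j}|t_{i,j}},$$ where the sum is over all families of partitions $\mu^{i,j}$, $1\le i\le3$, $1\le j\le N_i$, and $\mu^{i,N_i+1}=\emptyset$ (so the factor $e^{-|\mu^{i,j}|t_{i,j}}$ with $j=N_i+1$ is $1$). Then $$Z_{N_1,N_2,N_3}(\lambda;\mathbf t)=\exp\Big(\sum_{n=1}^\infty\frac1{n[n]^2}\sum_{i=1}^3\sum_{2\le k_1\le k_2\le N_i}e^{-n(t_{i,k_1}+\cdots+t_{i,k_2})}\Big)\sum_{\vec\mu}\mathcal W_{\mu^1,\mu^2,\mu^3}(q)\prod_{i=1}^3(-1)^{|\mu^i|}e^{-|\mu^i|t_{i,1}}s_{(\mu^i)^t}\big(u^i(q,\mathbf t_i)\big),$$ where the last sum is over all triples $\vec\mu=(\mu^1,\mu^2,\mu^3)$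 of partitions.
   Context: $q=e^{\sqrt{-1}\lambda}$, $[n]=q^{n/2}-q^{-n/2}$, $\mathbf t=(\mathbf t_1,\mathbf t_2,\mathbf t_3)$, $\mathbf t_i=(t_{i,1},\dots,t_{i,N_i})$ formal variables; both sides are formal power series in the $e^{-t_{i,j}}$ with coefficients functions of $q^{1/2}$. For a partition $\mu$: $|\mu|$ is its size, $\mu^t$ its transpose, $\kappa_\mu=\sum_i\mu_i(\mu_i-2i+1)$, $z_\mu=\prod_ii^{m_i}m_i!$ with $m_i$ the number of parts equal to $i$, $\chi_\mu(\nu)$ the irreducible symmetric group character labelled by $\mu$ on cycle type $\nu$. $s_\mu$ are Schur functions and $s_\mu s_\nu=\sum_\rho c^\rho_{\mu\nu}s_\rho$. Define $$\mathcal W_\mu(q)=s_\mu(x_i=q^{-i+\frac12},\ i\ge1),\quad\mathcal W_{\mu/\nu}(q)=\sum_\lambda c^\mu_{\nu\lambda}\mathcal W_\lambda(q),\quad\mathcal W_{\mu\nu}(q)=q^{\kappa_\mu/2+\kappa_\nu/2}\sum_\lambda\mathcal W_{\mu^t/\lambda}(q)\mathcal W_{\nu^t/\lambda}(q)$$ ($\mathcal W_\mu$ identified with the function of $q^{1/2}$ it represents; power sums specialize to $p_n=1/[n]$), and $$\mathcal W_{\mu^1,\mu^2,\mu^3}(q)=q^{\kappa_{\mu^2}/2+\kappa_{\mu^3}/2}\sum_{\rho,\rho^1,\rho^3}c^{\mu^1}_{\rho\rho^1}c^{(\mu^3)^t}_{\rho\rho^3}\frac{\mathcal W_{(\mu^2)^t\rho^1}(q)\mathcal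 W_{\mu^2\rho^3}(q)}{\mathcal W_{\mu^2}(q)}.$$ (Three comma-separated indices denote this vertex; two indices denote $\mathcal W_{\mu\nu}$.) Finally $$u^i_n(q,\mathbf t_i)=\frac1{[n]}\Big(1+\sum_{k=2}^{N_i}e^{-n(t_{i,2}+\cdots+t_{i,k})}\Big),\quad u^i_\nu=\prod_ju^i_{\nu_j},\quad s_\mu(u^i(q,\mathbf t_i))=\sum_{|\nu|=|\mu|}\frac{\chi_\mu(\nu)}{z_\nu}u^i_\nu(q,\mathbf t_i).$$ *)

(* Defs.v *)
From HB Require Import structures.
From mathcomp Require Import all_boot all_order all_algebra all_fingroup.
From mathcomp Require Import fraction algC classfun character.
From mathcomp Require Import finmap multiset.
From mathcomp Require Import boolp classical_sets functions cardinality fsbigop.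

Set Implicit Arguments.
Unset Strict Implicit.
Unset Printing Implicit Defensive.
Import Order.TTheory GRing.Theory Num.Theory.
Local Open Scope ring_scope.
Local Open Scope classical_set_scope.

(* A monomial is a finite multiset of variables; [coef f m] is the coefficient
   of the monomial [m]. *)
Record fps (I : choiceType) (R : comNzRingType) :=
  Fps { coef : {mset I}%mset -> R }.

Section FpsRing.
Variables (I : choiceType) (R : comNzRingType).
Local Notation mon := {mset I}%mset.
Implicit Types (f g h : fps I R) (m : mon).

HB.instance Definition _ := gen_eqMixin (fps I R).
HB.instance Definition _ := gen_choiceMixin (fps I R).

Lemma fpsP f g : coef f =1 coef g -> f = g.
Proof. by case: f g => [f] [g] /= /funext ->. Qed.

Definition fpsC (c : R) : fps I R := Fps (fun m => if m == mset0 then c else 0).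
Definition fpsX (i : I) : fps I R := Fps (fun m => (m == msetn 1 i)%:R).
Definition fps_add f g : fps I R := Fps (fun m => coef f m + coef g m).
Definition fps_opp f : fps I R := Fps (fun m => - coef f m).
Definition fps_mul f g : fps I R := Fps (fun m =>
  \sum_(p \in [set p : mon * mon | msetD p.1 p.2 = m]) coef f p.1 * coef g p.2).

Fact fps_addA : associative fps_add.
Proof. by move=> f g h; apply: fpsP => m /=; rewrite addrA. Qed.
Fact fps_addC : commutative fps_add.
Proof. by move=> f g; apply: fpsP => m /=; rewrite addrC. Qed.
Fact fps_add0 : left_id (fpsC 0) fps_add.
Proof. by move=> f; apply: fpsP => m /=; rewrite if_same add0r. Qed.
Fact fps_addN : left_inverse (fpsC 0) fps_opp fps_add.
Proof. by move=> f; apply: fpsP => m /=; rewrite if_same addNr. Qed.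

HB.instance Definition _ :=
  GRing.isZmodule.Build (fps I R) fps_addA fps_addC fps_add0 fps_addN.

Fact finite_submset m : finite_set [set a : mon | msubset a m].
Proof.
pose F (s : (size m).-tuple bool) := seq_mset (mask s m).
apply: (@sub_finite_set _ _ [set` map F (enum {: (size m).-tuple bool})]);
  last exact: finite_seq.
move=> a /= /msubsetP am.
have /count_subseqP[b /subseqP[s ss ->] ab] :
    forall x, (count_mem x (enum_mset a) <= count_mem x (enum_mset m))%N.
  by move=> x; rewrite !count_mem_mset.
apply/mapP; exists (tcast ss (in_tuple s)); first by rewrite mem_enum.
by rewrite /F val_tcast; apply/esym/eqP/mset_eqP => x;
  rewrite mset_seqE -(seq.permP ab) count_mem_mset.
Qed.

Fact fps_mulE f g m N : msubset m N ->
  let D := fset_set [set a : mon | msubset a N] in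
  coef (fps_mul f g) m =
  \sum_(a <- D) \sum_(b <- D) (if msetD a b == m then coef f a * coef g b else 0).
Proof.
move=> mN D; have DE a : (a \in D) = msubset a N.
  by rewrite /D in_fset_set ?inE//; [apply/idP/idP; rewrite inE | exact: finite_submset].
pose F (p : mon * mon) :=
  if msetD p.1 p.2 == m then coef f p.1 * coef g p.2 else 0.
transitivity (\sum_(p <- [seq (a, b) | a <- D, b <- D]) F p);
  last by rewrite big_allpairs.
rewrite -big_mkcond -big_filter /=.
set r := filter _ _; have rE p : p \in r -> msetD p.1 p.2 = m.
  by rewrite mem_filter => /andP[/eqP].
rewrite (fsbigE r); first by rewrite big_seq_cond [RHS]big_seq_cond;
  apply: eq_bigl => p; case: (boolP (p \in r)) => //= /rE pm; rewrite mem_set.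
- by rewrite filter_uniq// allpairs_uniq ?fset_uniq// => -[a b] [c d] _ _ [-> ->].
- by move=> p /=; rewrite mem_filter => /andP[/eqP].
- move=> [a b] /= abm; rewrite mem_filter /= abm eqxx /= => /negP[].
  apply/allpairsP; exists (a, b); rewrite !DE; split=> //=;
    apply: (msubset_trans _ mN); rewrite -abm; apply/msubsetP => x;
    by rewrite msetE2 ?leq_addr ?leq_addl.
Qed.

Fact fps_mulC : commutative fps_mul.
Proof.
move=> f g; apply: fpsP => m; rewrite !(fps_mulE _ _ (msubset_refl m)) exchange_big.
by apply: eq_bigr => a _; apply: eq_bigr => b _; rewrite msetDC mulrC.
Qed.

Fact fps_mulA : associative fps_mul.
Proof.
move=> f g h; apply: fpsP => m; rewrite !(fps_mulE _ _ (msubset_refl m)).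
set D := fset_set _; have DE a : (a \in D) = msubset a m.
  by rewrite /D in_fset_set ?inE//; [apply/idP/idP; rewrite inE | exact: finite_submset].
have sumD (F : mon -> R) c : (c \notin D -> F c = 0) ->
    \sum_(a <- D) (if c == a then F a else 0) = F c.
  move=> Fc; have [cD|cD] := boolP (c \in D).
    rewrite (bigD1_seq c) ?fset_uniq //= eqxx big1 ?addr0 // => a.
    by rewrite eq_sym => /negPf ->.
  rewrite Fc// big1_seq// => a aD; case: eqP => // ca.
  by move: aD; rewrite /= -ca (negPf cD).
have msubD a b : msetD a b = m -> (a \in D) && (b \in D).
  by move=> abm; rewrite !DE -abm; apply/andP; split; apply/msubsetP => x;
    rewrite msetE2 ?leq_addr ?leq_addl.
pose G a b c := if msetD a (msetD b c) == m then coef f a * coef g b * coef h c else 0.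
transitivity (\sum_(a <- D) \sum_(b <- D) \sum_(c <- D) G a b c).
  apply: eq_bigr => a _.
  transitivity (\sum_(x <- D) \sum_(b <- D) \sum_(c <- D)
      if msetD b c == x then if msetD a x == m then coef f a * (coef g b * coef h c) else 0 else 0).
    rewrite big_seq [RHS]big_seq; apply: eq_bigr => x; rewrite DE => xm.
    rewrite (fps_mulE _ _ xm); case: eqP => _.
      rewrite big_distrr; apply: eq_bigr => b _; rewrite big_distrr.
      by apply: eq_bigr => c _; case: eqP => //= _; rewrite mulr0.
    by rewrite big1// => b _; rewrite big1// => c _; rewrite if_same.
  rewrite exchange_big; apply: eq_bigr => b _; rewrite exchange_big.
  apply: eq_bigr => c _; rewrite (sumD (fun x =>
    if msetD a x == m then coef f a * (coef g b * coef h c) else 0)) /G ?mulrA//.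
  by case: eqP => // /msubD/andP[_ ->].
transitivity (\sum_(c <- D) \sum_(a <- D) \sum_(b <- D) G a b c).
  rewrite [RHS]exchange_big /=; apply: eq_bigr => a _.
  by rewrite exchange_big.
rewrite [RHS]exchange_big; apply: eq_bigr => c _.
transitivity (\sum_(x <- D) \sum_(a <- D) \sum_(b <- D)
    if msetD a b == x then if msetD x c == m then coef f a * coef g b * coef h c else 0 else 0).
  rewrite [RHS]exchange_big; apply: eq_bigr => a _; rewrite [RHS]exchange_big.
  apply: eq_bigr => b _; rewrite (sumD (fun x =>
    if msetD x c == m then coef f a * coef g b * coef h c else 0)) /G ?msetDA//.
  by case: eqP => // /msubD/andP[->].
rewrite big_seq [RHS]big_seq; apply: eq_bigr => x; rewrite DE => xm.
rewrite (fps_mulE _ _ xm); case: eqP => _.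
  rewrite big_distrl; apply: eq_bigr => a _; rewrite big_distrl.
  by apply: eq_bigr => b _; case: eqP => //= _; rewrite mul0r.
by rewrite big1// => a _; rewrite big1// => b _; rewrite if_same.
Qed.

Fact fps_mul1 : left_id (fpsC 1) fps_mul.
Proof.
move=> f; apply: fpsP => m; rewrite /= (fsbigE [:: (mset0, m)])//=.
- rewrite big_mkcond big_seq1 mem_set/= ?eqxx ?mul1r//; exact: mset0D.
- by move=> p /=; rewrite inE => /eqP ->; exact: mset0D.
- move=> [a b] /= abm; rewrite inE; case: (a =P mset0) => [a0|_];
    last by rewrite mul0r.
  by move: abm; rewrite a0 mset0D => ->; rewrite eqxx.
Qed.

Fact fps_mulDl : left_distributive fps_mul (@GRing.add (fps I R)).
Proof.
move=> f g h; apply: fpsP => m.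
rewrite -[RHS]/(coef (fps_mul f h) m + coef (fps_mul g h) m).
rewrite !(fps_mulE _ _ (msubset_refl m)).
rewrite -big_split; apply: eq_bigr => a _; rewrite -big_split.
apply: eq_bigr => b _; case: ifP => _; first exact: mulrDl.
by apply/esym; exact: addr0.
Qed.
Fact fps_1neq0 : fpsC 1 != 0 :> fps I R.
Proof.
apply/eqP => /(congr1 (fun f : fps I R => coef f mset0)) /= /eqP.
by rewrite eqxx oner_eq0.
Qed.

HB.instance Definition _ := GRing.Zmodule_isComNzRing.Build (fps I R)
  fps_mulA fps_mulC fps_mul1 fps_mulDl fps_1neq0.

End FpsRing.

(* An infinite sum of power series is taken coefficientwise. It is meaningful
   for locally finite families: where a monomial occurs in infinitely many
   terms, the library's finitely supported sum takes the default value 0. *)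
Definition fps_sum (I : choiceType) (R : comNzRingType) (T : choiceType)
    (A : set T) (F : T -> fps I R) : fps I R :=
  Fps (fun m => \sum_(a \in A) coef (F a) m).

Definition fps_exp (I : choiceType) (K : fieldType) (f : fps I K) : fps I K :=
  fps_sum [set: nat] (fun k => fpsC I (k`!%:R)^-1 * f ^+ k).

Record part := Part {
  pval :> seq nat;
  part_axiom : sorted geq pval && (0%N \notin pval)
}.
HB.instance Definition _ := [isSub for pval].
HB.instance Definition _ := [Choice of part by <:].

Definition part0 : part := @Part [::] isT.

Definition psize (mu : part) : nat := sumn mu.

Fact trp_subproof (mu : part) :
  let s := mkseq (fun j => count (fun p => (j < p)%N) mu) (head 0%N mu) in
  sorted geq s && (0%N \notin s).
Proof.
apply/andP; split.
  apply: (@homo_sorted _ _ _ ltn geq) (iota_ltn_sorted _ _) => i j /ltnW ij.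
  by apply: sub_count => p; apply: leq_ltn_trans.
apply/mapP => -[j]; rewrite mem_iota add0n => /andP[_].
by case: (pval mu) => //= p s -> /esym/eqP.
Qed.

Definition trp (mu : part) : part := Part (trp_subproof mu).

(* The parts mu_1, mu_2, ... are stored from index 0, whence the shift
   mu_i - 2 i + 1 ~> mu_(i+1) - 2 (i+1) + 1. *)
Definition kappa (mu : part) : int :=
  \sum_(i < size mu)
    (nth 0%N mu i)%:Z * ((nth 0%N mu i)%:Z - 2 * (i.+1)%:Z + 1).

Definition zee (nu : part) : nat :=
  (\prod_(i <- undup nu) (i ^ count_mem i nu * (count_mem i nu)`!))%N.

Section SymmetricGroup.
Variable n : nat.
Local Notation Sn := [set: 'S_n]%SET.

Definition sgn_fun : {ffun 'S_n -> algC} := [ffun s : 'S_n => (-1) ^+ odd_perm s].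

Fact sgn_subproof : is_class_fun <<Sn>>%g sgn_fun.
Proof.
rewrite genGid; apply: intro_class_fun => [s t _ _|s]; last by rewrite inE.
by rewrite odd_permJ.
Qed.

Definition sgn_char : 'CF(Sn) := Cfun 0 sgn_subproof.

(* [reshape_index mu k] is the row containing [k] when the Young diagram of
   [mu] is filled row by row with 0, 1, ..., n - 1. *)
Definition young_set (mu : part) : {set 'S_n} :=
  [set s : 'S_n |
    [forall k, reshape_index mu (s k) == reshape_index mu k]]%SET.

Fact young_group_set mu : group_set (young_set mu).
Proof.
apply/group_setP; split; first by rewrite inE; apply/forallP => k; rewrite perm1.
move=> s t; rewrite !inE => /forallP sP /forallP tP; apply/forallP => k.
by rewrite permM (eqP (tP _)) sP.
Qed.

Definition young mu : {group 'S_n} := Group (young_group_set mu).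

(* The irreducible character labelled by a partition [mu] of [n] is the unique
   common constituent of the trivial character induced from the Young subgroup
   of [mu] and the sign character induced from the Young subgroup of the
   transpose of [mu]. *)
Definition irr_char (mu : part) : 'CF(Sn) :=
  if [pick i : Iirr Sn |
       (i \in irr_constt ('Ind[Sn] (1 : 'CF(young mu))))
    && (i \in irr_constt ('Ind[Sn] ('Res[young (trp mu)] sgn_char)))]
  is Some i then 'chi_i else 0.

Definition has_cycle_type (s : 'S_n) (nu : part) : bool :=
  perm_eq [seq #|B| | B : {set 'I_n} <- enum (porbits s)] nu.

End SymmetricGroup.

Definition chi (mu nu : part) : algC :=
  if [pick s : 'S_(psize mu) | has_cycle_type s nu] is Some s
  then irr_char (psize mu) mu s else 0.

Definition ssyt (mu : part) (T : seq (seq nat)) : Prop :=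
  [/\ shape T = mu,
      forall k, k \in flatten T -> (0 < k)%N,
      forall r, r \in T -> sorted leq r
    & forall i j, (i.+1 < size T)%N -> (j < size (nth [::] T i.+1))%N ->
        (nth 0%N (nth [::] T i) j < nth 0%N (nth [::] T i.+1) j)%N].

(* The variables are x_1, x_2, ...; x_0 does not occur. *)
Definition schur (mu : part) : fps nat algC :=
  fps_sum [set T | ssyt mu T] (fun T => \prod_(k <- flatten T) fpsX algC k).

(* [lr rho mu nu] is c^rho_(mu nu). *)
Definition lr (rho mu nu : part) : algC :=
  xget (fun=> 0) [set c : part -> algC |
    schur mu * schur nu
    = fps_sum [set: part] (fun rho => fpsC nat (c rho) * schur rho)] rho.

(* q^(1/2) is an indeterminate, and functions of q^(1/2) are rational functions.
   The constants are algebraic numbers because characters take values there. *)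
Definition Kq : fieldType := {fraction {poly algC}}.

Definition cst (c : algC) : Kq := tofrac c%:P.

Definition qh : Kq := tofrac 'X.

Definition qint (n : nat) : Kq := qh ^+ n - qh ^- n.

Definition at_qhV (P : {poly algC}) : Kq := (map_poly cst P).[qh^-1].

(* [f] is the rational function whose expansion in powers of q^(-1/2) is the
   formal power series with coefficients [a]. *)
Definition represents (a : nat -> algC) (f : Kq) : Prop :=
  exists A B : {poly algC},
    [/\ B != 0, f * at_qhV B = at_qhV A
      & forall m, A`_m = \sum_(k < m.+1) B`_k * a (m - k)%N].

(* The coefficient of q^(-m/2) in s_mu(x_i = q^(-i + 1/2), i >= 1): such a
   substitution maps the monomial alpha to q^(-w/2), where w is the sum of
   2 i - 1 over the variables x_i of alpha. *)
Definition principal_coef (mu : part) (m : nat) : algC :=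
  \sum_(alpha \in [set alpha : {mset nat}%mset |
          (\sum_(i <- enum_mset alpha) (i.*2).-1)%N = m])
    coef (schur mu) alpha.

Definition W1 (mu : part) : Kq := xget 0 [set f | represents (principal_coef mu) f].

Definition Wskew (mu nu : part) : Kq :=
  \sum_(lam \in [set: part]) cst (lr mu nu lam) * W1 lam.

Definition W2 (mu nu : part) : Kq :=
  qh ^ (kappa mu + kappa nu) *
  \sum_(lam \in [set: part]) Wskew (trp mu) lam * Wskew (trp nu) lam.

Definition W3 (mu1 mu2 mu3 : part) : Kq :=
  qh ^ (kappa mu2 + kappa mu3) *
  \sum_(r \in [set: part * part * part])
    let: (rho, rho1, rho3) := r in
    cst (lr mu1 rho rho1) * cst (lr (trp mu3) rho rho3) *
    (W2 (trp mu2) rho1 * W2 mu2 rho3 / W1 mu2).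

(* The variable (i, j) is e^(-t_(i,j)); the legs 1, 2, 3 are the elements
   0, 1, 2 of 'I_3, and j is numbered from 1. Exponentials of integer combinations
   of the -t_(i,j) are written as monomials in these variables. *)
Definition tser := fps ('I_3 * nat)%type Kq.

Definition leg1 : 'I_3 := @Ordinal 3 0 isT.
Definition leg2 : 'I_3 := @Ordinal 3 1 isT.
Definition leg3 : 'I_3 := @Ordinal 3 2 isT.

Definition scal (c : Kq) : tser := fpsC _ c.

Definition expt (i : 'I_3) (j : nat) : tser := fpsX Kq (i, j).

Definition u_pow (i : 'I_3) (N n : nat) : tser :=
  scal (qint n)^-1 *
  (1 + \sum_(2 <= k < N.+1) (\prod_(2 <= l < k.+1) expt i l) ^+ n).

Definition u_part (i : 'I_3) (N : nat) (nu : part) : tser :=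
  \prod_(n <- pval nu) u_pow i N n.

Definition schur_u (i : 'I_3) (N : nat) (mu : part) : tser :=
  fps_sum [set nu : part | psize nu = psize mu]
    (fun nu => scal (cst (chi mu nu / (zee nu)%:R)) * u_part i N nu).

(* The families mu^(i,j), 1 <= j <= N_i, extended by the empty partition; in
   particular mu^(i,N_i+1) is empty. *)
Definition families (N : 'I_3 -> nat) : set ('I_3 -> nat -> part) :=
  [set mu | forall i j, ~~ (1 <= j <= N i)%N -> mu i j = part0].

Definition Zvertex (N : 'I_3 -> nat) : tser :=
  fps_sum (families N) (fun mu =>
    (-1) ^+ (\sum_(i < 3) psize (mu i 1%N))%N *
    \prod_(i < 3) expt i 1 ^+ psize (mu i 1%N) *
    scal (qh ^ (\sum_(i < 3) kappa (mu i 1%N))) *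
    scal (W3 (trp (mu leg3 1%N)) (trp (mu leg2 1%N)) (trp (mu leg1 1%N))) *
    \prod_(i < 3) \prod_(2 <= j < (N i).+2)
      (scal (qh ^ (- kappa (mu i j.-1)) * W2 (mu i j.-1) (mu i j)
             * qh ^ (- kappa (mu i j)))
       * expt i j ^+ psize (mu i j))).

(* Main.v *)
(* Write s_mu[a] for the Schur function of mu with the power sums p_n replaced
   by a_n, and x_n = 1/[n], so that W_mu = s_mu[x]. Up to powers of q, W_(mu nu)
   is the sum over lambda of s_(mu^t/lambda)[x] s_(nu^t/lambda)[x]. Summing
   s_(nu^t)[w] against it over nu gives, by the Cauchy identity and the addition
   formula for s_(mu^t),
     exp(sum_n x_n w_n / n) s_(mu^t)[x + w].
   Starting from the outer end of leg i, where w = 0, and taking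
   w_n = e^(-n t_(i,j)) v_n with v from the previous edge, the sums over
   mu^(i,N_i), ..., mu^(i,2) produce s_((mu^(i,1))^t)[u^i] and the exponential
   factor. The remaining vertex is brought to the stated form by
   W_(mu^t) = q^(-kappa_mu/2) W_mu, which follows from a weight-shifting
   bijection between tableaux of transposed shapes.

   The labelling of the irreducible characters and the Frobenius formula come
   from the Cauchy identity: in S_n the power sum products p_sigma satisfy
   sum_sigma p_sigma[x] p_sigma[y] = n! sum_mu s_mu[x] s_mu[y], and dominance,
   through the triangularity of the Kostka numbers and the Gale-Ryser condition,
   singles out one common constituent of the two induced characters. *)
From HB Require Import structures.
Require Import Defs.
From mathcomp Require Import all_boot all_order all_algebra all_fingroup.
From mathcomp Require Import fraction algC mxrepresentation classfun character.
From mathcomp Require Import finmap multiset.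
From mathcomp Require Import boolp classical_sets cardinality fsbigop.
From mathcomp Require Import zify ring.

Set Implicit Arguments.
Unset Strict Implicit.
Unset Printing Implicit Defensive.
Import Order.TTheory GRing.Theory Num.Theory.
Local Open Scope ring_scope.
Local Open Scope classical_set_scope.

(** * Partitions and horizontal strips *)

(** [lr], [W1] and [irr_char] select objects by a property, so existence and uniqueness must precede
    any computation with them: the formula [lrc], the value [sch cst qintV] and the predicate
    [irr_of] serve this end. The theory of symmetric functions is built from the branching rule in
    finitely many variables; an identity in infinitely many is read at one monomial at a time, where
    finitely many variables suffice.

    The addition formula is needed for power sums a + b with a and b arbitrary, not for alphabets of
    variables. Schur functions are therefore rewritten as polynomials in power sums ([sch]), with
    values in any commutative ring that receives [algC]; the Frobenius formula makes this possible.
    The identities then rest on the numbers 1/z_nu and are proved by marking one part of a partition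
    ([sum_insert]).

    Sums over all partitions are compared modulo terms of degree above a bound B. Every partition
    carries a variable to the power of its size, so both sides become finite sums over partitions of
    size at most B. *)

Local Notation prow mu i := (nth 0%N (Defs.pval mu) i).

Lemma row_gt0 (mu : part) i : (0 < prow mu i)%N = (i < size mu)%N.
Proof.
have [im|im] := ltnP i (size mu); last by rewrite nth_default.
case/andP: (part_axiom mu) => _ mu0; rewrite lt0n; apply: contraNneq mu0 => <-.
exact: mem_nth.
Qed.

Lemma leq_row (mu : part) i j : (i <= j)%N -> (prow mu j <= prow mu i)%N.
Proof.
move=> ij; have [jm|jm] := ltnP j (size mu); last by rewrite nth_default.
case/andP: (part_axiom mu) => smu _.
have geq_tr : transitive geq by move=> y x z /= xy yz; apply: leq_trans yz xy.
by apply: (sorted_leq_nth geq_tr leqnn 0%N smu) => //; exact: leq_ltn_trans jm.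
Qed.

Lemma eq_part (mu nu : part) : (forall i, prow mu i = prow nu i) -> mu = nu.
Proof.
move=> e; apply: val_inj; apply: (@eq_from_nth _ 0%N) => [|i _]; last exact: e.
apply/eqP; rewrite eqn_leq; apply/andP; split; rewrite leqNgt.
  by apply/negP; rewrite -row_gt0 e row_gt0 ltnn.
by apply/negP; rewrite -row_gt0 -e row_gt0 ltnn.
Qed.

Lemma mkpart_subproof (f : nat -> nat) (B : nat) :
  let s := if `[< forall i j, (i <= j)%N -> (f j <= f i)%N >]
           then [seq n <- mkseq f B | (0 < n)%N] else [::] in
  sorted geq s && (0%N \notin s).
Proof.
case: ifP => //= /asboolP mf; apply/andP; split; last by rewrite mem_filter.
apply: sorted_filter; first by move=> y x z /= xy yz; apply: leq_trans yz xy.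
apply: (@homo_sorted _ _ _ leq geq); last exact: iota_sorted.
by move=> i j ij; exact: mf.
Qed.

(** Total in [f]: a function that is not weakly decreasing yields the empty partition. [B] has to be
    a place where [f] vanishes for the rows to be the values of [f]. *)
Definition mkpart (f : nat -> nat) (B : nat) : part := Part (mkpart_subproof f B).

Lemma row_mkpart f B : (forall i j, (i <= j)%N -> (f j <= f i)%N) -> f B = 0%N ->
  forall i, prow (mkpart f B) i = f i.
Proof.
move=> mf fB i; rewrite /= asboolT //.
elim: B f mf fB i => [|B IH] f mf fB i /=.
  by rewrite nth_nil; apply/esym/eqP; rewrite -leqn0 -fB mf.
rewrite /mkseq /= (iotaDl 1 0) -map_comp.
have -> : [seq (f \o addn 1) i | i <- iota 0 B] = mkseq (f \o addn 1) B by [].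
have [f0|f0] := posnP (f 0%N).
  have fz j : f j = 0%N by apply/eqP; rewrite -leqn0 -f0 mf.
  rewrite fz /= (_ : filter _ _ = [::]) ?nth_nil //.
  apply/eqP; rewrite -size_eq0 size_filter eqn0Ngt -has_count.
  by apply/negP => /hasP[x /mapP[j _ ->]]; rewrite /= fz.
case: i => [|i] //=; rewrite IH //= => j k jk.
by apply: mf; rewrite leq_add2l.
Qed.

Lemma size_le_psize (mu : part) : (size mu <= psize mu)%N.
Proof.
have /andP[_] := part_axiom mu; rewrite /psize.
by elim: (Defs.pval mu) => //= n s IH; rewrite inE negb_or => /andP[n0 /IH]; lia.
Qed.

Lemma psizeE (mu : part) B : (size mu <= B)%N -> psize mu = (\sum_(i < B) prow mu i)%N.
Proof.
move=> mB; rewrite /psize sumnE (big_nth 0%N) -(big_mkord xpredT (fun i => prow mu i)).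
rewrite (big_cat_nat _ mB) //= [X in (_ + X)%N]big1_seq ?addn0 // => i.
by rewrite mem_index_iota => /andP[_ /andP[mi _]]; rewrite nth_default.
Qed.

Lemma row_le_psize (mu : part) i : (prow mu i <= psize mu)%N.
Proof.
rewrite (@psizeE mu (maxn (size mu) i.+1)) ?leq_maxl //.
have iB : (i < maxn (size mu) i.+1)%N by rewrite leq_max ltnSn orbT.
by rewrite (bigD1 (Ordinal iB)) //= leq_addr.
Qed.

Lemma row_psize (mu : part) : prow mu (psize mu) = 0%N.
Proof. by rewrite nth_default // size_le_psize. Qed.

Lemma psize_eq0 (mu : part) : (psize mu == 0%N) = (mu == part0).
Proof.
apply/eqP/eqP => [m0|->//]; apply: eq_part => i.
by have := row_le_psize mu i; rewrite m0 leqn0 => /eqP ->; rewrite nth_nil.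
Qed.

Definition parts (n : nat) : seq part :=
  undup [seq mu <- [seq mkpart (fun i => nth ord0 (codom f) i : 'I_n.+1) n
                   | f : {ffun 'I_n -> 'I_n.+1} <- enum {: {ffun 'I_n -> 'I_n.+1}}] | psize mu == n].

Lemma parts_uniq n : uniq (parts n).
Proof. exact: undup_uniq. Qed.

Lemma mem_parts n mu : (mu \in parts n) = (psize mu == n).
Proof.
rewrite mem_undup mem_filter; case: eqP => //= mun.
apply/mapP; exists [ffun i : 'I_n => inord (prow mu i)]; first by rewrite mem_enum.
have mur j : (prow mu j < n.+1)%N by rewrite ltnS -mun row_le_psize.
have e i : nth ord0 (codom [ffun i : 'I_n => inord (prow mu i) : 'I_n.+1]) i = prow mu i :> nat.
  have [ni|ni] := ltnP i n.
    rewrite /codom /image_mem (nth_map (Ordinal ni)) ?size_enum_ord //= ffunE.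
    by rewrite inordK ?mur // nth_enum_ord.
  rewrite (nth_default _ (leq_trans (size_le_psize mu) _)) ?mun //.
  by rewrite nth_default ?size_codom ?card_ord.
apply: eq_part => i; rewrite row_mkpart ?e // => [j k jk|].
  by rewrite !e leq_row.
by rewrite -mun row_psize.
Qed.

Lemma big_bij (T1 T2 : eqType) (V : nmodType) (r1 : seq T1) (r2 : seq T2)
    (P1 : pred T1) (P2 : pred T2) (f : T1 -> T2) (g : T2 -> T1)
    (F1 : T1 -> V) (F2 : T2 -> V) :
  uniq r1 -> uniq r2 ->
  (forall x, x \in r1 -> P1 x -> [/\ f x \in r2, P2 (f x) & g (f x) = x]) ->
  (forall y, y \in r2 -> P2 y -> [/\ g y \in r1, P1 (g y) & f (g y) = y]) ->
  (forall x, x \in r1 -> P1 x -> F1 x = F2 (f x)) ->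
  \sum_(x <- r1 | P1 x) F1 x = \sum_(y <- r2 | P2 y) F2 y.
Proof.
move=> u1 u2 fP gP FE; rewrite -big_filter -[RHS]big_filter.
have -> : \sum_(x <- [seq x <- r1 | P1 x]) F1 x =
          \sum_(x <- [seq x <- r1 | P1 x]) F2 (f x).
  by rewrite big_seq [RHS]big_seq; apply: eq_bigr => x; rewrite mem_filter => /andP[? ?]; exact: FE.
rewrite -(big_map f xpredT F2); apply: perm_big; apply: uniq_perm.
- rewrite map_inj_in_uniq ?filter_uniq // => x y.
  rewrite !mem_filter => /andP[Px xr] /andP[Py yr] e.
  by have [_ _ <-] := fP x xr Px; have [_ _ <-] := fP y yr Py; rewrite e.
- exact: filter_uniq.
- move=> y; apply/mapP/idP => [[x]|].
    by rewrite !mem_filter => /andP[Px xr] ->; have [-> -> _] := fP x xr Px.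
  rewrite mem_filter => /andP[Py yr]; have [gr Pg e] := gP y yr Py.
  by exists (g y); rewrite ?e // mem_filter gr Pg.
Qed.

(** A single index set for partitions of different sizes: sums over it can be exchanged, and the
    exact size turns into a filter. *)
Definition allparts (B : nat) : seq part := undup (flatten [seq parts n | n <- iota 0 B.+1]).

Lemma allparts_uniq B : uniq (allparts B).
Proof. exact: undup_uniq. Qed.

Lemma mem_allparts B mu : (mu \in allparts B) = (psize mu <= B)%N.
Proof.
rewrite mem_undup; apply/flatten_mapP/idP => [[n]|mB].
  by rewrite mem_iota ltnS => nB; rewrite mem_parts => /eqP ->.
by exists (psize mu); rewrite ?mem_parts // mem_iota ltnS.
Qed.

Lemma sum_parts (V : nmodType) n B (P : pred part) (F : part -> V) : (n <= B)%N ->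
  \sum_(mu <- parts n | P mu) F mu = \sum_(mu <- allparts B | (psize mu == n) && P mu) F mu.
Proof.
move=> nB; apply: (@big_bij _ _ _ _ _ _ _ id id).
- exact: parts_uniq.
- exact: allparts_uniq.
- by move=> x; rewrite mem_parts mem_allparts => /eqP -> ->; rewrite eqxx nB.
- by move=> y _ /andP[yn Py]; rewrite mem_parts.
- by [].
Qed.

(* [hs lam kap] says that lam / kap is a horizontal strip. *)
Definition hs (lam kap : part) : bool :=
  all (fun i => (prow kap i <= prow lam i) && (prow lam i.+1 <= prow kap i))%N
      (iota 0 (size lam + size kap)).

Lemma hsP lam kap :
  reflect (forall i, (prow kap i <= prow lam i)%N /\ (prow lam i.+1 <= prow kap i)%N)
          (hs lam kap).
Proof.
apply: (iffP allP) => [h i|h i _]; last by apply/andP.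
have [iB|iB] := ltnP i (size lam + size kap); first by apply/andP/h; rewrite mem_iota.
by rewrite !(nth_default 0%N (s := Defs.pval _)) //; move: iB; lia.
Qed.

Lemma leq_psize (kap lam : part) :
  (forall i, (prow kap i <= prow lam i)%N) -> (psize kap <= psize lam)%N.
Proof.
move=> h; pose B := maxn (size kap) (size lam).
rewrite (@psizeE kap B) ?leq_maxl // (@psizeE lam B) ?leq_maxr //.
exact: leq_sum.
Qed.

Lemma hs_psize lam kap : hs lam kap -> (psize kap <= psize lam)%N.
Proof. by move=> /hsP h; apply: leq_psize => i; case: (h i). Qed.

Lemma anti_step (f : nat -> nat) : (forall i, (f i.+1 <= f i)%N) ->
  forall i j, (i <= j)%N -> (f j <= f i)%N.
Proof.
move=> h i j /subnK <-; elim: (j - i)%N => // k IH.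
by apply: leq_trans IH; rewrite addSn.
Qed.

(** * Exchange of horizontal strips *)

Section HookSwap.
Variables nu ka : part.
Local Notation mi r := (minn (prow nu r) (prow ka r)).
Local Notation ma r := (maxn (prow nu r) (prow ka r)).

(** If [la / nu] and [la / ka] are horizontal strips, row [r.+1] of [la] ranges over the interval
    from [ma r.+1] to [mi r]; this is also the interval for row [r] of a partition [ta] with
    [nu / ta] and [ka / ta] horizontal strips. Reflecting the interval exchanges the two,
    independently in each row. Row 0 of [la] is bounded only below, by [ma 0]; its excess is the
    number [i] that [hs_up] puts back. *)
Definition hs_down (la : part) : part :=
  mkpart (fun r => mi r + ma r.+1 - prow la r.+1)%N (psize nu).

Definition hs_up (i : nat) (ta : part) : part :=
  mkpart (fun r => if r is r'.+1 then mi r' + ma r - prow ta r' else ma 0 + i)%N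
    (psize nu + psize ka).+1.

Lemma row_hs_down la : hs la nu -> hs la ka ->
  forall r, prow (hs_down la) r = (mi r + ma r.+1 - prow la r.+1)%N.
Proof.
move=> /hsP h1 /hsP h2; apply: row_mkpart.
  apply: anti_step => r.
  by have [? ?] := h1 r; have [? ?] := h2 r; have [? ?] := h1 r.+1; have [? ?] := h2 r.+1;
     have [? ?] := h1 r.+2; have [? ?] := h2 r.+2; lia.
have n0 := row_psize nu; have n1 := leq_row nu (leqnSn (psize nu)).
by have [] := h2 (psize nu).+1; move: n0 n1; lia.
Qed.

Lemma row_hs_up i ta : hs nu ta -> hs ka ta ->
  forall r, prow (hs_up i ta) r = if r is r'.+1 then (mi r' + ma r - prow ta r')%N else (ma 0 + i)%N.
Proof.
move=> /hsP h1 /hsP h2; apply: row_mkpart.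
  apply: anti_step => -[|r].
    by have [? ?] := h1 0%N; have [? ?] := h2 0%N; lia.
  by have [? ?] := h1 r; have [? ?] := h2 r; have [? ?] := h1 r.+1; have [? ?] := h2 r.+1; lia.
have l1 := leq_row nu (leq_addr (psize ka) (psize nu)).
have l2 := leq_row nu (leqW (leq_addr (psize ka) (psize nu))).
have l3 := leq_row ka (leqW (leq_addl (psize nu) (psize ka))).
by move: l1 l2 l3; rewrite !row_psize; lia.
Qed.

Lemma psize_swap la ta :
  (forall r, prow ta r + prow la r.+1 = mi r + ma r.+1)%N ->
  (psize ta + psize la + ma 0 = psize nu + psize ka + prow la 0)%N.
Proof.
move=> h; pose B := (psize ta + psize la + psize nu + psize ka)%N.
have sB (mu : part) : (psize mu <= B)%N -> (size mu <= B)%N := leq_trans (size_le_psize mu).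
have hta : (psize ta <= B)%N by rewrite /B; lia.
have hla : (psize la <= B)%N by rewrite /B; lia.
have hnu : (psize nu <= B)%N by rewrite /B; lia.
have hka : (psize ka <= B)%N by rewrite /B; lia.
have e : (\sum_(r < B) prow ta r + \sum_(r < B) prow la r.+1 =
          \sum_(r < B) mi r + \sum_(r < B) ma r.+1)%N.
  by rewrite -!big_split /=; apply: eq_bigr => r _; exact: h.
have e2 : (\sum_(r < B) mi r + \sum_(r < B.+1) ma r = psize nu + psize ka)%N.
  have -> : (\sum_(r < B) mi r = \sum_(r < B.+1) mi r)%N.
    rewrite big_ord_recr /= nth_default ?min0n ?addn0 //.
    exact: sB hnu.
  rewrite (psizeE (leqW (sB _ hnu))) (psizeE (leqW (sB _ hka))) -!big_split /=.
  by apply: eq_bigr => r _; lia.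
have e3 := psizeE (leqW (sB _ hla)).
move: e2 e3; rewrite !big_ord_recl /= (psizeE (sB _ hta)) => e2 e3.
have bE (f : nat -> nat) : (\sum_(i < B) f (bump 0 i) = \sum_(i < B) f i.+1)%N by [].
move: e e2 e3; rewrite (bE (fun i => ma i)) (bE (fun i => prow la i)).
set a := bigop _ _ _; set b := bigop _ _ _; set c := bigop _ _ _; set d := bigop _ _ _.
by lia.
Qed.

(** The counting form of the commutation relation between adding and removing horizontal strips; the
    sum over [i] is the geometric factor produced by the unbounded row 0. *)
Lemma hs_swap j B : (psize nu + j <= B)%N -> (psize ka <= B)%N ->
  (\sum_(la <- allparts B | [&& hs la nu, hs la ka & psize la == psize nu + j]) 1 =
   \sum_(i < j.+1) \sum_(ta <- allparts B |
       [&& hs nu ta, hs ka ta & psize ka + i == psize ta + j]) 1)%N.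
Proof.
move=> nB kB.
rewrite -(big_mkord xpredT (fun i => \sum_(ta <- allparts B |
       [&& hs nu ta, hs ka ta & psize ka + i == psize ta + j]) 1)%N) /=.
pose C (p : nat * part) := [&& hs nu p.2, hs ka p.2 & psize ka + p.1 == psize p.2 + j]%N.
transitivity (\sum_(p <- [seq (i, ta) | i <- index_iota 0 j.+1, ta <- allparts B] | C p) 1)%N;
  last by rewrite big_mkcond big_allpairs; apply: eq_bigr => i _; rewrite -big_mkcond.
apply: (@big_bij _ _ _ _ _ _ _ (fun la => (prow la 0 - ma 0, hs_down la)%N) (fun p => hs_up p.1 p.2)).
- exact: allparts_uniq.
- apply: allpairs_uniq; [exact: iota_uniq|exact: allparts_uniq|by move=> [? ?] [? ?] _ _ [-> ->]].
- move=> la _ /and3P[h1 h2 /eqP hl]; have hd := row_hs_down h1 h2.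
  move/hsP: (h1) => h1'; move/hsP: (h2) => h2'.
  have hn : hs nu (hs_down la).
    by apply/hsP => r; rewrite hd; have [? ?] := h1' r; have [? ?] := h2' r; have [? ?] := h1' r.+1; have [? ?] := h2' r.+1; lia.
  have hk : hs ka (hs_down la).
    by apply/hsP => r; rewrite hd; have [? ?] := h1' r; have [? ?] := h2' r; have [? ?] := h1' r.+1; have [? ?] := h2' r.+1; lia.
  have e : (psize (hs_down la) + psize la + ma 0 = psize nu + psize ka + prow la 0)%N.
    by apply: psize_swap => r; rewrite hd; have [? ?] := h1' r; have [? ?] := h2' r; lia.
  have l0 : (ma 0 <= prow la 0)%N by rewrite geq_max; case: (h1' 0%N) => -> _; case: (h2' 0%N) => -> _.
  have sn := hs_psize hn; have sk := hs_psize hk.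
  split.
  + apply/allpairsP; exists ((prow la 0 - ma 0)%N, hs_down la); split=> //=.
      by rewrite mem_iota; lia.
    by rewrite mem_allparts; lia.
  + by rewrite /C /= hn hk /=; apply/eqP; lia.
  + apply: eq_part => -[|r]; rewrite row_hs_up //=; first by lia.
    by rewrite hd; have [? ?] := h1' r; have [? ?] := h2' r; have [? ?] := h1' r.+1; have [? ?] := h2' r.+1; lia.
- move=> [i ta] pin; rewrite /C /= => /and3P[hn hk /eqP hl]; have hd := row_hs_up i hn hk.
  move/hsP: (hn) => h1'; move/hsP: (hk) => h2'.
  have h1 : hs (hs_up i ta) nu.
    apply/hsP => -[|r]; rewrite !hd; first by have [? ?] := h1' 0%N; have [? ?] := h2' 0%N; lia.
    by have [? ?] := h1' r; have [? ?] := h2' r; have [? ?] := h1' r.+1; have [? ?] := h2' r.+1; lia.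
  have h2 : hs (hs_up i ta) ka.
    apply/hsP => -[|r]; rewrite !hd; first by have [? ?] := h1' 0%N; have [? ?] := h2' 0%N; lia.
    by have [? ?] := h1' r; have [? ?] := h2' r; have [? ?] := h1' r.+1; have [? ?] := h2' r.+1; lia.
  have e : (psize ta + psize (hs_up i ta) + ma 0 = psize nu + psize ka + prow (hs_up i ta) 0)%N.
    by apply: psize_swap => r; rewrite hd; have [? ?] := h1' r; have [? ?] := h2' r; lia.
  rewrite hd in e; rewrite h1 h2 mem_allparts; split.
  + by have := hs_psize hn; lia.
  + by apply/eqP; have := hs_psize hn; lia.
  congr pair; first by rewrite hd; lia.
  apply: eq_part => r; rewrite row_hs_down // hd.
  by have [? ?] := h1' r; have [? ?] := h2' r; lia.
- by [].
Qed.

End HookSwap.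

Lemma sum_nat_mulr (R : pzSemiRingType) (T : Type) (r : seq T) (P : pred T) (c : R) :
  \sum_(x <- r | P x) c = c * (\sum_(x <- r | P x) 1)%N%:R.
Proof. by rewrite natr_sum mulr_sumr; apply: eq_bigr => x _; rewrite mulr1. Qed.

Lemma sum_allparts (V : nmodType) n (P : pred part) (F : part -> V) :
  \sum_(mu <- allparts n | P mu) F mu = \sum_(i < n.+1) \sum_(mu <- parts (n - i)%N | P mu) F mu.
Proof.
under [RHS]eq_bigr => i _ do rewrite (sum_parts _ _ (leq_subr i n)).
under [RHS]eq_bigr => i _ do rewrite big_mkcond /=.
rewrite exchange_big /= big_mkcond big_seq [RHS]big_seq; apply: eq_bigr => mu.
rewrite mem_allparts => mn.
have ni : (n - psize mu < n.+1)%N by rewrite ltnS leq_subr.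
rewrite (bigD1 (Ordinal ni)) //= subKn // eqxx /= big1 ?addr0 // => i.
rewrite -val_eqE /= => in0; case: eqP => //= e; case/eqP: in0.
by move: (ltn_ord i); lia.
Qed.

(** * Schur polynomials: Pieri rule and Cauchy identity *)

Section FiniteVariables.
Variable R : comNzRingType.
Implicit Types x y : nat -> R.

(* The Schur polynomial in [x 0], ..., [x N.-1], by the branching rule; [hx] is
   the complete homogeneous one. *)
Fixpoint sx x N lam : R :=
  if N is N'.+1 then
    \sum_(ka <- allparts (psize lam) | hs lam ka) x N' ^+ (psize lam - psize ka)%N * sx x N' ka
  else (lam == part0)%:R.

Fixpoint hx x N j : R :=
  if N is N'.+1 then \sum_(i < j.+1) x N' ^+ i * hx x N' (j - i)%N else (j == 0%N)%:R.

Arguments sx x N lam : simpl never.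
Arguments hx x N j : simpl never.

Lemma hxS x N j : hx x N.+1 j = \sum_(i < j.+1) x N ^+ i * hx x N (j - i)%N.
Proof. by []. Qed.

Lemma sxS x N lam B : (psize lam <= B)%N -> sx x N.+1 lam =
  \sum_(ka <- allparts B | hs lam ka) x N ^+ (psize lam - psize ka)%N * sx x N ka.
Proof.
move=> lB; apply: (@big_bij _ _ _ _ _ _ _ id id).
- exact: allparts_uniq.
- exact: allparts_uniq.
- by move=> ka; rewrite !mem_allparts => kl ->; split=> //; exact: leq_trans lB.
- by move=> ka _ h; rewrite mem_allparts h hs_psize.
- by [].
Qed.

(** Induction on the number of variables. The last variable is split off from each [la], [hs_swap]
    replaces the sum over [la] by one over [ta] below [nu] and [ka], the induction hypothesis sums
    over [ka], and what is left is the branching rule for [nu] times the recursion for [hx]. *)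
Lemma pieri x N nu j B : (psize nu + j <= B)%N ->
  \sum_(la <- allparts B | hs la nu && (psize la == psize nu + j)%N) sx x N la =
  hx x N j * sx x N nu.
Proof.
elim: N nu j => [|N IH] nu j nB.
  rewrite /sx /hx -natrM mulnb andbC.
  case: (eqVneq nu part0) => [->|nu0] /=; last first.
    rewrite big1 // => la /andP[_ /eqP la0]; rewrite -psize_eq0 la0 addn_eq0.
    by rewrite psize_eq0 (negPf nu0).
  case: (eqVneq j 0%N) => [->|j0] /=; last first.
    by rewrite big1 // => la /andP[_ /eqP la0]; rewrite -psize_eq0 la0 addn_eq0 (negPf j0).
  rewrite big_mkcond (bigD1_seq part0) ?allparts_uniq ?mem_allparts //=.
  by rewrite big1 ?addr0 // => la /negPf ->; rewrite if_same.
have step la : hs la nu && (psize la == psize nu + j)%N -> sx x N.+1 la =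
    \sum_(ka <- allparts B | hs la ka) x N ^+ (psize nu + j - psize ka)%N * sx x N ka.
  by move=> /andP[_ /eqP e]; rewrite (@sxS _ _ _ B) e.
rewrite (eq_bigr _ step) (exchange_big_dep xpredT) //=.
transitivity (\sum_(ka <- allparts B) x N ^+ (psize nu + j - psize ka)%N * sx x N ka *
  (\sum_(i < j.+1) \sum_(ta <- allparts B |
       [&& hs nu ta, hs ka ta & psize ka + i == psize ta + j]) 1)%N%:R).
  rewrite big_seq [RHS]big_seq; apply: eq_bigr => ka; rewrite mem_allparts => kB.
  by rewrite sum_nat_mulr -(hs_swap nB kB); congr (_ * _%:R); apply: eq_bigl => la; rewrite -andbA andbA andbAC -andbA.
rewrite hxS mulr_suml.
transitivity (\sum_(i < j.+1) \sum_(ta <- allparts B | hs nu ta)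
   \sum_(ka <- allparts B | hs ka ta && (psize ka == psize ta + (j - i)%N)%N)
     x N ^+ (psize nu + j - psize ka)%N * sx x N ka).
  under eq_bigr => ka _ do rewrite natr_sum mulr_sumr.
  rewrite exchange_big /=; apply: eq_bigr => i _.
  under eq_bigr => ka _ do rewrite -sum_nat_mulr big_mkcond.
  rewrite exchange_big /= [RHS]big_mkcond; apply: eq_bigr => ta _.
  case: ifP => [h|h]; last by rewrite big1.
  rewrite [RHS]big_mkcond; apply: eq_bigr => ka _ /=.
  rewrite (_ : (psize ka + i == psize ta + j)%N = (psize ka == psize ta + (j - i)%N)%N) //.
  by have ij := ltn_ord i; apply/eqP/eqP; lia.
apply: eq_bigr => i _; rewrite (sxS x N (leq_trans (leq_addr j _) nB)) mulr_sumr.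
apply: eq_bigr => ta h.
transitivity (x N ^+ (i + (psize nu - psize ta))%N * (hx x N (j - i)%N * sx x N ta)); last first.
  by rewrite exprD; ring.
have hn := hs_psize h; have ij := ltn_ord i.
rewrite -(IH ta (j - i)%N) ?mulr_sumr; last by lia.
by apply: eq_bigr => ka /andP[_ /eqP ->]; congr (_ ^+ _ * _); lia.
Qed.

Lemma sx0 x N : sx x N part0 = 1.
Proof.
elim: N => [|N IH]; first by rewrite /sx eqxx.
rewrite /sx -/(sx x).
rewrite big_mkcond (bigD1_seq part0) ?allparts_uniq ?mem_allparts //= IH.
rewrite big_seq_cond big1 => [|ka]; last first.
  by rewrite mem_allparts leqn0 psize_eq0 => /andP[/eqP ->]; rewrite eqxx.
by rewrite subnn addr0 mulr1.
Qed.

(** Splitting the last y-variable off [la] leaves [ka] with [la / ka] a horizontal strip of size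
    [i]; the Pieri rule in the x-variables then sums over [la]. *)
Lemma cauchy_sum x y N M n :
  \sum_(la <- parts n) sx x N la * sx y M.+1 la =
  \sum_(i < n.+1) y M ^+ i * hx x N i * (\sum_(la <- parts (n - i)%N) sx x N la * sx y M la).
Proof.
have e (la : part) : la \in parts n -> sx x N la * sx y M.+1 la =
    \sum_(i < n.+1) \sum_(ka <- parts (n - i)%N | hs la ka) sx x N la * (y M ^+ i * sx y M ka).
  rewrite mem_parts => /eqP ln; rewrite (@sxS _ _ _ n) ?ln // sum_allparts mulr_sumr.
  apply: eq_bigr => i _; rewrite mulr_sumr big_seq_cond [RHS]big_seq_cond.
  apply: eq_bigr => ka; rewrite mem_parts => /andP[/eqP -> _].
  by rewrite subKn // -ltnS.
rewrite big_seq (eq_bigr _ e) -big_seq exchange_big /=; apply: eq_bigr => i _.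
rewrite (exchange_big_dep xpredT) //= mulr_sumr big_seq [RHS]big_seq; apply: eq_bigr => ka.
rewrite mem_parts => /eqP kn; have ni := ltn_ord i; have kni : (psize ka + i = n)%N by lia.
rewrite -mulr_suml (sum_parts _ _ (leqnn n)).
have -> : \sum_(la <- allparts n | (psize la == n) && hs la ka) sx x N la = hx x N i * sx x N ka.
  rewrite -(@pieri _ _ _ _ n) ?kni //; apply: eq_bigl => la.
  by rewrite andbC.
by ring.
Qed.

(** The polynomial variable records the degree. Only coefficients of degree at most [B] are read, so
    cutting the geometric series there loses nothing. *)
Definition geom (B : nat) (z : R) : {poly R} := \poly_(k < B.+1) z ^+ k.

Lemma coef_prod_geom x N B n : (n <= B)%N -> (\prod_(i < N) geom B (x i))`_n = hx x N n.
Proof.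
elim: N n => [|N IH] n nB; first by rewrite big_ord0 coef1.
rewrite big_ord_recr /= mulrC coefM; apply: eq_bigr => i _.
by have ni := ltn_ord i; rewrite coef_poly IH ?ifT //; lia.
Qed.

Lemma hx_scale x N n (c : R) : hx (fun i => x i * c) N n = c ^+ n * hx x N n.
Proof.
elim: N n => [|N IH] n.
  by rewrite /hx; case: n => [|n]; rewrite ?expr0 ?mulr1 // mulr0.
rewrite !hxS mulr_sumr; apply: eq_bigr => i _; rewrite IH exprMn.
have /subnKC e : (i <= n)%N by rewrite -ltnS.
have -> : c ^+ n = c ^+ i * c ^+ (n - i)%N by rewrite -exprD e.
by ring.
Qed.

Lemma cauchy x y N M B n : (n <= B)%N ->
  (\prod_(p : 'I_N * 'I_M) geom B (x p.1 * y p.2))`_n =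
  \sum_(la <- parts n) sx x N la * sx y M la.
Proof.
rewrite -(pair_bigA _ (fun (i : 'I_N) (j : 'I_M) => geom B (x i * y j))) exchange_big /=.
elim: M n => [|M IH] n nB.
  rewrite big_ord0 coef1; case: n nB => [|n] _ /=.
    rewrite (bigD1_seq part0) ?mem_parts ?parts_uniq //= sx0 big1_seq ?addr0 ?mul1r.
      by rewrite sx0.
    by move=> la /andP[la0]; rewrite mem_parts psize_eq0 (negPf la0).
  rewrite big1_seq // => la; rewrite mem_parts /sx -/(sx x) => /= /eqP ln.
  by rewrite -psize_eq0 ln mulr0.
rewrite big_ord_recr /= mulrC coefM cauchy_sum; apply: eq_bigr => i _.
have ni := ltn_ord i.
by rewrite (coef_prod_geom (fun i => x i * y M)) ?hx_scale ?IH //; lia.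
Qed.

End FiniteVariables.

Arguments sx {R} x N lam : simpl never.
Arguments hx {R} x N j : simpl never.

(** * Tableaux *)

Local Notation tb T i j := (nth 0%N (nth [::] T i) j).

Definition mktab (lam : part) (f : nat -> nat -> nat) : seq (seq nat) :=
  mkseq (fun i => mkseq (f i) (prow lam i)) (size lam).

Lemma prow_lt_size (lam : part) i j : (j < prow lam i)%N -> (i < size lam)%N.
Proof. by move=> h; rewrite -row_gt0; exact: leq_ltn_trans h. Qed.

Lemma shape_mktab lam f : shape (mktab lam f) = lam.
Proof.
apply: (@eq_from_nth _ 0%N); first by rewrite /shape size_map size_mkseq.
move=> i; rewrite /shape size_map size_mkseq => il.
by rewrite (nth_map [::]) ?size_mkseq // nth_mkseq // size_mkseq.
Qed.

Lemma nth_mktab lam f i j : (j < prow lam i)%N -> tb (mktab lam f) i j = f i j.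
Proof. by move=> h; rewrite nth_mkseq ?(prow_lt_size h) // nth_mkseq. Qed.

Lemma eq_mktab lam f g : (forall i j, (j < prow lam i)%N -> f i j = g i j) ->
  mktab lam f = mktab lam g.
Proof.
move=> fg; apply: (@eq_from_nth _ [::]); first by rewrite !size_mkseq.
move=> i; rewrite size_mkseq => il; rewrite !nth_mkseq //.
apply: (@eq_from_nth _ 0%N); first by rewrite !size_mkseq.
by move=> j; rewrite size_mkseq => jl; rewrite !nth_mkseq ?fg.
Qed.

Lemma size_nth_shape (T : seq (seq nat)) i : size (nth [::] T i) = nth 0%N (shape T) i.
Proof.
have [iT|iT] := ltnP i (size T); first by rewrite (nth_map [::]).
by rewrite !nth_default // size_map.
Qed.

Lemma mktab_tb (lam : part) T : shape T = lam -> T = mktab lam (fun i j => tb T i j).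
Proof.
move=> sT; have sz : size T = size lam by rewrite -sT size_map.
apply: (@eq_from_nth _ [::]); first by rewrite size_mkseq.
move=> i iT; rewrite nth_mkseq -?sz //.
apply: (@eq_from_nth _ 0%N); first by rewrite size_mkseq size_nth_shape sT.
by move=> j; rewrite size_nth_shape sT => jl; rewrite nth_mkseq.
Qed.

Lemma flatten_mktabP lam f k :
  reflect (exists i j, (j < prow lam i)%N /\ k = f i j) (k \in flatten (mktab lam f)).
Proof.
apply: (iffP flattenP) => [[r /mapP[i]]|[i [j [jl ->]]]].
  rewrite mem_iota => _ -> /mapP[j]; rewrite mem_iota => /= jl ->.
  by exists i, j.
exists (mkseq (f i) (prow lam i)).
  by apply/mapP; exists i => //; rewrite mem_iota (prow_lt_size jl).
by apply/mapP; exists j => //; rewrite mem_iota.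
Qed.

Definition istab (lam : part) (f : nat -> nat -> nat) : Prop :=
  forall i j, (j < prow lam i)%N ->
    [/\ (0 < f i j)%N, ((j.+1 < prow lam i) ==> (f i j <= f i j.+1))%N
      & ((j < prow lam i.+1) ==> (f i j < f i.+1 j))%N].

Lemma ssyt_mktab lam f : ssyt lam (mktab lam f) <-> istab lam f.
Proof.
split=> [[_ h0 hr hc] i j jl|h].
  have il := prow_lt_size jl; split.
  - by apply: h0; apply/flatten_mktabP; exists i, j.
  - apply/implyP => jl'.
    have /hr s : mkseq (f i) (prow lam i) \in mktab lam f.
      by apply/mapP; exists i => //; rewrite mem_iota.
    have := sorted_leq_nth leq_trans leqnn 0%N s j j.+1.
    by rewrite !inE !size_mkseq !nth_mkseq //; apply.
  - apply/implyP => jl'; have il' := prow_lt_size jl'.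
    have := hc i j; rewrite size_mkseq size_nth_shape shape_mktab !nth_mktab //.
    by apply.
split.
- exact: shape_mktab.
- by move=> k /flatten_mktabP[i [j [jl ->]]]; case: (h i j jl).
- move=> r /mapP[i _ ->]; apply/(sortedP 0%N) => j; rewrite size_mkseq => jl.
  by rewrite !nth_mkseq // ?(ltnW jl) //; case: (h i j (ltnW jl)); rewrite jl.
- move=> i j; rewrite size_nth_shape shape_mktab => _ jl.
  have jl' := leq_trans jl (leq_row lam (leqnSn i)).
  by rewrite !nth_mktab //; case: (h i j jl'); rewrite jl.
Qed.

Lemma big_mktab (T : Type) (idx : T) (op : Monoid.law idx) (g : nat -> T) (lam : part) f B :
  (size lam <= B)%N ->
  \big[op/idx]_(k <- flatten (mktab lam f)) g k =
  \big[op/idx]_(i < B) \big[op/idx]_(j < prow lam i) g (f i j).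
Proof.
move=> lB; rewrite big_flatten big_map /=.
rewrite -(big_mkord xpredT (fun i => \big[op/idx]_(j < prow lam i) g (f i j))).
rewrite (big_cat_nat _ lB) //= [X in _ = op _ X]big1_seq ?Monoid.mulm1; last first.
  by move=> i; rewrite mem_index_iota => /andP[_ /andP[li _]]; rewrite nth_default // big_ord0.
rewrite /index_iota subn0; apply: eq_bigr => i _.
by rewrite big_map -(big_mkord xpredT (fun j => g (f i j))) /index_iota subn0.
Qed.

Lemma count_mktab (P : pred nat) (lam : part) f B : (size lam <= B)%N ->
  count P (flatten (mktab lam f)) = (\sum_(i < B) \sum_(j < prow lam i) P (f i j))%N.
Proof. by move=> lB; rewrite -sum1_count big_mkcond -(big_mktab _ (fun k => P k : nat)). Qed.

Definition tabs (N : nat) (lam : part) : seq (seq (seq nat)) :=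
  let n := psize lam in
  undup [seq T <- [seq mktab lam (fun i j => f (inord i, inord j) : nat)
                  | f : {ffun 'I_n.+1 * 'I_n.+1 -> 'I_N.+1} <- enum {: {ffun 'I_n.+1 * 'I_n.+1 -> 'I_N.+1}}]
        | `[< ssyt lam T >]].

Lemma tabs_uniq N lam : uniq (tabs N lam).
Proof. exact: undup_uniq. Qed.

Lemma mem_tabs N lam T :
  (T \in tabs N lam) = `[< ssyt lam T >] && all (leq^~ N) (flatten T).
Proof.
rewrite mem_undup mem_filter; case: asboolP => //= sT.
have TE : T = mktab lam (fun i j => tb T i j) by apply: mktab_tb; case: sT.
apply/mapP/allP => [[f _ ->] k /flatten_mktabP[i [j [_ ->]]]|hT].
  by rewrite -ltnS.
exists [ffun p : 'I_(psize lam).+1 * 'I_(psize lam).+1 => inord (tb T p.1 p.2)].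
  by rewrite mem_enum.
rewrite [LHS]TE; apply: eq_mktab => i j jl; rewrite ffunE /=.
have il := prow_lt_size jl.
have -> : @inord (psize lam) i = i :> nat.
  by rewrite inordK // ltnS (leq_trans (ltnW il)) ?size_le_psize.
have -> : @inord (psize lam) j = j :> nat.
  by rewrite inordK // ltnS (leq_trans (ltnW jl)) ?row_le_psize.
rewrite inordK // ltnS; apply: hT; rewrite TE.
by apply/flatten_mktabP; exists i, j; rewrite nth_mktab.
Qed.

Lemma mem_tabs_mktab N lam f :
  (mktab lam f \in tabs N lam) <->
  istab lam f /\ (forall i j, (j < prow lam i)%N -> (f i j <= N)%N).
Proof.
rewrite mem_tabs; split.
  move=> /andP[/asboolP/ssyt_mktab h /allP hN]; split=> // i j jl.
  by apply: hN; apply/flatten_mktabP; exists i, j.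
case=> h hN; apply/andP; split; first by apply/asboolP/ssyt_mktab.
by apply/allP => k /flatten_mktabP[i [j [jl ->]]]; exact: hN.
Qed.

Lemma tabs_mktab N lam T : T \in tabs N lam ->
  exists f, [/\ T = mktab lam f, istab lam f &
    forall i j, (j < prow lam i)%N -> (f i j <= N)%N].
Proof.
move=> hT; have := hT; rewrite mem_tabs => /andP[/asboolP[sT _ _ _] _].
exists (fun i j => tb T i j); have TE := mktab_tb sT; split=> //.
all: by move: hT; rewrite {1}TE => /mem_tabs_mktab[].
Qed.

(** In a weakly increasing row the entries at most [N] form an initial segment. This serves for rows
    of tableaux and again for the column lengths of a partition. *)
Lemma count_sorted (g : nat -> nat) n N :
  (forall j, (j.+1 < n)%N -> (g j <= g j.+1)%N) ->
  forall j, (j < n)%N -> (g j <= N)%N = (j < \sum_(k < n) (g k <= N))%N.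
Proof.
move=> gm; have mono j k : (k < n)%N -> (j <= k)%N -> (g j <= g k)%N.
  elim: k => [|k IH] kn; first by rewrite leqn0 => /eqP ->.
  rewrite leq_eqVlt => /predU1P[-> //|jk].
  exact: leq_trans (IH (ltnW kn) jk) (gm _ kn).
elim: n gm mono => [//|n IH] gm mono j; rewrite big_ord_recr /= ltnS => jn.
have IH' := IH (fun j jn => gm j (leqW jn)) (fun j k kn => mono j k (leqW kn)).
have le : (\sum_(k < n) (g k <= N) <= n)%N.
  by rewrite -[leqRHS]card_ord -sum1_card; apply: leq_sum => i _; exact: leq_b1.
move: jn; rewrite leq_eqVlt => /predU1P[->|jn].
  case: (leqP (g n) N) => [gN|_]; last by rewrite addn0 ltnNge le.
  rewrite (eq_bigr (fun=> 1%N)); first by rewrite sum1_card card_ord addn1 ltnSn.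
  by move=> i _; rewrite (leq_trans (mono i n _ _) gN) // ltnW.
rewrite IH' //; case: (leqP (g n) N) => [gN|_]; last by rewrite addn0.
rewrite (eq_bigr (fun=> 1%N)) ?sum1_card ?card_ord ?jn ?addn1 ?(leqW jn) // => i _.
by rewrite (leq_trans (mono i n _ _) gN) // ltnW.
Qed.

Lemma tabs0 lam : tabs 0 lam = if lam == part0 then [:: [::]] else [::].
Proof.
case: eqP => [->|l0].
  apply: perm_small_eq => //; apply: uniq_perm => //; first exact: tabs_uniq.
  move=> T; rewrite inE mem_tabs; apply/andP/eqP => [[/asboolP[sT _ _ _] _]|->].
    by apply/eqP; rewrite -size_eq0 -(size_map size) -/(shape T) sT.
  by split=> //; apply/asboolP; split.
case E : (tabs 0 lam) => [//|T s]; have : T \in tabs 0 lam by rewrite E mem_head.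
case/tabs_mktab => f [_ h h0]; case: l0; apply/eqP; rewrite -psize_eq0.
have [|l0] := posnP (prow lam 0).
  move=> l0; rewrite psize_eq0; apply/eqP/eq_part => i; rewrite nth_nil.
  by apply/eqP; rewrite -leqn0 -[leqRHS]l0 leq_row.
by case: (h 0%N 0%N l0); rewrite ltnNge h0.
Qed.

(** The shape occupied by the entries at most [N]. When all entries are at most [N.+1], column
    strictness makes the erased cells a horizontal strip. *)
Definition cut (N : nat) (lam : part) (f : nat -> nat -> nat) : part :=
  mkpart (fun i => \sum_(j < prow lam i) (f i j <= N))%N (size lam).

Lemma eq_cut N lam f g : (forall i j, (j < prow lam i)%N -> f i j = g i j) ->
  cut N lam f = cut N lam g.
Proof.
move=> fg; congr mkpart; apply/funext => i; apply: eq_bigr => j _.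
by rewrite fg.
Qed.

Section CutTableau.
Variables (N : nat) (lam : part) (f : nat -> nat -> nat).
Hypothesis hf : istab lam f.
Hypothesis hN : forall i j, (j < prow lam i)%N -> (f i j <= N.+1)%N.

Let c i : nat := (\sum_(j < prow lam i) (f i j <= N))%N.

Let cP i j : (j < prow lam i)%N -> (f i j <= N)%N = (j < c i)%N.
Proof.
move=> jl; apply: (count_sorted (g := f i)) => // k kl.
by case: (hf (ltnW kl)) => _; rewrite kl.
Qed.

Let c_le i : (c i <= prow lam i)%N.
Proof.
rewrite -[leqRHS]card_ord -sum1_card; apply: leq_sum => j _; exact: leq_b1.
Qed.

Let c_ge i : (prow lam i.+1 <= c i)%N.
Proof.
rewrite leqNgt; apply/negP => h; have h' := leq_trans h (leq_row lam (leqnSn i)).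
have := cP h'; rewrite ltnn => /negP[].
by case: (hf h') => _ _ /implyP/(_ h) lt; rewrite -ltnS; apply: leq_trans lt (hN h).
Qed.

Lemma prow_cut i : prow (cut N lam f) i = c i.
Proof.
apply: row_mkpart; first by apply: anti_step => k; exact: leq_trans (c_le _) (c_ge _).
by rewrite nth_default // big_ord0.
Qed.

Lemma hs_cut : hs lam (cut N lam f).
Proof. by apply/hsP => i; rewrite prow_cut. Qed.

Lemma ltn_cut i j : (j < prow lam i)%N -> (j < prow (cut N lam f) i)%N = (f i j <= N)%N.
Proof. by move=> jl; rewrite prow_cut cP. Qed.

End CutTableau.

(** Induction on [N]: erasing the letter [N.+1] matches the branching rule, and the inverse map
    fills the strip with [N.+1]. Letters start at 1 and variables at 0, whence [k.-1]. *)
Lemma sx_tabs (R : comNzRingType) (x : nat -> R) N lam :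
  sx x N lam = \sum_(T <- tabs N lam) \prod_(k <- flatten T) x k.-1.
Proof.
elim: N lam => [|N IH] lam.
  rewrite tabs0 /sx; case: eqP => _; last by rewrite big_nil.
  by rewrite big_seq1 big_nil.
rewrite (@sxS _ _ _ _ (psize lam)) //.
pose w T : R := \prod_(k <- flatten T) x k.-1.
transitivity (\sum_(p <- [seq (ka, T) | ka <- allparts (psize lam), T <- tabs N ka] | hs lam p.1)
    x N ^+ (psize lam - psize p.1)%N * w p.2).
  rewrite [RHS]big_mkcond big_allpairs_dep [LHS]big_mkcond /=. apply: eq_bigr => ka _.
  by case: ifP => _; [rewrite IH mulr_sumr | rewrite big1].
apply/esym; apply: (@big_bij _ _ _ _ _ _ _
  (fun T => let ka := cut N lam (fun i j => tb T i j) in (ka, mktab ka (fun i j => tb T i j)))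
  (fun p => mktab lam (fun i j => if (j < prow p.1 i)%N then tb p.2 i j else N.+1))).
- exact: tabs_uniq.
- apply: allpairs_uniq_dep => [|ka _|[? ?] [? ?] _ _ [-> ->]] //.
    exact: allparts_uniq.
  exact: tabs_uniq.
- move=> T hT _ /=; have := hT; rewrite mem_tabs => /andP[/asboolP[sT _ _ _] _].
  have TE := mktab_tb sT; set f := (fun i j => tb T i j) in TE *.
  move: hT; rewrite {1}TE => /mem_tabs_mktab[hf hN]; have cl := ltn_cut hf hN.
  have chs := hs_cut hf hN; have cl' i j : (j < prow (cut N lam f) i)%N -> (j < prow lam i)%N.
    by move=> jc; have /hsP/(_ i)[le _] := chs; exact: leq_trans jc le.
  split=> //.
  + apply/allpairsPdep; exists (cut N lam f), (mktab (cut N lam f) f); split=> //.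
      by rewrite mem_allparts hs_psize.
    apply/mem_tabs_mktab; split=> [i j jc|i j jc]; last by rewrite -cl ?cl'.
    have jl := cl' _ _ jc; case: (hf i j jl) => h1 h2 h3; split=> //.
      by apply/implyP => /cl' jl'; rewrite jl' in h2.
    by apply/implyP => /cl' jl'; rewrite jl' in h3.
  + rewrite [RHS]TE; apply: eq_mktab => i j jl; rewrite cl //; case: ifP => h.
      by rewrite nth_mktab // cl.
    by apply/eqP; rewrite eqn_leq hN // andbT ltnNge h.
- move=> [ka T] /allpairsPdep[ka' [T' [_ hT [e1 e2]]]]; subst ka' T' => /= hlk.
  have := hT => /tabs_mktab[f [TE hf hN]].
  have /hsP kl := hlk.
  pose g i j := if (j < prow ka i)%N then tb T i j else N.+1.
  have gE i j : (j < prow ka i)%N -> g i j = f i j by move=> h; rewrite /g h TE nth_mktab.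
  have gE' i j : (prow ka i <= j)%N -> g i j = N.+1 by move=> h; rewrite /g ltnNge h.
  have gle i j : (g i j <= N.+1)%N.
    by case: (ltnP j (prow ka i)) => h; [rewrite gE // leqW // hN | rewrite gE'].
  have hg : istab lam g.
    move=> i j jl; split.
    * case: (ltnP j (prow ka i)) => h; last by rewrite gE'.
      by rewrite gE //; case: (hf i j h).
    * apply/implyP => jl'; case: (ltnP j.+1 (prow ka i)) => h; last by rewrite [g i j.+1]gE'.
      by rewrite !gE ?(ltnW h) //; case: (hf i j (ltnW h)); rewrite h.
    * apply/implyP => jl'; have h : (j < prow ka i)%N by case: (kl i) => _; apply: leq_trans.
      rewrite (gE i) //; case: (ltnP j (prow ka i.+1)) => h'.
        by rewrite gE //; case: (hf i j h); rewrite h'.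
      by rewrite gE' // ltnS hN.
  have cE : cut N lam (fun i j => tb (mktab lam g) i j) = ka.
    rewrite (@eq_cut N lam _ g) => [|i j h]; last by rewrite nth_mktab.
    apply: eq_part => i; have ki : (prow ka i <= prow lam i)%N by case: (kl i).
    have ci : (prow (cut N lam g) i <= prow lam i)%N by have /hsP/(_ i)[] := hs_cut hg (fun i j _ => gle i j).
    have gc j : (j < prow lam i)%N -> (j < prow (cut N lam g) i)%N = (j < prow ka i)%N.
      move=> jl; rewrite ltn_cut //; case: (ltnP j (prow ka i)) => h; first by rewrite gE // hN.
      by rewrite gE' // ltnn.
    apply/eqP; rewrite eqn_leq; apply/andP; split; rewrite leqNgt; apply/negP => h.
      by have := gc _ (leq_trans h ci); rewrite h ltnn.
    by have := gc _ (leq_trans h ki); rewrite h ltnn.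
  rewrite (_ : mktab lam _ = mktab lam g) //; split=> //.
  + by apply/mem_tabs_mktab; split=> // i j _; exact: gle.
  + rewrite cE; congr pair; rewrite [RHS]TE; apply: eq_mktab => i j h.
    have jl : (j < prow lam i)%N by case: (kl i) => h' _; exact: leq_trans h'.
    by rewrite nth_mktab // gE.
- move=> T /tabs_mktab[f [TE hf hN]] _ /=.
  have fE i j : (j < prow lam i)%N -> tb T i j = f i j.
    by move=> h; rewrite TE nth_mktab.
  have cl := ltn_cut hf hN; have /hsP hc := hs_cut hf hN; have cP := hs_psize (hs_cut hf hN).
  rewrite (eq_cut _ fE); set ka := cut N lam f in cl hc cP *; rewrite TE /w.
  pose B := (size lam + size ka)%N.
  have lB : (size lam <= B)%N by exact: leq_addr.
  have kB : (size ka <= B)%N by exact: leq_addl.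
  rewrite !(@big_mktab _ _ _ _ _ _ B) //.
  have -> : (psize lam - psize ka = \sum_(i < B) (prow lam i - prow ka i))%N.
    rewrite (psizeE lB) (psizeE kB) sumnB // => i _.
    by case: (hc i).
  rewrite -prodrXr -big_split /=; apply: eq_bigr => i _.
  have ki : (prow ka i <= prow lam i)%N by case: (hc i).
  rewrite -(big_mkord xpredT (fun j => x (f i j).-1)) (big_cat_nat _ ki) //= mulrC.
  rewrite -(big_mkord xpredT (fun j => x (tb (mktab lam f) i j).-1)); congr (_ * _).
    rewrite -prodr_const_nat big_nat [RHS]big_nat; apply: eq_bigr => j /andP[kj jl].
    have : ~~ (f i j <= N)%N by rewrite -cl // -leqNgt.
    rewrite -ltnNge => h; have /eqP -> // : f i j == N.+1.
    by rewrite eqn_leq hN.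
  rewrite big_nat [RHS]big_nat; apply: eq_bigr => j /andP[_ kj].
  by rewrite nth_mktab // (leq_trans kj).
Qed.

(** * Power series *)

Lemma fsbig_seqE (V : nmodType) (T : choiceType) (A : set T) (r : seq T) (f : T -> V) :
  uniq r -> (forall x, x \in r -> A x) -> (forall x, A x -> x \notin r -> f x = 0) ->
  \sum_(x \in A) f x = \sum_(x <- r) f x.
Proof.
move=> ur rA f0; have rA' : [set` r] `<=` A by move=> x /=; exact: rA.
rewrite (@fsbigE _ _ _ _ A r f ur rA' f0).
by rewrite big_seq_cond [RHS]big_seq_cond; apply: eq_bigl => x;
  rewrite andbT; case: (boolP (x \in r)) => //= /rA xA; rewrite mem_set.
Qed.

Section FpsCoef.
Variables (I : choiceType) (R : comNzRingType).
Local Notation mon := {mset I}%mset.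
Implicit Types (f g : fps I R) (m : mon).

Definition submsets m : seq mon := fset_set [set a : mon | msubset a m].

Lemma mem_submsets m a : (a \in submsets m) = msubset a m.
Proof.
by rewrite /submsets in_fset_set ?inE //;
  [apply/idP/idP; rewrite inE | exact: finite_submset].
Qed.

Definition splits m : seq (mon * mon) :=
  [seq p <- [seq (a, b) | a <- submsets m, b <- submsets m] | msetD p.1 p.2 == m].

Lemma splits_uniq m : uniq (splits m).
Proof.
by rewrite filter_uniq // allpairs_uniq ?fset_uniq // => -[? ?] [? ?] _ _ [-> ->].
Qed.

Lemma mem_splits m p : (p \in splits m) = (msetD p.1 p.2 == m).
Proof.
rewrite mem_filter; case: eqP => //= e; apply/allpairsP; exists p.
by rewrite !mem_submsets -e; split=> //; [| |by case: p e];
  apply/msubsetP => x; rewrite msetE2 ?leq_addr ?leq_addl.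
Qed.

Lemma fcoefM f g m : coef (f * g) m = \sum_(p <- splits m) coef f p.1 * coef g p.2.
Proof.
rewrite -[LHS]/(coef (fps_mul f g) m) /=; apply: fsbig_seqE.
- exact: splits_uniq.
- by move=> p; rewrite mem_splits => /eqP.
- by move=> p /= /eqP pm; rewrite mem_splits pm.
Qed.

Lemma fcoefD f g m : coef (f + g) m = coef f m + coef g m.
Proof. by []. Qed.

Lemma fcoefN f m : coef (- f) m = - coef f m.
Proof. by []. Qed.

Lemma fcoef0 m : coef (0 : fps I R) m = 0.
Proof. by rewrite -[LHS]/(if m == mset0 then 0 else 0) if_same. Qed.

Lemma fcoef1 m : coef (1 : fps I R) m = (m == mset0)%:R.
Proof. by rewrite -[LHS]/(if m == mset0 then 1 else 0); case: eqP. Qed.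

Lemma fcoef_sum (T : Type) (r : seq T) (P : pred T) (F : T -> fps I R) m :
  coef (\sum_(x <- r | P x) F x) m = \sum_(x <- r | P x) coef (F x) m.
Proof.
apply: (big_morph (fun f => coef f m)); [exact: (fun f g => fcoefD f g m) | exact: fcoef0].
Qed.

Lemma fcoefCM (c : R) f m : coef (fpsC I c * f) m = c * coef f m.
Proof.
rewrite fcoefM (bigD1_seq (mset0, m)) ?splits_uniq ?mem_splits ?mset0D //=.
rewrite eqxx big1_seq ?addr0 // => -[a b] /andP[ab]; rewrite mem_splits /= => /eqP e.
case: eqP => a0; last by rewrite mul0r.
by move: ab; rewrite -e a0 mset0D eqxx.
Qed.

Lemma fpsC_is_zmod_morphism : zmod_morphism (@fpsC I R).
Proof.
move=> a b; apply: fpsP => m; rewrite fcoefD fcoefN /=.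
by case: eqP => _ //; rewrite subr0.
Qed.

Lemma fpsC_is_monoid_morphism : monoid_morphism (@fpsC I R).
Proof.
split=> [|a b]; first by [].
by apply: fpsP => m; rewrite fcoefCM /=; case: eqP => _ //; rewrite mulr0.
Qed.

HB.instance Definition _ :=
  GRing.isZmodMorphism.Build R (fps I R) (@fpsC I R) fpsC_is_zmod_morphism.
HB.instance Definition _ :=
  GRing.isMonoidMorphism.Build R (fps I R) (@fpsC I R) fpsC_is_monoid_morphism.

Definition mono (a : mon) : fps I R := Fps (fun m => (m == a)%:R).

Lemma monoD a b : mono (msetD a b) = mono a * mono b.
Proof.
apply: fpsP => m; rewrite fcoefM /=; case: eqP => [->|ne].
  rewrite (bigD1_seq (a, b)) ?splits_uniq ?mem_splits //= !eqxx mulr1.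
  rewrite big1 ?addr0 // => -[c d]; rewrite xpair_eqE negb_and /=.
  by case/orP => /negPf ->; rewrite ?mul0r ?mulr0.
rewrite big1_seq // => -[c d] /=; rewrite mem_splits /= => /eqP e.
case: eqP => [ca|_]; rewrite ?mul0r //; case: eqP => [db|_]; rewrite ?mulr0 //.
by case: ne; rewrite -e ca db.
Qed.

Lemma mono0 : mono mset0 = 1.
Proof. by apply: fpsP => m; rewrite fcoef1. Qed.

Lemma prod_fpsX (s : seq I) : \prod_(k <- s) fpsX R k = mono (seq_mset s).
Proof.
elim: s => [|k s IH]; first by rewrite big_nil -mono0; congr mono; apply/esym/msetP => x; rewrite mset_seqE mset0E.
by rewrite big_cons IH mset_cons monoD; congr (_ * _).
Qed.

End FpsCoef.

Lemma fcoef_fps_sum_seq (I : choiceType) (R : comNzRingType) (T : choiceType) (A : set T)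
    (r : seq T) (F : T -> fps I R) m : uniq r -> (forall x, x \in r -> A x) ->
  (forall x, A x -> x \notin r -> coef (F x) m = 0) ->
  coef (fps_sum A F) m = \sum_(x <- r) coef (F x) m.
Proof. exact: fsbig_seqE. Qed.

(** A tableau contributing to [m] has all its entries in [m], so tableaux with entries at most [N]
    account for the whole coefficient. *)
Lemma coef_schur N lam (m : {mset nat}%mset) : (forall i, i \in m -> (i <= N)%N) ->
  coef (schur lam) m = coef (sx (fun k => fpsX algC k.+1) N lam) m.
Proof.
move=> mN; rewrite sx_tabs fcoef_sum (@fcoef_fps_sum_seq _ _ _ _ (tabs N lam)).
- apply: eq_big_seq => T; rewrite mem_tabs => /andP[/asboolP[_ T0 _ _] _].
  apply: (congr1 (fun f => coef f m)); apply: eq_big_seq => k /T0 k0.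
  by apply: (congr1 (@fpsX _ _)); case: k k0.
- exact: tabs_uniq.
- by move=> T; rewrite mem_tabs => /andP[/asboolP].
- move=> T sT; rewrite mem_tabs asboolT //= prod_fpsX /=; case: eqP => // mE /negP[].
  apply/allP => k kT; apply: mN; rewrite mE in_mset mset_seqE.
  by rewrite -has_count; apply/hasP; exists k => /=.
Qed.

(** * Words fixed by permutations *)

Section CycleProducts.
Variables (n : nat) (R : comNzRingType).
Implicit Types s t : 'S_n.

(** With the power sums for [p], this is p_sigma, the power sum product of the cycle type of [s]. *)
Definition cyc (p : nat -> R) s : R := \prod_(B in porbits s) p #|B|.

Lemma cycM p q s : cyc (fun k => p k * q k) s = cyc p s * cyc q s.
Proof. exact: big_split. Qed.

Definition fixes (A : Type) (w : 'I_n -> A) s : Prop := forall k, w (s k) = w k.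

Lemma fixes_porbit (A : Type) (w : 'I_n -> A) s : fixes w s ->
  forall k l, l \in porbit s k -> w l = w k.
Proof.
move=> ws k l /porbitP[i ->]; elim: i => [|i IH]; first by rewrite expg0 perm1.
by rewrite expgSr permM ws.
Qed.

(** Expanding the product of sums chooses a letter for each cycle, that is, a word constant on the
    cycles of [s]. *)
Lemma cyc_words (A : finType) (a0 : A) (Z : A -> R) s :
  cyc (fun k => \sum_(a : A) Z a ^+ k) s =
  \sum_(w : {ffun 'I_n -> A} | [forall k, w (s k) == w k]) \prod_(k < n) Z (w k).
Proof.
rewrite /cyc (big_distr_big a0) /=.
(* The expansion ranges over functions on all sets, equal to [a0] off the cycles; [toW] and [toF]
   pass between these and the words fixed by [s]. *)
pose toW (f : {ffun {set 'I_n} -> A}) : {ffun 'I_n -> A} := [ffun k => f (porbit s k)].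
pose toF (w : {ffun 'I_n -> A}) : {ffun {set 'I_n} -> A} :=
  [ffun B : {set 'I_n} => if B \in porbits s then (if [pick k in B] is Some k then w k else a0) else a0].
have porb k : porbit s k \in porbits s by exact: imset_f.
rewrite (reindex_onto toW toF) /=; last first.
  move=> w /forallP ws; apply/ffunP => k; rewrite /toF /toW !ffunE porb.
  case: pickP => [l lk|/(_ k)]; last by rewrite porbit_id.
  by apply: fixes_porbit lk => j; exact/eqP.
apply: eq_big => f.
  apply/pffun_onP/andP => [[sf _]|[_ /eqP <-]].
    split; first by apply/forallP => k; rewrite /toW !ffunE -(porbit_perm s 1 k) expg1.
    apply/eqP/ffunP => B; rewrite /toF /toW !ffunE; case: ifP => Bs.
      have /imsetP[k _ BE] := Bs.
      case: pickP => [l lB|/(_ k)]; last by rewrite BE porbit_id.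
      by rewrite ffunE; congr (f _); rewrite BE in lB *; apply/eqP; rewrite eq_porbit_mem.
    by apply/esym/eqP; apply: contraFT Bs => fB; move/fintype.subsetP: sf => /(_ B); apply; rewrite inE.
  split=> //; apply/fintype.subsetP => B; rewrite inE /toF ffunE; case: ifP => //.
  by rewrite eqxx.
move=> _; rewrite [RHS](partition_big (porbit s) (mem (porbits s))) /=; last by move=> k _; exact: porb.
apply: eq_bigr => B Bs; rewrite -prodr_const.
have eqB k : (porbit s k == B) = (k \in B).
  have /imsetP[l _ ->] := Bs; by rewrite eq_porbit_mem porbit_sym.
rewrite (eq_bigl _ _ eqB); apply: eq_bigr => k; rewrite -eqB /toW ffunE => /eqP ->.
by [].
Qed.

Lemma exists_perm_word (A : eqType) (w v : 'I_n -> A) :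
  (forall a, #|[pred k | w k == a]| = #|[pred k | v k == a]|) ->
  exists s : 'S_n, forall k, v k = w (s k).
Proof.
move=> wv; have : perm_eq [tuple v k | k < n] [tuple w k | k < n].
  apply/allP => a _ /=; apply/eqP.
  by rewrite !count_map; move: (wv a); rewrite !cardE /enum_mem !size_filter => ->.
case/tuple_permP => s e; exists s => k.
have /val_inj/(congr1 (fun u : n.-tuple A => tnth u k)) := e.
by rewrite !tnth_mktuple.
Qed.

(** Sorting the permutations [t] by the word [w0 \o t] gives all words with the content of [w0], and
    the fibre over a word is a coset of its stabiliser. *)
Lemma card_stab_words (A : finType) (w0 : {ffun 'I_n -> A}) :
  (\sum_(w : {ffun 'I_n -> A} | [forall a, #|[pred k | w k == a]| == #|[pred k | w0 k == a]|])
    #|[set s : 'S_n | [forall k, w (s k) == w k]]%SET| = n`!)%N.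
Proof.
rewrite -[RHS](card_Sn n) -sum1_card.
rewrite (partition_big (fun t : 'S_n => [ffun k => w0 (t k)])
  (fun w : {ffun 'I_n -> A} => [forall a, #|[pred k | w k == a]| == #|[pred k | w0 k == a]|])) //.
  apply: eq_bigr => w /forallP ww0.
  have [t tE] := @exists_perm_word _ w0 w (fun a => esym (eqP (ww0 a))).
  rewrite sum1_card -[LHS](card_imset _ (@mulIg _ t)); apply: eq_card => r.
  apply/idP/idP => [/imsetP[s]|].
    rewrite inE => /forallP sw ->; change ([ffun k => w0 ((s * t)%g k)] == w); apply/eqP/ffunP => k.
    by rewrite ffunE permM -tE (eqP (sw k)).
  change ([ffun k => w0 (r k)] == w -> r \in [set (x * t)%g | x in [set s : 'S_n | [forall k, w (s k) == w k]]]%SET).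
  move=> /eqP/ffunP e; apply/imsetP; exists (r * t^-1)%g; last by rewrite mulgKV.
  by rewrite inE; apply/forallP => k; rewrite permM tE permKV -e ffunE.
move=> t _; apply/forallP => a; apply/eqP.
rewrite -(card_imset _ (@perm_inj _ t)); apply: eq_card => k.
rewrite !inE; apply/imsetP/idP => [[l]|kw].
  by rewrite inE ffunE => lw ->.
by exists (t^-1 k)%g; rewrite ?permKV // inE ffunE permKV.
Qed.

Lemma exists_word (A : finType) (g : A -> nat) : (\sum_a g a = n)%N ->
  exists w : {ffun 'I_n -> A}, forall a, #|[pred k | w k == a]| = g a.
Proof.
move=> gn; pose s := flatten [seq nseq (g a) a | a <- enum A].
have sz : size s = n.
  rewrite size_flatten /shape -map_comp sumnE big_map big_enum -[RHS]gn /=.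
  by apply: eq_bigr => a _; rewrite size_nseq.
pose t := Tuple (introT eqP sz); exists [ffun k => tnth t k] => a.
have -> : #|[pred k | [ffun k => tnth t k] k == a]| = count_mem a (map (tnth t) (enum 'I_n)).
  rewrite -sum1_card -sum1_count big_map big_enum_cond /=.
  by apply: eq_bigl => k; rewrite !inE ffunE.
rewrite map_tnth_enum /= /s count_flatten -map_comp sumnE big_map /=.
rewrite (bigD1_seq a) ?mem_enum ?enum_uniq //= count_nseq /= eqxx mul1n.
by rewrite big1 ?addn0 // => b /negPf ba; rewrite count_nseq /= ba.
Qed.

(** Up to n! this is the complete homogeneous function of degree [n]. After [cyc_words],
    permutations are summed for a fixed word and words are grouped by content; [card_stab_words]
    then gives n! for each monomial of degree [n]. *)
Lemma cyc_sum (A : finType) (a0 : A) (Z : A -> R) :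
  \sum_(s : 'S_n) cyc (fun k => \sum_(a : A) Z a ^+ k) s =
  n`!%:R * (\prod_(a : A) geom n (Z a))`_n.
Proof.
rewrite (eq_bigr _ (fun s _ => cyc_words a0 Z s)).
rewrite (exchange_big_dep xpredT) //=.
pose W (g : {ffun A -> 'I_n.+1}) : R := \prod_a Z a ^+ g a.
pose cont (w : {ffun 'I_n -> A}) : {ffun A -> 'I_n.+1} := [ffun a => inord #|[pred k | w k == a]|].
have contE w a : cont w a = #|[pred k | w k == a]| :> nat.
  by rewrite ffunE inordK // ltnS -[leqRHS]card_ord max_card.
have ZW (w : {ffun 'I_n -> A}) : \prod_(k < n) Z (w k) = W (cont w).
  rewrite (partition_big (fun k => w k) xpredT) //=; apply: eq_bigr => a _.
  by rewrite contE -prodr_const; apply: eq_bigr => k /eqP ->.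
have sumc w : (\sum_a cont w a = n)%N.
  rewrite (eq_bigr _ (fun a _ => contE w a)) -[RHS]card_ord -sum1_card.
  rewrite [RHS](partition_big (fun k => w k) xpredT) //=.
  by apply: eq_bigr => a _; rewrite sum1_card.
transitivity (\sum_(w : {ffun 'I_n -> A}) W (cont w) * #|[set s : 'S_n | [forall k, w (s k) == w k]]%SET|%:R).
  apply: eq_bigr => w _; rewrite ZW sum_nat_mulr; congr (_ * _%:R).
  by rewrite -sum1_card; apply: eq_bigl => s; rewrite inE.
rewrite (partition_big cont (fun g : {ffun A -> 'I_n.+1} => (\sum_a g a == n)%N)) /=; last first.
  by move=> w _; rewrite sumc.
rewrite (eq_bigr _ (fun a _ => poly_def _ _) : \prod_a geom n (Z a) = _).
rewrite bigA_distr_bigA coef_sum mulr_sumr /= big_mkcond; apply: eq_bigr => g _.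
have -> : \prod_a (Z a ^+ g a *: 'X^(g a)) = W g *: 'X^(\sum_a g a)%N :> {poly R}.
  by rewrite scaler_prod prodrXr.
rewrite coefZ coefXn [n == _]eq_sym; case: eqP => gn; last by rewrite !mulr0.
have [w0 w0E] := exists_word gn.
rewrite mulr1 mulrC -(card_stab_words w0) natr_sum mulr_sumr.
apply: eq_big => w /=.
  apply/eqP/forallP => [e a|h]; first by rewrite w0E -e contE.
  by apply/ffunP => a; apply: val_inj; rewrite /= contE (eqP (h a)) w0E.
move=> e; have -> : cont w = g by apply/eqP.
by rewrite mulrC.
Qed.

End CycleProducts.

(** [cyc_sum] for the alphabet of products x_i y_j, whose power sums factor, followed by the Cauchy
    identity. *)
Lemma cyc_cauchy n (R : comNzRingType) (x y : nat -> R) N :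
  \sum_(s : 'S_n) cyc (fun k => \sum_(i < N.+1) x i ^+ k) s * cyc (fun k => \sum_(i < N.+1) y i ^+ k) s =
  n`!%:R * \sum_(la <- parts n) sx x N.+1 la * sx y N.+1 la.
Proof.
rewrite -(cauchy x y _ _ (leqnn n)) -(@cyc_sum _ _ _ (ord0, ord0)); apply: eq_bigr => s _.
rewrite -cycM; apply: eq_bigr => B _; rewrite big_distrlr /= pair_bigA /=.
by apply: eq_bigr => p _; rewrite exprMn.
Qed.

Lemma sx_rmorph (R S : comNzRingType) (f : {rmorphism R -> S}) (x : nat -> R) N la :
  f (sx x N la) = sx (fun i => f (x i)) N la.
Proof.
elim: N la => [|N IH] la; first by rewrite /sx rmorph_nat.
rewrite !(@sxS _ _ _ _ (psize la)) // rmorph_sum; apply: eq_bigr => ka _.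
by rewrite rmorphM rmorphXn IH.
Qed.

Lemma cyc_rmorph n (R S : comNzRingType) (f : {rmorphism R -> S}) p (s : 'S_n) :
  f (cyc p s) = cyc (fun k => f (p k)) s.
Proof. exact: rmorph_prod. Qed.

Definition map_fps (I : choiceType) (R S : comNzRingType) (f : R -> S) (g : fps I R) : fps I S :=
  Fps (fun m => f (coef g m)).

Section MapFps.
Variables (I : choiceType) (R S : comNzRingType) (f : {rmorphism R -> S}).

Lemma map_fps_is_zmod_morphism : zmod_morphism (@map_fps I R S f).
Proof. move=> a b; apply: fpsP => m.
by rewrite -[RHS]/(f (coef a m) - f (coef b m)) -rmorphB. Qed.

Lemma map_fps_is_monoid_morphism : monoid_morphism (@map_fps I R S f).
Proof.
split=> [|a b]; first by apply: fpsP => m; rewrite [RHS]fcoef1 -[LHS]/(f (coef 1 m)) fcoef1 rmorph_nat.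
apply: fpsP => m; rewrite [RHS]fcoefM -[LHS]/(f (coef (a * b) m)) fcoefM rmorph_sum.
by apply: eq_bigr => p _; rewrite rmorphM.
Qed.

HB.instance Definition _ := GRing.isZmodMorphism.Build (fps I R) (fps I S)
  (map_fps f) map_fps_is_zmod_morphism.
HB.instance Definition _ := GRing.isMonoidMorphism.Build (fps I R) (fps I S)
  (map_fps f) map_fps_is_monoid_morphism.

Lemma map_fpsX (i : I) : map_fps f (fpsX R i) = fpsX S i.
Proof. by apply: fpsP => m /=; rewrite rmorph_nat. Qed.

End MapFps.

(** * Truncation to finitely many variables *)

Section Truncation.
Variable R : comNzRingType.
Local Notation mon := {mset nat}%mset.

Definition eqN N (f g : fps nat R) : Prop :=
  forall m : mon, (forall i, i \in m -> (i <= N)%N) -> coef f m = coef g m.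

Lemma eqNM N f g f' g' : eqN N f f' -> eqN N g g' -> eqN N (f * g) (f' * g').
Proof.
move=> ff gg m mN; rewrite !fcoefM; apply: eq_big_seq => -[a b].
rewrite mem_splits => /eqP /= e; congr (_ * _); [apply: ff | apply: gg] => i ia;
  by apply: mN; rewrite -e in_msetD ia ?orbT.
Qed.

Lemma eqN_prod N (T : Type) (r : seq T) (P : pred T) (F G : T -> fps nat R) :
  (forall x, P x -> eqN N (F x) (G x)) ->
  eqN N (\prod_(x <- r | P x) F x) (\prod_(x <- r | P x) G x).
Proof.
move=> h; apply: big_rec2 => [m _ //|x f g Px fg]; apply: eqNM fg; exact: h.
Qed.

Lemma fpsX_exp (i k : nat) : fpsX R i ^+ k = mono R (msetn k i).
Proof.
elim: k => [|k IH]; first by rewrite expr0 msetn0 mono0.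
rewrite exprS IH -[fpsX R i]/(mono R (msetn 1 i)) -monoD; congr mono.
by apply/msetP => x; rewrite msetE2 !msetnE; case: eqP.
Qed.

(* Only meaningful for [0 < k]. *)
Definition psum (k : nat) : fps nat R := fps_sum [set i | (0 < i)%N] (fun i => fpsX R i ^+ k).

Definition psumN (N k : nat) : fps nat R := \sum_(i < N) fpsX R i.+1 ^+ k.

Lemma psum_trunc N k : (0 < k)%N -> eqN N (psum k) (psumN N k).
Proof.
move=> k0 m mN; rewrite (@fcoef_fps_sum_seq _ _ _ _ (iota 1 N)).
- rewrite /psumN fcoef_sum -(big_mkord xpredT (fun i => coef (fpsX R i.+1 ^+ k) m)).
  by rewrite /index_iota subn0 -[1%N]addn0 iotaDl big_map; apply: eq_bigr => i _; rewrite add1n.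
- exact: iota_uniq.
- by move=> i; rewrite mem_iota => /andP[].
- move=> i /= i0; rewrite mem_iota i0 /= add1n ltnS => iN.
  rewrite fpsX_exp /=; case: eqP => // mE; case/negP: iN; apply: mN.
  by rewrite mE msetn1.
Qed.

Lemma cyc_trunc n N (s : 'S_n) : eqN N (cyc psum s) (cyc (psumN N) s).
Proof.
apply: eqN_prod => B /imsetP[k _ ->]; apply: psum_trunc.
by apply/card_gt0P; exists k; exact: porbit_id.
Qed.

End Truncation.

Lemma mset_bound (m : {mset nat}%mset) : exists N, forall i, i \in m -> (i <= N)%N.
Proof.
exists (\max_(i <- enum_mset m) i)%N => i im.
by rewrite (big_rem i) /= ?leq_max ?leqnn // enum_msetE.
Qed.

(** Two independent alphabets come from nesting power series: the x_i are constants of the outer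
    ring and the y_i its variables, so the coefficient of F(x) G(y) at a pair of monomials is a
    product. Truncation beyond both monomials reduces the claim to [cyc_cauchy]. *)
Lemma cauchy_coef n (m m' : {mset nat}%mset) :
  \sum_(s : 'S_n) coef (cyc (@psum algC) s) m * coef (cyc (@psum algC) s) m' =
  n`!%:R * \sum_(la <- parts n) coef (schur la) m * coef (schur la) m'.
Proof.
have [N1 h1] := mset_bound m; have [N2 h2] := mset_bound m'.
pose N := (N1 + N2)%N.
have mN i : i \in m -> (i <= N.+1)%N by move=> /h1; rewrite /N; lia.
have m'N i : i \in m' -> (i <= N.+1)%N by move=> /h2; rewrite /N; lia.
pose S := fps nat algC; pose X i : S := fpsX algC i.+1.
pose x i : fps nat S := fpsC nat (X i); pose y i : fps nat S := fpsX S i.+1.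
pose cst : {rmorphism algC -> S} := @fpsC nat algC.
pose mp : {rmorphism fps nat algC -> fps nat S} := map_fps cst.
have yE i : y i = mp (X i) := esym (map_fpsX cst i.+1).
have ex (F G : S) : coef (coef (fpsC nat F * mp G : fps nat S) m') m = coef F m * coef G m'.
  by rewrite fcoefCM -[coef (mp G) m']/(fpsC nat (coef G m')) mulrC fcoefCM mulrC.
have cx (s : 'S_n) : cyc (fun k => \sum_(i < N.+1) x i ^+ k) s = fpsC nat (cyc (psumN _ N.+1) s).
  rewrite cyc_rmorph; apply: eq_bigr => B _; rewrite /psumN rmorph_sum.
  by apply: eq_bigr => i _; rewrite rmorphXn.
have cy (s : 'S_n) : cyc (fun k => \sum_(i < N.+1) y i ^+ k) s = mp (cyc (psumN _ N.+1) s).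
  rewrite cyc_rmorph; apply: eq_bigr => B _; rewrite /psumN rmorph_sum.
  by apply: eq_bigr => i _; rewrite rmorphXn yE.
have sX la : sx x N.+1 la = fpsC nat (sx X N.+1 la) by rewrite sx_rmorph.
have sY la : sx y N.+1 la = mp (sx X N.+1 la).
  by rewrite sx_rmorph (_ : y = fun i => mp (X i)) //; apply/funext => i; exact: yE.
transitivity (coef (coef (\sum_(s : 'S_n) cyc (fun k => \sum_(i < N.+1) x i ^+ k) s *
   cyc (fun k => \sum_(i < N.+1) y i ^+ k) s) m') m).
  rewrite fcoef_sum fcoef_sum; apply: eq_bigr => s _.
  by rewrite (@cyc_trunc _ _ _ s m mN) (@cyc_trunc _ _ _ s m' m'N) cx cy ex.
rewrite cyc_cauchy.
have -> : n`!%:R = fpsC nat (cst n`!%:R) :> fps nat S by rewrite !rmorph_nat.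
rewrite fcoefCM fcoefCM fcoef_sum fcoef_sum; congr (_ * _); apply: eq_bigr => la _.
by rewrite (coef_schur la mN) (coef_schur la m'N) sX sY ex.
Qed.

(** * Dominance and transposition *)

Definition dom (lam mu : part) : Prop :=
  forall k, (\sum_(i < k) prow mu i <= \sum_(i < k) prow lam i)%N.

Lemma dom_anti lam mu : dom lam mu -> dom mu lam -> lam = mu.
Proof.
move=> h1 h2; have e k : (\sum_(i < k) prow mu i = \sum_(i < k) prow lam i)%N.
  by apply/eqP; rewrite eqn_leq h1 h2.
by apply: eq_part => i; apply/esym; have := e i.+1; rewrite !big_ord_recr /= (e i) => /addnI.
Qed.

(** A numerical refinement of dominance on partitions of [n], used as induction measure. *)
Definition domsum n (mu : part) : nat := (\sum_(k < n.+1) \sum_(i < k) prow mu i)%N.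

Lemma dom_domsum n lam mu : lam \in parts n -> mu \in parts n -> dom lam mu ->
  lam != mu -> (domsum n mu < domsum n lam)%N.
Proof.
rewrite !mem_parts => /eqP ln /eqP mn h; apply: contraNltn => le; apply/eqP.
have e k : (k < n.+1)%N -> (\sum_(i < k) prow mu i = \sum_(i < k) prow lam i)%N.
  move=> kn; apply/eqP; rewrite eqn_leq h /= leqNgt; apply/negP => lt.
  move: le; rewrite leqNgt => /negP[]; rewrite /domsum.
  rewrite (bigD1 (Ordinal kn)) //= [X in (_ < X)%N](bigD1 (Ordinal kn)) //=.
  by rewrite -addSn leq_add //; apply: leq_sum => j _; exact: h.
apply: eq_part => i; apply/esym; have [ni|ni] := ltnP i n.
  by have := e i.+1 ni; rewrite !big_ord_recr /= (e i (ltnW ni)) => /addnI.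
by rewrite !nth_default // (leq_trans (size_le_psize _)) ?ln ?mn.
Qed.

Lemma domsum_le n mu : mu \in parts n -> (domsum n mu <= n.+1 * n)%N.
Proof.
rewrite mem_parts => /eqP mn; rewrite -[X in (X * _)%N]card_ord -sum_nat_const.
have sn : (size mu <= n.+1)%N by rewrite leqW // -mn size_le_psize.
apply: leq_sum => k _; rewrite -[leqRHS]mn (psizeE sn).
rewrite (big_ord_widen n.+1 (fun i => prow mu i) (ltnW (ltn_ord k))).
by rewrite [leqLHS]big_mkcond; apply: leq_sum => i _; case: ifP.
Qed.

(** The monomial with exponent mu_i at x_i; [coef (schur lam) (cont mu)] is thus the Kostka number
    of [lam] and [mu]. *)
Definition cont (mu : part) : {mset nat}%mset :=
  seq_mset (flatten (mktab mu (fun i _ => i.+1))).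

Lemma contE mu i : cont mu i.+1 = prow mu i.
Proof.
rewrite mset_seqE (@count_mktab _ _ _ (size mu + i.+1)) ?leq_addr //.
have iB : (i < size mu + i.+1)%N by rewrite addnS ltnS leq_addl.
rewrite (bigD1 (Ordinal iB)) //= [X in (_ + X)%N]big1 ?addn0.
  by under eq_bigr => j _ do rewrite eqxx; rewrite sum1_card card_ord.
move=> j jne; rewrite big1 // => k _; rewrite eqSS; case: eqP => // ji.
by case/eqP: jne; exact: val_inj.
Qed.

Lemma cont0 mu : cont mu 0%N = 0%N.
Proof.
by rewrite mset_seqE (@count_mktab _ _ _ (size mu)) // big1 // => i _; rewrite big1.
Qed.

Lemma istab_geS lam f : istab lam f -> forall i j, (j < prow lam i)%N -> (i < f i j)%N.
Proof.
move=> h; elim=> [|i IH] j jl; first by case: (h 0%N j jl).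
have jl' := leq_trans jl (leq_row lam (leqnSn i)).
by case: (h i j jl') => _ _; rewrite jl; apply: leq_ltn_trans; exact: IH.
Qed.

Lemma sum_leq_indicator (lam : part) B k : (k <= B)%N -> 
  (\sum_(i < B) \sum_(j < prow lam i) (i < k) = \sum_(i < k) prow lam i)%N.
Proof.
move=> kB; rewrite (big_ord_widen B (fun i => prow lam i)) // [RHS]big_mkcond.
apply: eq_bigr => i _; case: ifP => ik; last by rewrite big1.
by rewrite sum1_card card_ord.
Qed.

Lemma tab_cont_count lam mu f k : seq_mset (flatten (mktab lam f)) = cont mu ->
  forall B, (size lam + size mu + k <= B)%N ->
  (\sum_(i < B) \sum_(j < prow lam i) (f i j <= k) = \sum_(i < k) prow mu i)%N.
Proof.
move=> /eq_seq_msetP/seq.permP e B hB.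
have h1 : (size lam <= B)%N by move: hB; lia.
have h2 : (size mu <= B)%N by move: hB; lia.
rewrite -(count_mktab (fun x => (x <= k)%N) f h1) e (count_mktab _ _ h2).
by apply: sum_leq_indicator; move: hB; lia.
Qed.

(** Column strictness puts an entry at most [k] into the first [k] rows, so all mu_1 + ... + mu_k
    such entries have to fit there. *)
Lemma ssyt_dom lam mu T : ssyt lam T -> seq_mset (flatten T) = cont mu -> dom lam mu.
Proof.
move=> sT; have TE : T = mktab lam (fun i j => nth 0%N (nth [::] T i) j).
  by apply: mktab_tb; case: sT.
move: sT; rewrite TE => /ssyt_mktab h e k.
rewrite -(@tab_cont_count _ _ _ k e _ (leqnn _)) -(@sum_leq_indicator lam (size lam + size mu + k)); last by lia.
apply: leq_sum => i _; apply: leq_sum => j _.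
have := istab_geS h (ltn_ord j).
by case: leqP => // le; case: ltnP => // ki; move: le; lia.
Qed.

(** Equality case of the same count: an entry of row [i] exceeding [i.+1] would leave fewer than
    mu_1 + ... + mu_(i+1) entries at most [i.+1]. *)
Lemma ssyt_cont_unique mu T : ssyt mu T -> seq_mset (flatten T) = cont mu ->
  T = mktab mu (fun i _ => i.+1).
Proof.
move=> sT; have TE : T = mktab mu (fun i j => nth 0%N (nth [::] T i) j).
  by apply: mktab_tb; case: sT.
move: sT; rewrite TE; set f := (fun i j => _) => /ssyt_mktab h e.
apply: eq_mktab => i j jl; apply/eqP; rewrite eqn_leq (istab_geS h jl) andbT.
pose B := (size mu + size mu + i.+1)%N.
have iB : (i < B)%N by rewrite /B; lia.
have := @tab_cont_count _ _ _ i.+1 e _ (leqnn B).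
rewrite -(@sum_leq_indicator mu B); last by rewrite /B; lia.
have hle (i' : 'I_B) : (\sum_(j < prow mu i') (f i' j <= i.+1) <= \sum_(j < prow mu i') (i' < i.+1))%N.
  apply: leq_sum => j' _; have := istab_geS h (ltn_ord j').
  by case: leqP => // le; case: ltnP => // ki; move: le; lia.
apply: contra_eqT; rewrite -ltnNge => fij; rewrite neq_ltn; apply/orP; left.
rewrite (bigD1 (Ordinal iB)) //= [X in (_ < X)%N](bigD1 (Ordinal iB)) //=.
rewrite -addSn leq_add //; last by apply: leq_sum => i' _; exact: hle.
rewrite (bigD1 (Ordinal jl)) //= [X in (_ < X)%N](bigD1 (Ordinal jl)) //=.
have -> : (f i j <= i.+1)%N = false by rewrite leqNgt fij.
rewrite ltnSn add0n add1n ltnS; apply: leq_sum => j' _.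
by rewrite leq_b1.
Qed.

Lemma schur_coefE N lam (m : {mset nat}%mset) : (forall i, i \in m -> (i <= N)%N) ->
  coef (schur lam) m = (\sum_(T <- tabs N lam) (m == seq_mset (flatten T)))%:R.
Proof.
move=> mN; rewrite (coef_schur lam mN) sx_tabs fcoef_sum natr_sum; apply: eq_big_seq => T.
rewrite mem_tabs => /andP[/asboolP[_ T0 _ _] _].
have -> : \prod_(k <- flatten T) fpsX algC k.-1.+1 = \prod_(k <- flatten T) fpsX algC k.
  by apply: eq_big_seq => k /T0 k0; apply: (congr1 (@fpsX _ _)); case: k k0.
by rewrite prod_fpsX.
Qed.

Lemma schur_coef_nat lam m : coef (schur lam) m \is a Num.nat.
Proof. by have [N mN] := mset_bound m; rewrite (schur_coefE lam mN) Num.Theory.natr_nat. Qed.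

Lemma schur_coef_neq0 lam m : coef (schur lam) m != 0 ->
  exists2 T, ssyt lam T & seq_mset (flatten T) = m.
Proof.
have [N mN] := mset_bound m; rewrite (schur_coefE lam mN) => h.
have : has (fun T => m == seq_mset (flatten T)) (tabs N lam).
  apply: contraNT h => /hasPn h; rewrite big1_seq // => T /andP[_ /h /negPf ->].
  by [].
by case/hasP => T; rewrite mem_tabs => /andP[/asboolP sT _] /eqP; exists T.
Qed.

Lemma kostka_dom lam mu : coef (schur lam) (cont mu) != 0 -> dom lam mu.
Proof. by case/schur_coef_neq0 => T /ssyt_dom; apply. Qed.

Lemma kostka1 mu : coef (schur mu) (cont mu) = 1.
Proof.
have [N mN] := mset_bound (cont mu); rewrite (schur_coefE mu mN).
pose T0 := mktab mu (fun i _ => i.+1).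
have h0 : istab mu (fun i _ => i.+1) by move=> i j _; rewrite /= leqnn ltnSn !implybT.
have hT : T0 \in tabs N mu.
  apply/mem_tabs_mktab; split=> // i j jl; apply: mN.
  rewrite in_mset contE; exact: leq_ltn_trans jl.
rewrite (bigD1_seq T0) ?tabs_uniq //= eqxx big1_seq ?addn0 // => T /andP[TT].
rewrite mem_tabs => /andP[/asboolP sT _]; case: eqP => // /esym/(ssyt_cont_unique sT) TE.
by rewrite TE eqxx in TT.
Qed.

Lemma schur_inj lam mu : (forall m, coef (schur lam) m = coef (schur mu) m) -> lam = mu.
Proof.
move=> e; apply: dom_anti; apply: kostka_dom.
  by rewrite e kostka1 oner_eq0.
by rewrite -e kostka1 oner_eq0.
Qed.

Lemma schur_coef_size lam m : coef (schur lam) m != 0 -> size (enum_mset m) = psize lam.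
Proof.
case/schur_coef_neq0 => T [sT _ _ _] <-.
by rewrite (perm_size (perm_eq_seq_mset _)) size_flatten sT.
Qed.

Lemma prow_trp mu j : prow (trp mu) j = count (fun p => (j < p)%N) mu.
Proof.
rewrite /trp /=; have [jh|jh] := ltnP j (head 0%N mu); first by rewrite nth_mkseq.
rewrite nth_default ?size_mkseq //; apply/esym/eqP; rewrite -leqn0 leqNgt -has_count.
apply/negP => /(has_nthP 0%N)[k _]; rewrite ltnNge => /negP[].
by apply: leq_trans (leq_row mu (leq0n k)) _; rewrite nth0.
Qed.

Lemma ltn_prow_trp mu i j : (i < prow (trp mu) j)%N = (j < prow mu i)%N.
Proof.
rewrite prow_trp; have [im|im] := ltnP i (size mu); last first.
  rewrite (nth_default _ im) ltn0 ltnNge (leq_trans (count_size _ _)) //.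
rewrite -sum1_count big_mkcond (big_nth 0%N) big_mkord.
(* The Booleans [~~ (j < prow mu k)] increase with [k], so [count_sorted] with bound 0 says that the
   rows longer than [j] come first. *)
have := @count_sorted (fun k => ~~ (j < prow mu k)%N) (size mu) 0 _ i im.
rewrite leqn0 eqb0 negbK (_ : (\sum_(k < size mu) _ = \sum_(k < size mu) (if (j < prow mu k)%N then 1 else 0))%N) => [->|] //.
  by move=> k _; case: ltnP => // jk; case: ltnP => // kk; have := leq_row mu (leqnSn k); move: jk kk; lia.
by apply: eq_bigr => k _; rewrite leqn0 eqb0 negbK; case: ltnP.
Qed.

Lemma trpK : involutive trp.
Proof.
move=> mu; apply: eq_part => i; apply/eqP; rewrite eqn_leq; apply/andP; split.
  by rewrite leqNgt !ltn_prow_trp ltnn.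
by rewrite leqNgt -ltn_prow_trp -ltn_prow_trp ltnn.
Qed.

Lemma sum_ltn_ord B b : (b <= B)%N -> (\sum_(j < B) (j < b) = b)%N.
Proof.
move=> bB; rewrite -[RHS]card_ord -sum1_card (big_ord_widen B (fun=> 1%N)) //.
by rewrite [RHS]big_mkcond; apply: eq_bigr => i _; case: ltnP.
Qed.

Lemma psize_cells mu B : (psize mu <= B)%N ->
  psize mu = (\sum_(i < B) \sum_(j < B) (j < prow mu i))%N.
Proof.
move=> mB; rewrite (psizeE (leq_trans (size_le_psize mu) mB)); apply: eq_bigr => i _.
by rewrite sum_ltn_ord // (leq_trans (row_le_psize _ _)).
Qed.

Lemma psize_trp mu : psize (trp mu) = psize mu.
Proof.
pose B := (psize mu + psize (trp mu))%N.
rewrite (@psize_cells mu B) ?leq_addr // (@psize_cells (trp mu) B) ?leq_addl //.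
by rewrite exchange_big; apply: eq_bigr => i _; apply: eq_bigr => j _; rewrite ltn_prow_trp.
Qed.

(** [kappa] is twice the sum of the contents of the cells. The square box of side [B] lets
    transposition act by exchanging the two sums. *)
Lemma kappa_cells mu B : (psize mu <= B)%N ->
  kappa mu = \sum_(i < B) \sum_(j < B | (j < prow mu i)%N) 2 * ((j : nat)%:Z - (i : nat)%:Z).
Proof.
move=> mB; have inner b i : (b <= B)%N ->
    \sum_(j < B | (j < b)%N) 2 * ((j : nat)%:Z - i%:Z) = b%:Z * (b%:Z - 2 * i.+1%:Z + 1).
  move=> bB; rewrite -(big_ord_widen B (fun j => 2 * (j%:Z - i%:Z))) //.
  elim: b {bB} => [|b IH]; first by rewrite big_ord0 mul0r.
  by rewrite big_ord_recr /= IH; lia.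
rewrite /kappa.
transitivity (\sum_(i < B) (prow mu i)%:Z * ((prow mu i)%:Z - 2 * (i.+1)%:Z + 1)).
  have sB := leq_trans (size_le_psize mu) mB.
  rewrite (big_ord_widen B (fun i => (prow mu i)%:Z * ((prow mu i)%:Z - 2 * (i.+1)%:Z + 1))) //.
  rewrite big_mkcond; apply: eq_bigr => i _; case: ltnP => // mi.
  by rewrite nth_default // mul0r.
by apply: eq_bigr => i _; rewrite inner // (leq_trans (row_le_psize _ _)).
Qed.

Lemma kappa_trp mu : kappa (trp mu) = - kappa mu.
Proof.
rewrite (@kappa_cells _ (psize mu)) ?psize_trp // (@kappa_cells mu (psize mu)) //.
rewrite (exchange_big_dep xpredT) //= -sumrN; apply: eq_bigr => i _; rewrite -sumrN.
by apply: eq_big => j; [rewrite ltn_prow_trp | lia].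
Qed.

(** * Characters of the symmetric group *)

Local Notation Sn n := [set: 'S_n]%SET.

Lemma reshape_indexS s sh k :
  reshape_index (s :: sh) k = if (k < s)%N then 0%N else (reshape_index sh (k - s)).+1.
Proof. by rewrite /reshape_index /= subn_eq0; case: ltnP => // sk; rewrite subSn. Qed.

Lemma count_reshape_index sh i :
  (\sum_(k < sumn sh) (reshape_index sh k == i) = nth 0 sh i)%N.
Proof.
elim: sh i => [|s sh IH] i; first by rewrite big_ord0 nth_nil.
rewrite /= big_split_ord /=.
have -> : (\sum_(k < s) (reshape_index (s :: sh) k == i) = (i == 0) * s)%N.
  rewrite (eq_bigr (fun=> (i == 0%N : nat))) ?sum_nat_const ?card_ord 1?mulnC // => k _.
  by rewrite reshape_indexS ltn_ord eq_sym.
have -> : (\sum_(k < sumn sh) (reshape_index (s :: sh) (s + k) == i) =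
    (if i is i'.+1 then nth 0 sh i' else 0))%N.
  case: i => [|i]; first by rewrite big1 // => k _; rewrite reshape_indexS ltnNge leq_addr.
  by rewrite -IH; apply: eq_bigr => k _; rewrite reshape_indexS ltnNge leq_addr /= addKn eqSS.
by case: i => [|i] /=; rewrite ?mul1n ?mul0n ?addn0.
Qed.

Lemma reshape_offsetS s sh k :
  reshape_offset (s :: sh) k = if (k < s)%N then k else reshape_offset sh (k - s).
Proof.
rewrite /reshape_offset reshape_indexS; case: ltnP => sk /=; first by rewrite subn0.
by rewrite subnDA.
Qed.

Lemma count_reshape_offset sh j :
  (\sum_(k < sumn sh) (reshape_offset sh k == j) = count (fun p => j < p) sh)%N.
Proof.
elim: sh j => [|s sh IH] j; first by rewrite big_ord0.
rewrite /= big_split_ord /=; congr (_ + _)%N.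
  rewrite (eq_bigr (fun k : 'I_s => (val k == j : nat))); last first.
    by move=> k _; rewrite reshape_offsetS ltn_ord.
  have [js|js] := ltnP j s; last first.
    by rewrite big1 // => k _; case: eqP => // kj; have := ltn_ord k; rewrite kj ltnNge js.
  rewrite (bigD1 (Ordinal js)) //= eqxx big1 // => k; rewrite -val_eqE /= => /negPf ->.
  by [].
by rewrite -IH; apply: eq_bigr => k _; rewrite reshape_offsetS ltnNge leq_addr /= addKn.
Qed.

Section SymmetricCharacters.
Variable n : nat.
Local Notation G := [set: 'S_n]%SET.
Local Notation P s := (cyc (@psum algC) s).

Definition has_content (mu : part) (w : {ffun 'I_n -> 'I_n.+1}) : bool :=
  [forall i : 'I_n.+1, #|[pred k | w k == i]| == prow mu i].

Definition fixw (w : {ffun 'I_n -> 'I_n.+1}) (s : 'S_n) : bool := [forall k, w (s k) == w k].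

Lemma count_word (w : {ffun 'I_n -> 'I_n.+1}) (i : 'I_n.+1) :
  count_mem i.+1 [seq (w k : nat).+1 | k : 'I_n] = #|[pred k | w k == i]|.
Proof.
rewrite -sum1_card -sum1_count big_map big_enum_cond /=.
by apply: eq_bigl => k; rewrite inE eqSS val_eqE.
Qed.

Lemma word_cont mu (w : {ffun 'I_n -> 'I_n.+1}) : psize mu = n ->
  (seq_mset [seq (w k : nat).+1 | k : 'I_n] == cont mu) = has_content mu w.
Proof.
move=> mn; apply/mset_eqP/forallP => [h i|h x].
  by rewrite -count_word -mset_seqE h contE.
rewrite mset_seqE; case: x => [|x].
  by rewrite cont0; apply/eqP; rewrite -leqn0 leqNgt -has_count; apply/negP => /hasP[y /mapP[k _ ->]].
rewrite contE; have [xn|xn] := ltnP x n.+1.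
  by rewrite -(eqP (h (Ordinal xn))) -count_word.
rewrite nth_default; last by rewrite (leq_trans (size_le_psize mu)) // mn ltnW.
apply/eqP; rewrite -leqn0 leqNgt -has_count; apply/negP => /hasP[y /mapP[k _ ->]] /=.
by rewrite eqSS => /eqP e; move: xn; rewrite -e ltnNge -ltnS ltn_ord.
Qed.

Lemma prod_word N (w : 'I_n -> 'I_N) : \prod_(k < n) fpsX algC (w k : nat).+1 =
  mono algC (seq_mset [seq (w k : nat).+1 | k : 'I_n]).
Proof. by rewrite -prod_fpsX big_map big_enum. Qed.

(** By [cyc_words] the fixed words are sorted by their content monomial. The letters 0, ..., n stand
    for the variables 1, ..., n + 1, which cover [cont mu] because [mu] has at most [n] rows. *)
Lemma P_cont mu (s : 'S_n) : psize mu = n ->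
  coef (P s) (cont mu) = #|[set w | fixw w s && has_content mu w]%SET|%:R.
Proof.
move=> mn; have mN i : i \in cont mu -> (i <= n.+1)%N.
  rewrite in_mset; case: i => // i; rewrite contE => h; rewrite ltnS.
  by rewrite (leq_trans (ltnW (prow_lt_size h))) // -mn size_le_psize.
rewrite (@cyc_trunc _ _ n.+1 s _ mN).
rewrite (cyc_words ord0 (fun i : 'I_n.+1 => fpsX algC (i : nat).+1)) fcoef_sum.
rewrite -sum1_card natr_sum [RHS]big_mkcond [LHS]big_mkcond /=; apply: eq_bigr => w _.
rewrite inE /fixw; case: ifP => //= _.
rewrite -word_cont // prod_word /= eq_sym.
by case: ifP.
Qed.

Lemma P_coef_nat (s : 'S_n) m : coef (P s) m \is a Num.nat.
Proof.
have [N mN] := mset_bound m; rewrite (@cyc_trunc _ _ N.+1 s m); last by move=> i /mN /leqW.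
rewrite (cyc_words ord0 (fun i : 'I_N.+1 => fpsX algC (i : nat).+1)) fcoef_sum.
apply: rpred_sum => w _.
rewrite prod_word /=.
exact: Num.Theory.natr_nat.
Qed.

(** The coefficient at [m] of the Frobenius characteristic of [phi]. *)
Definition frob_char (phi : 'S_n -> algC) m : algC := n`!%:R^-1 * \sum_(s : 'S_n) phi s * coef (P s) m.

Let fact0 : n`!%:R != 0 :> algC.
Proof. by rewrite pnatr_eq0 -lt0n fact_gt0. Qed.

Definition young_perm_char (mu : part) : 'CF(G) := 'Ind[G] (1 : 'CF(young n mu)).
Definition young_sgn_char (mu : part) : 'CF(G) := 'Ind[G] ('Res[young n mu] (sgn_char n)).

(** The word of row indices in the row-by-row filling of [mu]; the Young subgroup is its
    stabiliser. *)
Definition rword (mu : part) : {ffun 'I_n -> 'I_n.+1} := [ffun k : 'I_n => inord (reshape_index mu k)].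

Lemma rwordE mu k : psize mu = n -> rword mu k = reshape_index mu k :> nat.
Proof.
move=> mn; rewrite ffunE inordK // ltnS (leq_trans (ltnW (reshape_indexP _))) -?mn ?size_le_psize //.
by rewrite -/(psize mu) mn.
Qed.

Lemma hasC_rword mu : psize mu = n -> has_content mu (rword mu).
Proof.
move=> mn; apply/forallP => i; apply/eqP.
have e m : m = n -> (\sum_(k < m) (reshape_index mu k == i) = \sum_(k < n) (reshape_index mu k == i))%N.
  by move=> ->.
rewrite -(count_reshape_index (Defs.pval mu) i) e // -sum1_card big_mkcond /=.
by apply: eq_bigr => k _; rewrite inE -val_eqE /= rwordE //; case: eqP.
Qed.

Lemma mem_young mu (s : 'S_n) : psize mu = n -> (s \in young n mu) = fixw (rword mu) s.
Proof.
move=> mn; rewrite inE; apply: eq_forallb => k.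
by rewrite -val_eqE /= !rwordE.
Qed.

(** The symmetric group acts transitively on the words of content [mu], with the Young subgroup as
    stabiliser of [rword mu], so the induced character counts fixed words. *)
Lemma pic_val mu (s : 'S_n) : psize mu = n -> young_perm_char mu s = coef (P s) (cont mu).
Proof.
move=> mn; rewrite P_cont // /young_perm_char cfIndE ?finset.subsetT //.
have Y0 : #|young n mu|%:R != 0 :> algC by rewrite pnatr_eq0 -lt0n cardG_gt0.
apply: (mulfI Y0); rewrite mulVKf //.
move: (rword mu) (hasC_rword mn) (fun s => mem_young s mn) => w0 hw0 memY.
(* [s ^ y] fixes [w0] exactly when [s] fixes the translate of [w0] by [y], and each word of content
   [mu] arises from one coset of the Young subgroup. *)
transitivity (\sum_(y : 'S_n) (fixw [ffun k => w0 (y k)] s : nat)%:R : algC).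
  apply: eq_big => y; first by rewrite inE.
  move=> _; rewrite cfun1E memY; congr ((nat_of_bool _)%:R).
  apply/forallP/forallP => h k.
    have := h (y k); rewrite conjgE !permM permK => /eqP e.
    by rewrite 2!ffunE e eqxx.
  have := h (y^-1 k)%g; rewrite 2!ffunE permKV conjgE !permM.
  by [].
rewrite -natr_sum -natrM; congr _%:R.
rewrite (partition_big (fun y : 'S_n => [ffun k => w0 (y k)]) (has_content mu)) /=; last first.
  move=> y _; rewrite -[has_content _ _](_ : has_content mu w0 = _) //.
  apply: eq_forallb => i; congr (_ == _); rewrite -(card_imset _ (@perm_inj _ y^-1)).
  apply: eq_card => k; apply/imsetP/idP => [[l]|].
    by rewrite !inE => lw ->; rewrite ffunE permKV.
  by rewrite inE ffunE => h; exists (y k); rewrite ?inE ?permK.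
rewrite -[#|young_set n mu|]/#|young n mu| -[X in (_ * X)%N]sum1_card mulnC big_distrl /= [RHS]big_mkcond /= [LHS]big_mkcond; apply: eq_bigr => w _.
rewrite inE andbC; case: ifP => // hw.
rewrite (eq_bigr (fun=> (fixw w s : nat))); last by move=> y /eqP ->.
rewrite sum_nat_const mul1n.
have [t tE] : exists t : 'S_n, forall k, w k = w0 (t k).
  apply: exists_perm_word => a; apply/esym/eqP.
  by move/forallP: hw0 => /(_ a)/eqP ->; move/forallP: hw => /(_ a).
have -> : #|[pred y : 'S_n | [ffun k => w0 (y k)] == w]| = #|young n mu|.
  rewrite -[RHS](card_imset _ (@mulgI _ t)); apply: eq_card => y.
  apply/idP/imsetP => [/eqP/ffunP h|[h hY ->]].
    exists (t^-1 * y)%g; last by rewrite mulKVg.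
    rewrite memY; apply/forallP => k; rewrite permM.
    by have := h (t^-1 k)%g; rewrite ffunE tE permKV => ->.
  rewrite inE; apply/eqP/ffunP => k; rewrite ffunE permM tE.
  by move: hY; rewrite memY => /forallP/(_ (t k))/eqP.
by case: (fixw w s); rewrite ?muln0 ?muln1.
Qed.

(** The projection formula: inducing the restricted sign multiplies the permutation character by the
    sign. *)
Lemma eps_val mu (s : 'S_n) : psize mu = n ->
  young_sgn_char mu s = (-1) ^+ odd_perm s * coef (P s) (cont mu).
Proof.
move=> mn; rewrite /young_sgn_char -[X in 'Ind[G] X]mul1r cfIndM ?finset.subsetT //.
by rewrite cfunE -/(young_perm_char mu) pic_val // mulrC; congr (_ * _); rewrite cfunElock.
Qed.

Lemma cfdot_pic (phi : 'CF(G)) mu : psize mu = n -> '[phi, young_perm_char mu] = frob_char phi (cont mu).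
Proof.
move=> mn; rewrite cfdotE cardsT card_Sn; congr (_ * _).
apply: eq_big => s; first by rewrite inE.
by move=> _; rewrite pic_val // conj_natr ?P_coef_nat.
Qed.

(** [cauchy_coef] with one monomial set to [cont mu]: the expansion of h_mu in Schur functions with
    Kostka numbers as coefficients. *)
Lemma chc_pic mu m : psize mu = n ->
  frob_char (young_perm_char mu) m = \sum_(la <- parts n) coef (schur la) (cont mu) * coef (schur la) m.
Proof.
move=> mn; rewrite /frob_char; under eq_bigr => s _ do rewrite pic_val //.
by rewrite cauchy_coef mulKf.
Qed.

Lemma pic_char mu : young_perm_char mu \is a character.
Proof. by rewrite cfInd_char // rpred1. Qed.

Lemma sgn_mx_repr : mx_repr G (fun s : 'S_n => ((-1) ^+ odd_perm s)%:M : 'M[algC]_1).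
Proof.
split=> [|s t _ _]; first by rewrite odd_perm1.
by rewrite -scalar_mxM odd_permM signr_addb.
Qed.

Lemma sgn_charP : sgn_char n \is a character.
Proof.
have -> : sgn_char n = cfRepr (MxRepresentation sgn_mx_repr).
  apply/cfunP => s; rewrite [LHS]cfunElock [RHS]cfunElock inE mulr1n /= mxtrace_scalar.
  by rewrite mulr1n.
exact: cfRepr_char.
Qed.

Lemma eps_char mu : young_sgn_char mu \is a character.
Proof. by rewrite cfInd_char // cfRes_char // sgn_charP. Qed.

(** If two positions carry the same letter, their transposition stabilises [u] and reverses the
    signs; otherwise the stabiliser is trivial. *)
Lemma sgn_stab (A : finType) (u : 'I_n -> A) :
  \sum_(s : 'S_n | [forall k, u (s k) == u k]) (-1) ^+ odd_perm s = (injectiveb u)%:R :> algC.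
Proof.
have [uinj|] := boolP (injectiveb u).
  rewrite (bigD1 1%g) /=; last by apply/forallP => k; rewrite perm1.
  rewrite odd_perm1 expr0 big1 ?addr0 // => s /andP[/forallP h] /eqP[].
  by apply/permP => k; rewrite perm1; apply: (injectiveP _ uinj); exact/eqP.
move=> /injectivePn[k [l kl ukl]].
set S := \sum_(s | _) _.
have : S = - S.
  rewrite {1}/S (reindex_inj (@mulIg _ (tperm k l))) /= -sumrN; apply: eq_big => s.
    apply/forallP/forallP => h j; have := h j; rewrite !permM.
      by case: tpermP => // -> /eqP <-; rewrite ukl.
    by case: tpermP => // -> /eqP <-; rewrite ukl.
  by move=> _; rewrite odd_permM odd_tperm kl addbT; case: (odd_perm s) => /=; rewrite ?expr1 ?expr0 ?opprK.
move/eqP; rewrite -addr_eq0 -mulr2n mulrn_eq0 /= => /eqP ->.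
by [].
Qed.

(** The product of the two permutation characters counts pairs of words fixed by [s]; summing the
    sign keeps the pairs in which no two positions agree in both letters. Divided by n!, their
    number counts the 0-1 matrices with row sums [la] and column sums [nu]. *)
Lemma cfdot_pic_eps la nu : psize la = n -> psize nu = n ->
  '[young_perm_char la, young_sgn_char nu] = n`!%:R^-1 *
    (\sum_(p : {ffun 'I_n -> 'I_n.+1} * {ffun 'I_n -> 'I_n.+1} | has_content la p.1 && has_content nu p.2)
      injectiveb (fun k => (p.1 k, p.2 k)))%:R.
Proof.
move=> ln nn; rewrite cfdotE cardsT card_Sn; congr (_ * _); rewrite natr_sum.
transitivity (\sum_(s : 'S_n) \sum_(p : {ffun 'I_n -> 'I_n.+1} * {ffun 'I_n -> 'I_n.+1} |
    (fixw p.1 s && has_content la p.1) && (fixw p.2 s && has_content nu p.2)) (-1) ^+ odd_perm s : algC).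
  apply: eq_big => s; first by rewrite inE.
  move=> _; rewrite pic_val // conj_intr; last first.
    by rewrite eps_val // rpredM ?rpredX ?rpredN ?rpred1 // Num.Theory.intr_nat ?P_coef_nat.
  rewrite eps_val //.
  rewrite !P_cont // mulrCA -natrM -cardsX sum_nat_mulr -sum1_card; congr (_ * _%:R).
  by apply: eq_bigl => -[w v]; rewrite !inE.
rewrite (exchange_big_dep (fun p => has_content la p.1 && has_content nu p.2)) /=; last first.
  by move=> s p _ /andP[/andP[_ ->] /andP[_ ->]].
apply: eq_bigr => -[w v] /= /andP[hw hv]; rewrite -sgn_stab; apply: eq_bigl => s.
rewrite hw hv !andbT; apply/andP/forallP => [[/forallP h1 /forallP h2] k|h].
  by rewrite xpair_eqE h1 h2.
by split; apply/forallP => k; have := h k; rewrite xpair_eqE => /andP[].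
Qed.

(** A column of a 0-1 matrix meets the first [k] rows in at most the minimum of [k] and its column
    sum. For the column sums of [trp mu] these minima add up to mu_1 + ... + mu_k. *)
Lemma gale_ryser la mu : psize la = n -> psize mu = n ->
  '[young_perm_char la, young_sgn_char (trp mu)] != 0 -> dom mu la.
Proof.
move=> ln mn; rewrite cfdot_pic_eps ?psize_trp // mulf_eq0 negb_or pnatr_eq0 => /andP[_].
rewrite sum_nat_eq0 negb_forall => /existsP[[w v]] /=.
rewrite negb_imply eqb0 negbK => /andP[/andP[/forallP hw /forallP hv] /injectiveP inj] k.
have cut (lam : part) : psize lam = n -> (\sum_(i < k) prow lam i = \sum_(i < n.+1 | (i < k)%N) prow lam i)%N.
  move=> lamn; pose B := (n.+1 + k)%N.
  rewrite (big_ord_widen B (fun i => prow lam i)) ?leq_addl //.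
  rewrite -(big_mkord (fun i => i < k)%N (fun i => prow lam i)) (big_cat_nat (n := n.+1)) ?leq_addr //=.
  rewrite big_mkord [X in (_ + X)%N]big1_seq ?addn0 // => i /andP[_]; rewrite mem_index_iota => /andP[ni _].
  by rewrite nth_default // (leq_trans (size_le_psize lam)) // lamn ltnW.
rewrite !cut //.
have -> : (\sum_(i < n.+1 | (i < k)%N) prow la i = \sum_(j < n.+1) #|[pred t | (w t < k)%N && (v t == j)]|)%N.
  transitivity #|[pred t | (w t < k)%N]|.
    rewrite -sum1_card [RHS](partition_big (fun t => w t) (fun i : 'I_n.+1 => (i < k)%N)) //=.
    apply: eq_bigr => i ik; rewrite -(eqP (hw i)) -sum1_card; apply: eq_bigl => t.
    by rewrite !inE andbC; case: eqP => // ->; rewrite ik.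
  rewrite -sum1_card [LHS](partition_big (fun t => v t) xpredT) //=.
  by apply: eq_bigr => j _; rewrite -sum1_card; apply: eq_bigl => t; rewrite !inE.
have -> : (\sum_(i < n.+1 | (i < k)%N) prow mu i = \sum_(j < n.+1) \sum_(i < n.+1 | (i < k)%N) (i < prow (trp mu) j))%N.
  rewrite exchange_big /=; apply: eq_bigr => i _.
  rewrite -(@sum_ltn_ord n.+1 (prow mu i)); first by apply: eq_bigr => j _; rewrite ltn_prow_trp.
  by rewrite leqW // -[leqRHS]mn row_le_psize.
apply: leq_sum => j _.
have mj : (prow (trp mu) j <= n.+1)%N.
  by rewrite leqW // -[leqRHS]mn -(psize_trp mu) row_le_psize.
have -> : (\sum_(i < n.+1 | (i < k)%N) (i < prow (trp mu) j) = minn k (prow (trp mu) j))%N.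
  rewrite -[RHS](@sum_ltn_ord n.+1); last by rewrite geq_min mj orbT.
  rewrite big_mkcond; apply: eq_bigr => i _; rewrite leq_min.
  by case: (ltnP i k).
rewrite leq_min; apply/andP; split; last first.
  rewrite -(eqP (hv j)); apply: subset_leq_card; apply/fintype.subsetP => t.
  by rewrite !inE => /andP[].
have iw : {in [pred t | (w t < k)%N && (v t == j)] &, injective w}.
  by move=> s t; rewrite !inE => /andP[_ /eqP e1] /andP[_ /eqP e2] e; apply: inj; rewrite e e1 e2.
rewrite -(card_in_imset iw).
apply: leq_trans (_ : #|[set i : 'I_n.+1 | (i < k)%N]%SET| <= k)%N.
  apply: subset_leq_card; apply/fintype.subsetP => i /imsetP[t]; rewrite !inE => /andP[h _] ->.
  by [].
rewrite -sum1_card (eq_bigl (fun i : 'I_n.+1 => (i < k)%N)) => [|i]; last by rewrite inE.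
rewrite big_mkcond -[leqRHS](@sum_ltn_ord (n.+1 + k)%N) ?leq_addl // big_split_ord /=.
by rewrite (leq_trans _ (leq_addr _ _)) //; apply: leq_sum => i _; case: ltnP.
Qed.

(** The row and column indices of the cells of [mu] form an injective pair of words. *)
Lemma gale_ryser_self mu : psize mu = n -> '[young_perm_char mu, young_sgn_char (trp mu)] != 0.
Proof.
move=> mn; rewrite cfdot_pic_eps ?psize_trp //; apply: mulf_neq0; first exact: invr_neq0 fact0.
rewrite pnatr_eq0 sum_nat_eq0 negb_forall.
pose v : {ffun 'I_n -> 'I_n.+1} := [ffun k : 'I_n => inord (reshape_offset mu k)].
have vE k : v k = reshape_offset mu k :> nat.
  have kl : (k < sumn mu)%N by rewrite -/(psize mu) mn.
  rewrite ffunE inordK // ltnS; apply: leq_trans (ltnW (reshape_offsetP kl)) _.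
  by rewrite -[leqRHS]mn row_le_psize.
apply/existsP; exists (rword mu, v); rewrite [_.1]/= [_.2]/= hasC_rword // negb_imply andTb.
apply/andP; split; last first.
  rewrite eqb0 negbK; apply/injectiveP => k l [/(congr1 val) /=]; rewrite !rwordE // => e1.
  move=> /(congr1 val) /=; rewrite !vE => e2; apply: val_inj.
  by rewrite /= -(reshape_indexK mu k) -(reshape_indexK mu l) e1 e2.
apply/forallP => j; apply/eqP.
have e m : m = n -> (\sum_(k < m) (reshape_offset mu k == j) = \sum_(k < n) (reshape_offset mu k == j))%N.
  by move=> ->.
rewrite prow_trp -(count_reshape_offset (Defs.pval mu) j) e // -sum1_card big_mkcond /=.
by apply: eq_bigr => k _; rewrite inE -val_eqE /= vE; case: eqP.
Qed.

End SymmetricCharacters.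

(** * Labelling of the irreducible characters *)

Section IrreducibleCharacters.
Variable n : nat.
Local Notation G := [set: 'S_n]%SET.
Local Notation P s := (cyc (@psum algC) s).
Local Notation K la mu := (coef (schur la) (cont mu)).

Let fact0 : n`!%:R != 0 :> algC.
Proof. by rewrite pnatr_eq0 -lt0n fact_gt0. Qed.

(* The Frobenius characteristic of the irreducible character of index [i] is
   the Schur function of [mu]; its values are integers depending only on the
   cycle type. *)
Definition irr_of (mu : part) (i : Iirr G) : Prop :=
  [/\ forall m, frob_char 'chi_i m = coef (schur mu) m,
      forall s t, P s = P t -> 'chi_i s = 'chi_i t
    & forall s, 'chi_i s \is a Num.int].

Lemma irr_of_inj la mu i : irr_of la i -> irr_of mu i -> la = mu.
Proof. by move=> [h _ _] [h' _ _]; apply: schur_inj => m; rewrite -h h'. Qed.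

Lemma cfdot_pic_irr la mu i : psize mu = n -> irr_of la i -> '[young_perm_char n mu, 'chi_i] = K la mu.
Proof.
move=> mn [h _ _]; rewrite cfdotC cfdot_pic // h conj_natr //; exact: schur_coef_nat.
Qed.

(* Downward induction on dominance: subtracting from the permutation character
   the irreducible characters already found leaves a class function of norm 1. *)
Lemma exists_irr_of mu : psize mu = n -> exists i, irr_of mu i.
Proof.
have [d] := ubnP (n.+1 * n - domsum n mu)%N; elim: d mu => // d IH mu + mn.
rewrite ltnS => hd; have mun : mu \in parts n by rewrite mem_parts mn.
(* Apart from [mu] itself, only partitions strictly dominating [mu] have a nonzero Kostka number;
   their larger [domsum] brings them under the induction hypothesis. *)
pose S := [seq la <- parts n | (la != mu) && (K la mu != 0)].
have SP la : la \in S -> [/\ psize la = n, la != mu & exists i, irr_of la i].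
  rewrite mem_filter => /andP[/andP[lm Klm] lan]; have ln : psize la = n by move: lan; rewrite mem_parts => /eqP.
  split=> //; apply: IH => //; have := dom_domsum lan mun (kostka_dom Klm) lm.
  by have := domsum_le lan; move: hd; lia.
have [f fP] : {f : part -> Iirr G & forall la, la \in S -> irr_of la (f la)}.
  apply: (@choice _ _ (fun la i => la \in S -> irr_of la i)) => la.
  case: (boolP (la \in S)) => [/SP[_ _ [i hi]]|_]; first by exists i.
  by exists 0.
have finj : {in S &, injective f}.
  by move=> la la' h h' e; apply: (irr_of_inj (fP _ h)); rewrite e; exact: fP.
pose psi := young_perm_char n mu - \sum_(la <- S) K la mu *: 'chi_(f la).
have uS : uniq S by rewrite filter_uniq // parts_uniq.
have dotf i : '[psi, 'chi_i] = '[young_perm_char n mu, 'chi_i] - \sum_(la <- S) K la mu * (f la == i)%:R.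
  rewrite cfdotBl cfdot_suml; congr (_ - _); apply: eq_bigr => la _.
  by rewrite cfdotZl cfdot_irr.
have dot0 la : la \in S -> '[psi, 'chi_(f la)] = 0.
  move=> laS; rewrite dotf (bigD1_seq la) //= eqxx mulr1.
  have [_ _ _] := SP _ laS; rewrite (cfdot_pic_irr mn (fP _ laS)).
  rewrite [X in _ - (_ + X)]big1_seq ?addr0 ?subrr // => la' /andP[ne la'S].
  by case: eqP => [/(finj _ _ la'S laS) e|]; rewrite ?mulr0 // e eqxx in ne *.
(* The subtraction leaves exactly the term of [mu] in [chc_pic], whose Kostka number is 1. *)
have chpsi m : frob_char psi m = coef (schur mu) m.
  have -> : frob_char psi m = frob_char (young_perm_char n mu) m - \sum_(la <- S) K la mu * frob_char 'chi_(f la) m.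
    rewrite /frob_char -[X in _ - X](_ : n`!%:R^-1 * \sum_(s : 'S_n) (\sum_(la <- S) K la mu * 'chi_(f la) s) * coef (P s) m = _).
      rewrite -mulrBr -sumrB; congr (_ * _); apply: eq_bigr => s _; rewrite -mulrBl; congr (_ * _).
      rewrite !cfunE sum_cfunE; congr (_ - _); apply: eq_bigr => la _; rewrite cfunE.
      by [].
    under eq_bigr => s _ do rewrite mulr_suml.
    rewrite exchange_big mulr_sumr; apply: eq_bigr => la _.
    rewrite [RHS]mulrCA; congr (_ * _); rewrite mulr_sumr; apply: eq_bigr => s _.
    by rewrite mulrA.
  rewrite chc_pic // (bigD1_seq mu) ?parts_uniq // kostka1 mul1r.
  rewrite -[RHS]addr0 -addrA; congr (_ + _).
  rewrite big_filter big_mkcondr; apply/eqP; rewrite subr_eq0; apply/eqP.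
  rewrite [LHS]big_seq_cond [RHS]big_seq_cond; apply: eq_bigr => la /andP[lan lm].
  case: eqP => [->|/eqP Kl]; first by rewrite mul0r.
  have laS : la \in S by rewrite mem_filter lm Kl.
  by have [-> _ _] := fP _ laS.
have npsi : '[psi] = 1.
  rewrite {2}/psi cfdotBr cfdot_sumr big1_seq ?subr0.
    by rewrite cfdot_pic // chpsi kostka1.
  by move=> la /andP[_ laS]; rewrite cfdotZr dot0 // mulr0.
(* The multiplicity at each [f la] is 0 and elsewhere that of the permutation character, so none is
   negative; norm 1 then makes [psi] irreducible. *)
have cpsi : psi \is a character.
  apply/forallP => i; rewrite coord_cfdot.
  have [/mapP[la laS ->]|ni] := boolP (i \in map f S); first by rewrite dot0.
  rewrite dotf big1_seq ?subr0 ?Cnat_cfdot_char_irr ?pic_char // => la /andP[_ laS].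
  by case: eqP => [e|_]; rewrite ?mulr0 //; case/negP: ni; apply/mapP; exists la.
have /irrP[i psiE] : psi \in irr G by rewrite irrEchar cpsi npsi eqxx.
exists i; rewrite /irr_of -psiE; split=> [//|s t st|s].
  rewrite !cfunE !pic_val // st; congr (_ - _); rewrite !sum_cfunE; apply: eq_big_seq => la laS.
  by rewrite !cfunE; congr (_ * _); have [_ h _] := fP _ laS; exact: h.
rewrite !cfunE pic_val //; apply: rpredB; first by apply: Num.Theory.intr_nat; exact: P_coef_nat.
rewrite sum_cfunE big_seq; apply: rpred_sum => la laS.
rewrite cfunE; apply: rpredM; first by apply: Num.Theory.intr_nat; exact: schur_coef_nat.
by have [_ _] := fP _ laS; apply.
Qed.

(** A constituent of the permutation character of [mu] has a label dominating [mu], by the Kostka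
    numbers; if it also occurs in the induced sign character, Gale-Ryser gives the opposite
    dominance. So the choice in [irr_char] is forced, and it can be made because the two characters
    are not orthogonal. *)
Lemma irr_charE mu : psize mu = n ->
  exists2 i, irr_of mu i & Defs.irr_char n mu = 'chi_i.
Proof.
move=> mn; have [I IP] : {I : part -> Iirr G & forall la, psize la = n -> irr_of la (I la)}.
  apply: (@choice _ _ (fun la i => psize la = n -> irr_of la i)) => la.
  by case: (eqVneq (psize la) n) => [/exists_irr_of[i hi]|/eqP]; [exists i | exists 0].
(* The difference is orthogonal to each ['chi_(I la)] and, by [chc_pic], to the permutation
   character; hence its norm is 0. *)
have picE : young_perm_char n mu = \sum_(la <- parts n) K la mu *: 'chi_(I la).
  apply/eqP; rewrite -subr_eq0 -cfnorm_eq0.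
  have dotK la : la \in parts n -> '[young_perm_char n mu - \sum_(la <- parts n) K la mu *: 'chi_(I la), 'chi_(I la)] = 0.
    rewrite mem_parts => /eqP ln; rewrite cfdotBl (cfdot_pic_irr mn (IP _ ln)) cfdot_suml.
    rewrite (bigD1_seq la) ?parts_uniq ?mem_parts ?ln // cfdotZl cfdot_irr eqxx mulr1.
    rewrite [X in _ - (_ + X)]big1_seq ?addr0 ?subrr // => la' /andP[ne]; rewrite mem_parts => /eqP ln'.
    rewrite cfdotZl cfdot_irr; case: eqP => [e|_]; rewrite ?mulr0 //.
    by case/eqP: ne; apply: (irr_of_inj (IP _ ln')); rewrite e; exact: IP.
  rewrite cfdotBr cfdot_sumr [X in _ - X]big1_seq ?subr0; last first.
    by move=> la lan; rewrite cfdotZr dotK // mulr0.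
  rewrite cfdotBl cfdot_suml cfdot_pic // chc_pic // subr_eq0; apply/eqP.
  apply: eq_big_seq => la; rewrite mem_parts => /eqP ln; rewrite cfdotZl cfdot_pic //.
  by have [-> _ _] := IP _ ln.
have uniq_i i : i \in irr_constt (young_perm_char n mu) -> i \in irr_constt (young_sgn_char n (trp mu)) -> i = I mu.
  rewrite !irr_consttE => h1 h2.
  have [la lan] : exists2 la, la \in parts n & (K la mu != 0) && (I la == i).
    apply/hasP; apply: contraNT h1 => /hasPn h; rewrite picE cfdot_suml big1_seq // => la /andP[_ lan].
    rewrite cfdotZl cfdot_irr; have := h la lan; rewrite negb_and negbK.
    by case/orP => [/eqP ->|/negPf ->]; rewrite ?mul0r ?mulr0.
  case/andP => Kl /eqP Ii; have ln : psize la = n by move: lan; rewrite mem_parts => /eqP.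
  suff -> : mu = la by [].
  apply: dom_anti; last exact: kostka_dom.
  apply: (gale_ryser ln mn); rewrite cfdot_sum_irr.
  (* All terms are products of multiplicities, so a single common constituent makes the scalar
     product nonzero. *)
  have ge0 j : 0 <= '[young_perm_char n la, 'chi_j] * '[young_sgn_char n (trp mu), 'chi_j]^*.
    have N1 := Cnat_cfdot_char_irr j (pic_char n la).
    have N2 := Cnat_cfdot_char_irr j (eps_char n (trp mu)).
    by rewrite conj_natr // mulr_ge0 // natr_ge0.
  rewrite (bigD1 i) //= gt_eqF // ltr_wpDr ?sumr_ge0 //.
  rewrite lt_def ge0 andbT mulf_neq0 ?conjC_eq0 // -Ii.
  by rewrite (cfdot_pic_irr ln (IP _ ln)) kostka1 oner_eq0.
exists (I mu); first exact: IP.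
rewrite /Defs.irr_char; case: pickP => [i /andP[h1 h2]|h]; first by congr 'chi__; exact: uniq_i.
have := gale_ryser_self mn; rewrite cfdot_sum_irr big1 ?eqxx // => i _.
have := h i; rewrite !irr_consttE => /negbT; rewrite negb_and !negbK.
by case/orP => /eqP; rewrite -/(young_perm_char n mu) -/(young_sgn_char n (trp mu)) => ->; rewrite ?conjC0 ?mul0r ?mulr0.
Qed.

End IrreducibleCharacters.

(** * The Frobenius formula *)

Local Notation P s := (cyc (@psum algC) s).

(** A one-sided inverse of a square matrix is two-sided. This turns row orthogonality of characters
    into column orthogonality. *)
Lemma sum_inverse (T : eqType) (F : fieldType) (s : seq T) (A B : T -> T -> F) : uniq s ->
  (forall x z, x \in s -> z \in s -> \sum_(y <- s) A x y * B y z = (x == z)%:R) ->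
  forall x z, x \in s -> z \in s -> \sum_(y <- s) B x y * A y z = (x == z)%:R.
Proof.
case: s => [//|t0 s0]; set s := t0 :: s0 => us AB x z xs zs.
pose MA := \matrix_(i < size s, j < size s) A (nth t0 s i) (nth t0 s j).
pose MB := \matrix_(i < size s, j < size s) B (nth t0 s i) (nth t0 s j).
have e : MA *m MB = 1%:M.
  apply/matrixP => i j; rewrite !mxE; under eq_bigr => k _ do rewrite !mxE.
  rewrite -(big_mkord xpredT (fun k => A (nth t0 s i) (nth t0 s k) * B (nth t0 s k) (nth t0 s j))).
  by rewrite -(big_nth t0 xpredT (fun y => A (nth t0 s i) y * B y (nth t0 s j))) AB ?mem_nth // nth_uniq.
have xi : (index x s < size s)%N by rewrite index_mem.
have zi : (index z s < size s)%N by rewrite index_mem.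
move/mulmx1C: e => /matrixP/(_ (Ordinal xi) (Ordinal zi)); rewrite !mxE.
under eq_bigr => k _ do rewrite !mxE.
rewrite (nth_index t0 xs) (nth_index t0 zs).
rewrite -(big_mkord xpredT (fun k => B x (nth t0 s k) * A (nth t0 s k) z)).
rewrite -(big_nth t0 xpredT (fun y => B x y * A y z)) => ->.
congr (nat_of_bool _)%:R; apply/eqP/eqP => [/(congr1 val) e|xz]; last by apply: val_inj; rewrite /= xz.
change (index x s = index z s) in e.
by rewrite -(nth_index t0 xs) e nth_index.
Qed.

Lemma sort_part_subproof (l : seq nat) :
  let s := [seq k <- sort geq l | (0 < k)%N] in sorted geq s && (0%N \notin s).
Proof.
have geq_tr : transitive geq by move=> y x z /= xy yz; apply: leq_trans yz xy.
by rewrite /= mem_filter ltnn andbT sorted_filter // sort_sorted // => x y; exact: leq_total.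
Qed.

Definition sort_part (l : seq nat) : part := Part (sort_part_subproof l).

Lemma perm_sort_part l : (0%N \notin l) -> perm_eq (sort_part l) l.
Proof.
move=> l0; rewrite /sort_part /= (eq_in_filter (a2 := predT)) ?filter_predT ?perm_sort //.
by move=> k; rewrite mem_sort; case: k l0 => // /negPf ->.
Qed.

Lemma perm_part (mu nu : part) : perm_eq mu nu -> mu = nu.
Proof.
move=> e; apply: val_inj; apply: (sorted_eq (leT := geq)) e.
- by move=> y x z /= xy yz; apply: leq_trans yz xy.
- by move=> x y /= h; apply/eqP; rewrite eqn_leq andbC.
- by case/andP: (part_axiom mu).
- by case/andP: (part_axiom nu).
Qed.

Lemma part_gt0 (mu : part) k : k \in Defs.pval mu -> (0 < k)%N.
Proof. by case/andP: (part_axiom mu) => _; case: k => // /negPf ->. Qed.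

Definition pw (R : pzSemiRingType) (a : nat -> R) (nu : part) : R := \prod_(k <- Defs.pval nu) a k.

Lemma pw_rmorph (R S : comNzRingType) (f : {rmorphism R -> S}) a nu :
  f (pw a nu) = pw (fun k => f (a k)) nu.
Proof. exact: rmorph_prod. Qed.

Section CycleType.
Variable n : nat.
Implicit Type s : 'S_n.

Definition ctype s : part := sort_part [seq #|B| | B : {set 'I_n} <- enum (porbits s)].

Lemma ctype_perm s : perm_eq (ctype s) [seq #|B| | B : {set 'I_n} <- enum (porbits s)].
Proof.
apply: perm_sort_part; apply/mapP => -[B]; rewrite mem_enum => /imsetP[k _ ->].
by move/esym/eqP; rewrite cards_eq0 => /eqP e; have := porbit_id s k; rewrite e inE.
Qed.

Lemma has_cycle_typeE s nu : has_cycle_type s nu = (ctype s == nu).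
Proof.
rewrite /has_cycle_type; apply/idP/eqP => [h|<-].
  by apply: perm_part; apply: perm_trans (ctype_perm s) h.
by rewrite perm_sym ctype_perm.
Qed.

Lemma cyc_pw (R : comNzRingType) (a : nat -> R) s : cyc a s = pw a (ctype s).
Proof. by rewrite /pw (perm_big _ (ctype_perm s)) /= big_map big_enum. Qed.

Lemma psize_ctype s : psize (ctype s) = n.
Proof.
rewrite /psize sumnE (perm_big _ (ctype_perm s)) big_map big_enum /=.
rewrite -[RHS]card_ord -cardsT -sum1_card.
rewrite [RHS](partition_big (porbit s) (mem (porbits s))) /=; last by move=> k _; exact: imset_f.
apply: eq_bigr => B /imsetP[l _ ->]; rewrite -sum1_card; apply: eq_bigl => k.
by rewrite inE /= eq_porbit_mem porbit_sym.
Qed.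

(** For [nu] of size [n] this is 1/z_nu; the value is obtained from an identity between power sums
    rather than from the order of a centraliser. *)
Definition class_density (nu : part) : algC := #|[set s : 'S_n | ctype s == nu]%SET|%:R / n`!%:R.

Lemma sum_ctype (F : part -> algC) :
  n`!%:R^-1 * \sum_(s : 'S_n) F (ctype s) = \sum_(nu <- parts n) class_density nu * F nu.
Proof.
have -> : \sum_(s : 'S_n) F (ctype s) = \sum_(s : 'S_n) \sum_(nu <- parts n | ctype s == nu) F nu.
  apply: eq_bigr => s _; rewrite big_mkcond (bigD1_seq (ctype s)) ?parts_uniq ?mem_parts ?psize_ctype //=.
  by rewrite eqxx big1 ?addr0 // => nu; rewrite eq_sym => /negPf ->.
rewrite (exchange_big_dep xpredT) //= mulr_sumr; apply: eq_bigr => nu _.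
rewrite sum_nat_mulr mulrC -mulrA mulrC /class_density -sum1_card; congr (_%:R * _ * _).
by apply: eq_bigl => s; rewrite inE.
Qed.

End CycleType.

Lemma chi_ctype n mu (s : 'S_n) : psize mu = n -> chi mu (ctype s) = Defs.irr_char n mu s.
Proof.
(* [chi] lives on ['S_(psize mu)], so [n] is replaced by [psize mu]; the permutation picked has the
   cycle type of [s], which determines the character value. *)
move=> mn; case: _ / mn s => s; rewrite /chi; case: pickP => [t|/(_ s)]; last first.
  by rewrite has_cycle_typeE eqxx.
rewrite has_cycle_typeE => /eqP st; have [i [_ h _] ->] := irr_charE (erefl (psize mu)).
by apply: h; rewrite !cyc_pw st.
Qed.

Section Frobenius.
Variable n : nat.
Local Notation class_density := (@class_density n).
Local Notation sum_ctype := (@sum_ctype n).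

Lemma schur_frob mu m : psize mu = n ->
  coef (schur mu) m = \sum_(nu <- parts n) class_density nu * (chi mu nu * coef (pw (@psum algC) nu) m).
Proof.
move=> mn; have [i [h _ _] iE] := irr_charE mn; rewrite -h /frob_char -sum_ctype; congr (_ * _).
by apply: eq_bigr => s _; rewrite chi_ctype // iE cyc_pw.
Qed.

Lemma chi_orth mu la : psize mu = n -> psize la = n ->
  \sum_(nu <- parts n) class_density nu * (chi mu nu * chi la nu) = (mu == la)%:R.
Proof.
move=> mn ln; rewrite -(sum_ctype (fun nu => chi mu nu * chi la nu)).
have [i ihi iE] := irr_charE mn; have [j jhj jE] := irr_charE ln.
have -> : (mu == la) = (i == j).
  apply/eqP/eqP => [e|e]; first by apply/irr_inj; rewrite -iE -jE e.
  by apply: irr_of_inj ihi _; rewrite e.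
rewrite -(cfdot_irr i j) cfdotE cardsT card_Sn; congr (_ * _); apply: eq_big => s; first by rewrite inE.
by move=> _; rewrite !chi_ctype // iE jE conj_intr //; case: jhj.
Qed.

Lemma chi_orth2 nu nu' : psize nu = n -> psize nu' = n ->
  \sum_(mu <- parts n) chi mu nu * (class_density nu' * chi mu nu') = (nu == nu')%:R.
Proof.
move=> h h'; apply: (@sum_inverse _ _ (parts n) (fun mu nu => class_density nu * chi mu nu) (fun nu mu => chi mu nu)).
- exact: parts_uniq.
- move=> mu la; rewrite !mem_parts => /eqP mn /eqP ln; rewrite -chi_orth //.
  by apply: eq_bigr => y _; rewrite mulrA.
- by rewrite mem_parts h.
- by rewrite mem_parts h'.
Qed.

Lemma pw_schur nu m : psize nu = n ->
  coef (pw (@psum algC) nu) m = \sum_(mu <- parts n) chi mu nu * coef (schur mu) m.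
Proof.
move=> nn.
transitivity (\sum_(mu <- parts n) \sum_(nu' <- parts n)
    (chi mu nu * (class_density nu' * chi mu nu')) * coef (pw (@psum algC) nu') m); last first.
  apply: eq_big_seq => mu; rewrite mem_parts => /eqP mn; rewrite (schur_frob m mn) mulr_sumr.
  by apply: eq_bigr => nu' _; rewrite !mulrA.
rewrite exchange_big /=; under eq_bigr => nu' _ do rewrite -mulr_suml.
rewrite (bigD1_seq nu) ?mem_parts ?nn ?parts_uniq // chi_orth2 // eqxx mul1r.
rewrite [X in _ = _ + X]big1_seq ?addr0 // => nu' /andP[ne]; rewrite mem_parts => /eqP nn'.
by rewrite chi_orth2 // eq_sym (negPf ne) mul0r.
Qed.

(** The Kostka matrix is unitriangular: the coefficient at [cont la] leaves [c la] and terms for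
    partitions strictly dominating [la], which vanish by induction. *)
Lemma schur_free (c : part -> algC) :
  (forall m, \sum_(la <- parts n) c la * coef (schur la) m = 0) ->
  forall la, psize la = n -> c la = 0.
Proof.
move=> h la; have [d] := ubnP (n.+1 * n - domsum n la)%N; elim: d la => // d IH la hd ln.
have lan : la \in parts n by rewrite mem_parts ln.
have : c la + \sum_(mu <- parts n | mu != la) c mu * coef (schur mu) (cont la) = 0.
  by rewrite -[RHS](h (cont la)) (bigD1_seq la) ?parts_uniq // kostka1 mulr1.
rewrite [X in _ + X]big1_seq ?addr0 // => mu /andP[ml mun]; have [->|K0] := eqVneq (coef (schur mu) (cont la)) 0; first by rewrite mulr0.
rewrite IH ?mul0r //; last by move: mun; rewrite mem_parts => /eqP.
have := dom_domsum mun lan (kostka_dom K0) ml.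
by have := domsum_le mun; move: hd; lia.
Qed.

(** In the Schur basis the hypothesis becomes one equation for each [mu]; column orthogonality of
    the characters inverts this system. *)
Lemma pw_free (c : part -> algC) :
  (forall m, \sum_(nu <- parts n) c nu * coef (pw (@psum algC) nu) m = 0) ->
  forall nu, psize nu = n -> c nu = 0.
Proof.
move=> h nu nn.
have h2 mu : psize mu = n -> \sum_(nu <- parts n) c nu * chi mu nu = 0.
  apply: (schur_free (c := fun mu => \sum_(nu <- parts n) c nu * chi mu nu)) => m.
  rewrite -[RHS](h m); under eq_bigr => mu' _ do rewrite mulr_suml.
  rewrite exchange_big /=; apply: eq_big_seq => nu'; rewrite mem_parts => /eqP nn'.
  by rewrite pw_schur // mulr_sumr; apply: eq_bigr => la _; rewrite mulrA.
have : \sum_(mu <- parts n) (\sum_(nu' <- parts n) c nu' * chi mu nu') * (class_density nu * chi mu nu) = 0.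
  by rewrite big1_seq // => mu; rewrite mem_parts => /andP[_ /eqP mn]; rewrite h2 // mul0r.
under eq_bigr => mu _ do rewrite mulr_suml.
rewrite exchange_big /= (bigD1_seq nu) ?mem_parts ?nn ?parts_uniq //= => e.
rewrite -e -[LHS]addr0; congr (_ + _).
  under eq_bigr => mu _ do rewrite -mulrA.
  by rewrite -mulr_sumr chi_orth2 // eqxx mulr1.
rewrite big1_seq // => nu' /andP[ne]; rewrite mem_parts => /eqP nn'.
under eq_bigr => mu _ do rewrite -mulrA.
by rewrite -mulr_sumr chi_orth2 // (negPf ne) mulr0.
Qed.

End Frobenius.

(** * Cycle index *)

Definition padd (k : nat) (nu : part) : part := sort_part (k :: Defs.pval nu).
Definition prem (k : nat) (nu : part) : part := sort_part (rem k (Defs.pval nu)).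
Definition pcat (al be : part) : part := sort_part (Defs.pval al ++ Defs.pval be).

Lemma part_notin0 (nu : part) : 0%N \notin Defs.pval nu.
Proof. by case/andP: (part_axiom nu). Qed.

Lemma perm_padd k nu : (0 < k)%N -> perm_eq (padd k nu) (k :: Defs.pval nu).
Proof. by move=> k0; apply: perm_sort_part; rewrite inE negb_or part_notin0 andbT eq_sym -lt0n. Qed.

Lemma perm_pcat al be : perm_eq (pcat al be) (Defs.pval al ++ Defs.pval be).
Proof. by apply: perm_sort_part; rewrite mem_cat negb_or !part_notin0. Qed.

Lemma perm_prem k (nu : part) : k \in Defs.pval nu -> perm_eq (k :: Defs.pval (prem k nu)) (Defs.pval nu).
Proof.
move=> kn; rewrite perm_sym; apply: perm_trans (perm_to_rem kn) _.
rewrite perm_cons perm_sym; apply: perm_sort_part.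
by apply: contraNN (part_notin0 nu) => /mem_rem.
Qed.

Lemma premK k nu : k \in Defs.pval nu -> padd k (prem k nu) = nu.
Proof.
move=> kn; apply: perm_part; apply: perm_trans (perm_padd _ _) (perm_prem kn).
exact: part_gt0 kn.
Qed.

Lemma mem_padd k nu : (0 < k)%N -> k \in Defs.pval (padd k nu).
Proof. by move=> k0; rewrite (perm_mem (perm_padd nu k0)) mem_head. Qed.

Lemma paddK k nu : (0 < k)%N -> prem k (padd k nu) = nu.
Proof.
move=> k0; apply: perm_part; rewrite -(perm_cons k).
by apply: perm_trans (perm_prem (mem_padd nu k0)) (perm_padd nu k0).
Qed.

Lemma psize_perm (mu : part) l : perm_eq (Defs.pval mu) l -> psize mu = sumn l.
Proof. by move=> e; rewrite /psize !sumnE (perm_big _ e). Qed.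

Lemma psize_padd k nu : (0 < k)%N -> psize (padd k nu) = (k + psize nu)%N.
Proof. by move=> k0; rewrite (psize_perm (perm_padd nu k0)). Qed.

Lemma psize_pcat al be : psize (pcat al be) = (psize al + psize be)%N.
Proof. by rewrite (psize_perm (perm_pcat al be)) sumn_cat. Qed.

Lemma pw_padd (R : comPzSemiRingType) (a : nat -> R) k nu : (0 < k)%N ->
  pw a (padd k nu) = a k * pw a nu.
Proof. by move=> k0; rewrite /pw (perm_big _ (perm_padd nu k0)) big_cons. Qed.

Lemma pw_pcat (R : comPzSemiRingType) (a : nat -> R) al be :
  pw a (pcat al be) = pw a al * pw a be.
Proof. by rewrite /pw (perm_big _ (perm_pcat al be)) big_cat. Qed.

Lemma pcat_paddl k al be : (0 < k)%N -> pcat (padd k al) be = padd k (pcat al be).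
Proof.
move=> k0; apply: perm_part; apply: perm_trans (perm_pcat _ _) _.
rewrite perm_sym; apply: perm_trans (perm_padd _ k0) _.
rewrite perm_sym; apply: (@perm_trans _ (k :: Defs.pval al ++ Defs.pval be)).
  by rewrite -cat_cons perm_cat2r perm_padd.
by rewrite perm_cons perm_sym perm_pcat.
Qed.

Lemma pcatC al be : pcat al be = pcat be al.
Proof.
apply: perm_part; apply: perm_trans (perm_pcat _ _) _.
by rewrite perm_sym; apply: perm_trans (perm_pcat _ _) _; rewrite perm_catC.
Qed.

Lemma pcat0 : pcat part0 part0 = part0.
Proof. by apply/eqP; rewrite -psize_eq0 psize_pcat. Qed.

Lemma zeeE nu B : (psize nu < B)%N ->
  zee nu = (\prod_(i < B) (i ^ count_mem (i : nat) (Defs.pval nu) * (count_mem (i : nat) (Defs.pval nu))`!))%N.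
Proof.
move=> nB; pose F i := (i ^ count_mem i (Defs.pval nu) * (count_mem i (Defs.pval nu))`!)%N.
rewrite -(big_mkord xpredT F) (bigID (fun i => i \in Defs.pval nu)) /= [X in (_ * X)%N]big1 ?muln1; last first.
  by move=> i /count_memPn; rewrite /F => ->; rewrite expn0.
rewrite -big_filter /zee; apply: perm_big; apply: uniq_perm; rewrite ?undup_uniq ?filter_uniq ?iota_uniq // => i.
rewrite mem_undup mem_filter mem_index_iota; case: (boolP (i \in _)) => //= h.
rewrite (leq_ltn_trans _ nB) // /psize sumnE (big_rem i) //= leq_addr.
by [].
Qed.

Lemma zee_padd k nu : (0 < k)%N ->
  zee (padd k nu) = (k * (count_mem k (Defs.pval nu)).+1 * zee nu)%N.
Proof.
move=> k0; pose B := (k + psize nu).+1.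
rewrite (@zeeE _ B) ?psize_padd // (@zeeE nu B); last by rewrite ltnS leq_addl.
have kB : (k < B)%N by rewrite ltnS leq_addr.
have cE i : count_mem i (Defs.pval (padd k nu)) = ((k == i) + count_mem i (Defs.pval nu))%N.
  by rewrite (seq.permP (perm_padd nu k0)).
rewrite (bigD1 (Ordinal kB)) //= [in RHS](bigD1 (Ordinal kB)) //= cE eqxx add1n expnS factS.
rewrite [X in (_ * X)%N = _](eq_bigr (fun i : 'I_B => i ^ count_mem (i : nat) (Defs.pval nu) * (count_mem (i : nat) (Defs.pval nu))`!)%N).
  by ring.
move=> i ik; rewrite cE; case: eqP => // ki; case/eqP: ik; exact: val_inj.
Qed.

Lemma zee_gt0 nu : (0 < zee nu)%N.
Proof.
rewrite /zee big_seq; apply: prodn_cond_gt0 => i; rewrite mem_undup => /part_gt0 i0.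
by rewrite muln_gt0 expn_gt0 i0 fact_gt0.
Qed.

Section CycleIndex.
Variables (R : comNzRingType) (f : {rmorphism algC -> R}).
Local Notation iz nu := (f (zee nu)%:R^-1).

Lemma iz_padd k nu : (0 < k)%N ->
  (count_mem k (Defs.pval nu)).+1%:R * iz (padd k nu) = f (k%:R^-1) * iz nu.
Proof.
move=> k0; rewrite -[X in X * _](rmorph_nat f) -!rmorphM zee_padd // !natrM; congr (f _).
have z0 : (zee nu)%:R != 0 :> algC by rewrite pnatr_eq0 -lt0n zee_gt0.
have k0' : k%:R != 0 :> algC by rewrite pnatr_eq0 -lt0n.
have c0 : (count_mem k (Defs.pval nu)).+1%:R != 0 :> algC by rewrite pnatr_eq0.
move: (_.+1%:R) c0 => c c0; move: (zee nu)%:R z0 => z z0; move: k%:R k0' => k' k0'.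
by field; rewrite z0 k0' c0.
Qed.

(** A partition with a marked part [k.+1] is a smaller partition with that part inserted, and the
    multiplicity of the part cancels against z_nu. Weight [g k = k] yields recursions in the size,
    weight 1 recursions in the number of parts. *)
Lemma sum_insert (g : nat -> R) (X : part -> R) N :
  \sum_(nu <- allparts N) (\sum_(k <- Defs.pval nu) g k) * (iz nu * X nu) =
  \sum_(k < N) g k.+1 * f (k.+1%:R^-1) *
    \sum_(nu <- allparts N | (k.+1 + psize nu <= N)%N) iz nu * X (padd k.+1 nu).
Proof.
transitivity (\sum_(nu <- allparts N) \sum_(k < N) (count_mem k.+1 (Defs.pval nu))%:R * g k.+1 * (iz nu * X nu)).
  apply: eq_big_seq => nu; rewrite mem_allparts => nN; rewrite -mulr_suml; congr (_ * _).
  transitivity (\sum_(j <- Defs.pval nu) \sum_(k < N) (j == k.+1)%:R * g k.+1); last first.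
    rewrite exchange_big; apply: eq_bigr => k _; rewrite -mulr_suml -natr_sum; congr (_%:R * _).
    by rewrite -sum1_count [RHS]big_mkcond; apply: eq_bigr => j _ /=; case: eqP.
  apply: eq_big_seq => j jnu; have j0 := part_gt0 jnu.
  have jN : (j.-1 < N)%N.
    rewrite prednK // (leq_trans _ nN) // /psize sumnE (big_rem j) //=; exact: leq_addr.
  rewrite (bigD1 (Ordinal jN)) //= prednK // eqxx mul1r big1 ?addr0 // => k kj.
  by case: eqP => [jk|_]; rewrite ?mul0r //; case/eqP: kj; apply: val_inj; rewrite /= jk.
rewrite exchange_big /=; apply: eq_bigr => k _.
rewrite (bigID (fun nu : part => k.+1 \in Defs.pval nu)) /= [X in _ + X]big1 ?addr0; last first.
  by move=> nu /count_memPn ->; rewrite !mul0r.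
rewrite mulr_sumr; apply: (@big_bij _ _ _ _ _ _ _ (prem k.+1) (padd k.+1)).
- exact: allparts_uniq.
- exact: allparts_uniq.
- move=> nu; rewrite mem_allparts => nN kn; have e := premK kn.
  have : psize nu = (k.+1 + psize (prem k.+1 nu))%N by rewrite -[in LHS]e psize_padd.
  by rewrite mem_allparts => pE; split=> //; move: nN; rewrite pE //; lia.
- move=> nu _ h; rewrite mem_allparts psize_padd // h mem_padd // paddK //.
- move=> nu nN kn; have e := premK kn; rewrite -[in LHS]e -[in RHS]e paddK //.
  set mu := prem _ _.
  rewrite (seq.permP (perm_padd mu (ltn0Sn k))) /= eqxx add1n.
  transitivity (g k.+1 * ((count_mem k.+1 (Defs.pval mu)).+1%:R * iz (padd k.+1 mu)) * X (padd k.+1 mu)); first by ring.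
  by rewrite iz_padd //; ring.
Qed.

(** The complete homogeneous function h_n written in power sums, with p_k replaced by [a k]. *)
Definition cindex (a : nat -> R) n : R := \sum_(nu <- parts n) iz nu * pw a nu.

Lemma cindex0 a : cindex a 0 = 1.
Proof.
rewrite /cindex (bigD1_seq part0) ?mem_parts ?parts_uniq //= big1_seq ?addr0.
  by rewrite /pw big_nil mulr1 /zee big_nil invr1 rmorph1.
by move=> nu /andP[n0]; rewrite mem_parts psize_eq0 (negPf n0).
Qed.

(** Marking a part with weight its length multiplies the term of [nu] by the size [n.+1]. *)
Lemma newton_cindex a n :
  n.+1%:R * cindex a n.+1 = \sum_(k < n.+1) a k.+1 * cindex a (n - k)%N.
Proof.
have := sum_insert (fun k => k%:R) (fun nu => (psize nu == n.+1)%:R * pw a nu) n.+1.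
have -> : n.+1%:R * cindex a n.+1 = \sum_(nu <- allparts n.+1) (\sum_(k <- Defs.pval nu) k%:R) * (iz nu * ((psize nu == n.+1)%:R * pw a nu)).
  rewrite /cindex (sum_parts _ _ (leqnn _)) mulr_sumr big_mkcond; apply: eq_bigr => nu _.
  rewrite andbT -natr_sum -sumnE -/(psize nu); case: eqP => [->|_]; rewrite ?mul1r // mul0r !mulr0.
  by [].
move=> ->; apply: eq_bigr => k _; have kn := ltn_ord k.
have -> : k.+1%:R * f k.+1%:R^-1 = 1.
  by rewrite -[X in X * _](rmorph_nat f) -rmorphM divff ?rmorph1 // pnatr_eq0.
rewrite mul1r /cindex (sum_parts _ _ (leq_trans (leq_subr k n) (leqnSn n))) mulr_sumr [LHS]big_mkcond [RHS]big_mkcond.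
apply: eq_bigr => nu _; rewrite andbT psize_padd // pw_padd //.
have -> : (k.+1 + psize nu == n.+1)%N = (psize nu == n - k)%N by apply/eqP/eqP; lia.
case: eqP => [->|_]; last by rewrite mul0r mulr0 if_same.
by rewrite ifT; [rewrite (_ : true%:R = 1) // mul1r mulrCA | lia].
Qed.

End CycleIndex.

(** Induction on the number of variables and then on the degree, through h_(m+1)(x_1, ..., x_(M+1))
    = h_(m+1)(x_1, ..., x_M) + x_(M+1) h_m(x_1, ..., x_(M+1)). *)
Lemma newton_hx (R : comNzRingType) (x : nat -> R) N n :
  n.+1%:R * hx x N n.+1 = \sum_(k < n.+1) (\sum_(i < N) x i ^+ k.+1) * hx x N (n - k)%N.
Proof.
have hS M m : hx x M.+1 m.+1 = hx x M m.+1 + x M * hx x M.+1 m.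
  rewrite !hxS big_ord_recl expr0 mul1r subn0 mulr_sumr; congr (_ + _).
  by apply: eq_bigr => i _; rewrite subSS mulrA -exprS.
have h0 M : hx x M 0 = 1.
  by elim: M => [|M IH]; [rewrite /hx eqxx | rewrite hxS big_ord1 expr0 mul1r subnn].
elim: N n => [|N IHN] n.
  by rewrite /hx /= mulr0 big1 // => k _; rewrite big_ord0 mul0r.
elim: n => [|n IHn].
  have := IHN 0%N; rewrite big_ord1 subnn h0 mulr1 mul1r => h1.
  by rewrite hS big_ord1 subnn !h0 mul1r !mulr1 big_ord_recr /= h1 expr1.
rewrite hS mulrDr IHN.
rewrite [RHS](eq_bigr (fun k : 'I_n.+2 => (\sum_(i < N) x i ^+ k.+1) * hx x N.+1 (n.+1 - k)%N +
   x N ^+ k.+1 * hx x N.+1 (n.+1 - k)%N)); last by move=> k _; rewrite big_ord_recr mulrDl.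
rewrite big_split /=.
have -> : n.+2%:R * (x N * hx x N.+1 n.+1) = x N * hx x N.+1 n.+1 + x N * (n.+1%:R * hx x N.+1 n.+1).
  by rewrite -[n.+2%:R]natr1; ring.
rewrite IHn [X in _ = _ + X]big_ord_recl /= subn0 expr1 addrCA [RHS]addrCA; congr (_ + _).
rewrite big_ord_recr [X in _ = X + _]big_ord_recr /= subnn !h0 -!addrA [RHS]addrCA [LHS]addrCA; congr (_ + _).
rewrite mulr_sumr -!big_split /=; apply: eq_bigr => k _; have kn := ltn_ord k.
have -> : (n.+1 - k = (n - k).+1)%N by lia.
by rewrite /bump leq0n add1n subSS hS big_ord_recr /= !exprS; ring.
Qed.

(** * Littlewood-Richardson coefficients *)

Section CycleIndexSpec.
Variables (R : comNzRingType) (f : {rmorphism algC -> R}).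
Local Notation iz nu := (f (zee nu)%:R^-1).

Lemma f_natV k : k.+1%:R * f k.+1%:R^-1 = 1.
Proof. by rewrite -[X in X * _](rmorph_nat f) -rmorphM divff ?rmorph1 // pnatr_eq0. Qed.

Lemma mulnI_alg k (u v : R) : k.+1%:R * u = k.+1%:R * v -> u = v.
Proof.
move=> e; rewrite -[u]mul1r -[v]mul1r -(f_natV k) ![_.+1%:R * _]mulrC -!mulrA.
by rewrite e.
Qed.

(** Both sides obey Newton's recursion, and [n.+1] can be cancelled because the ring receives its
    inverse from [algC]. *)
Lemma cindex_hx (x : nat -> R) N n : cindex f (fun k => \sum_(i < N) x i ^+ k) n = hx x N n.
Proof.
have [m] := ubnP n; elim: m n => // m IH [|n] nm.
  rewrite cindex0; elim: N {IH nm} => [|N IHN]; first by rewrite /hx eqxx.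
  by rewrite hxS big_ord1 expr0 mul1r subnn.
apply: (@mulnI_alg n); rewrite newton_cindex newton_hx; apply: eq_bigr => k _.
by rewrite IH //; move: nm; lia.
Qed.

Section Addition.
Variables (a b : nat -> R) (N : nat).

(* The weight [phi] is what the induction needs: splitting off a part [k.+1]
   replaces it by [phi \o padd k.+1]. *)
Definition addL (phi : part -> R) n : R :=
  \sum_(nu <- allparts N) iz nu * ((psize nu == n)%:R * phi nu * pw (fun k => a k + b k) nu).

Definition addQ (phi : part -> R) n : R :=
  \sum_(al <- allparts N) \sum_(be <- allparts N) iz be *
    (iz al * ((psize al + psize be == n)%N%:R * phi (pcat al be) * (pw a al * pw b be))).

Lemma addL_rec phi n : (n < N)%N -> n.+1%:R * addL phi n.+1 =
  \sum_(k < N) (a k.+1 + b k.+1) * ((k <= n)%N%:R * addL (fun nu => phi (padd k.+1 nu)) (n - k)%N).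
Proof.
move=> nN.
have := sum_insert f (fun k => k%:R)
  (fun nu => (psize nu == n.+1)%:R * phi nu * pw (fun k => a k + b k) nu) N.
have -> : \sum_(nu <- allparts N) (\sum_(k <- Defs.pval nu) k%:R) *
   (iz nu * ((psize nu == n.+1)%:R * phi nu * pw (fun k => a k + b k) nu)) = n.+1%:R * addL phi n.+1.
  rewrite /addL mulr_sumr; apply: eq_bigr => nu _; rewrite -natr_sum -sumnE -/(psize nu).
  by case: eqP => [->//|_]; rewrite !mul0r !mulr0.
move=> ->; apply: eq_bigr => k _; rewrite f_natV mul1r /addL big_mkcond !mulr_sumr.
apply: eq_bigr => nu _; rewrite psize_padd // pw_padd //.
have [kn|nk] := leqP k n.
  have -> : (k.+1 + psize nu == n.+1)%N = (psize nu == n - k)%N by apply/eqP/eqP; lia.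
  case: ifP => h; first by rewrite mul1r; ring.
  by case: eqP => [e|_]; [move: h; rewrite e; lia | rewrite !mul0r !mulr0].
rewrite !mul0r mulr0; case: ifP => // _.
by rewrite (_ : (_ == n.+1) = false) ?mul0r ?mulr0 //; apply/negbTE; rewrite neq_ltn; apply/orP; right; lia.
Qed.

Lemma addQ_rec phi n : (n < N)%N ->
  \sum_(al <- allparts N) \sum_(be <- allparts N) iz be *
    (iz al * ((psize al)%:R * ((psize al + psize be == n.+1)%N%:R * phi (pcat al be) * (pw a al * pw b be)))) =
  \sum_(k < N) a k.+1 * ((k <= n)%N%:R * addQ (fun nu => phi (padd k.+1 nu)) (n - k)%N).
Proof.
move=> nN; rewrite exchange_big /=.
transitivity (\sum_(be <- allparts N) \sum_(k < N) iz be * (a k.+1 * ((k <= n)%N%:R *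
   \sum_(al <- allparts N) iz al * ((psize al + psize be == n - k)%N%:R *
       phi (padd k.+1 (pcat al be)) * (pw a al * pw b be))))); last first.
  rewrite exchange_big /=; apply: eq_bigr => k _; rewrite /addQ [in RHS]exchange_big /= !mulr_sumr.
  by apply: eq_bigr => be _; rewrite !mulr_sumr; apply: eq_bigr => al _; ring.
apply: eq_bigr => be _; rewrite -!mulr_sumr; congr (_ * _).
have := sum_insert f (fun k => k%:R)
  (fun al => (psize al + psize be == n.+1)%N%:R * phi (pcat al be) * (pw a al * pw b be)) N.
have -> : \sum_(nu <- allparts N) (\sum_(k <- Defs.pval nu) k%:R) * (iz nu *
    ((psize nu + psize be == n.+1)%N%:R * phi (pcat nu be) * (pw a nu * pw b be))) =
   \sum_(i <- allparts N) iz i * ((psize i)%:R *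
     ((psize i + psize be == n.+1)%N%:R * phi (pcat i be) * (pw a i * pw b be))).
  by apply: eq_bigr => nu _; rewrite -natr_sum -sumnE -/(psize nu); ring.
move=> ->; apply: eq_bigr => k _; rewrite f_natV mul1r big_mkcond !mulr_sumr.
apply: eq_bigr => nu _; rewrite psize_padd // pw_padd // pcat_paddl //.
have [kn|nk] := leqP k n.
  have -> : (k.+1 + psize nu + psize be == n.+1)%N = (psize nu + psize be == n - k)%N by apply/eqP/eqP; lia.
  case: ifP => h; first by rewrite mul1r; ring.
  by case: eqP => [e|_]; [move: h; lia | rewrite !mul0r !mulr0].
rewrite !mul0r mulr0; case: ifP => // _.
by rewrite (_ : (_ == n.+1) = false) ?mul0r ?mulr0 //; apply/negbTE; rewrite neq_ltn; apply/orP; right; lia.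
Qed.

End Addition.

Lemma addQC a b N phi n : addQ a b N phi n = addQ b a N phi n.
Proof.
rewrite /addQ exchange_big /=; apply: eq_bigr => al _; apply: eq_bigr => be _.
by rewrite pcatC addnC; ring.
Qed.

(** Induction on [n]: after multiplication by the size a part is marked, and a marked part of
    [pcat al be] lies in [al] or in [be]; this matches the two summands of [a k + b k]. *)
Lemma cindex_add (a b : nat -> R) N (phi : part -> R) n : (n <= N)%N ->
  addL a b N phi n = addQ a b N phi n.
Proof.
have [m] := ubnP n; elim: m n phi => // m IH [|n] phi nm nN.
  rewrite /addL /addQ (bigD1_seq part0) ?mem_allparts ?allparts_uniq //= big1 ?addr0; last first.
    by move=> nu n0; rewrite psize_eq0 (negPf n0) !mul0r mulr0.
  rewrite [RHS](bigD1_seq part0) ?mem_allparts ?allparts_uniq //= [X in _ = _ + X]big1 ?addr0; last first.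
    by move=> nu n0; rewrite big1 // => be _; rewrite addn_eq0 psize_eq0 (negPf n0) !mul0r !mulr0.
  rewrite [RHS](bigD1_seq part0) ?mem_allparts ?allparts_uniq //= [X in _ = _ + X]big1 ?addr0; last first.
    by move=> nu n0; rewrite psize_eq0 (negPf n0) !mul0r !mulr0.
  rewrite pcat0 /pw !big_nil /zee big_nil invr1 rmorph1.
  by rewrite !mulr1 !mul1r.
apply: (@mulnI_alg n); rewrite addL_rec //.
transitivity (\sum_(k < N) a k.+1 * ((k <= n)%N%:R * addQ a b N (fun nu => phi (padd k.+1 nu)) (n - k)%N) +
   \sum_(k < N) b k.+1 * ((k <= n)%N%:R * addQ b a N (fun nu => phi (padd k.+1 nu)) (n - k)%N)).
  rewrite -big_split; apply: eq_bigr => k _ /=.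
  have [kn|nk] := leqP k n; last by rewrite !mul0r !mulr0 addr0.
  by rewrite !mul1r IH; [rewrite mulrDl [addQ b a _ _ _]addQC|lia|lia].
rewrite -!addQ_rec // [X in _ + X]exchange_big /= -big_split mulr_sumr; apply: eq_bigr => al _.
rewrite -big_split mulr_sumr; apply: eq_bigr => be _ /=.
rewrite [pcat be al]pcatC [(psize be + psize al)%N]addnC.
case: eqP => [e|_]; last by rewrite !mul0r !mulr0 addr0.
by rewrite -e natrD !mul1r; ring.
Qed.

End CycleIndexSpec.

Lemma pw_trunc N (nu : part) : eqN N (pw (@psum algC) nu) (pw (psumN algC N) nu).
Proof.
rewrite /pw big_seq [X in eqN _ _ X]big_seq; apply: eqN_prod => k /part_gt0; exact: psum_trunc.
Qed.

(** Averaging p_sigma over the symmetric group and summing p_nu / z_nu both give h_n, by [cyc_sum]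
    and [cindex_hx]; [pw_free] compares the coefficients. *)
Lemma aa_zee n nu : psize nu = n -> class_density n nu = (zee nu)%:R^-1.
Proof.
move=> nn; apply/eqP; rewrite -subr_eq0; apply/eqP; move: nu nn.
apply: (pw_free (c := fun nu => class_density n nu - (zee nu)%:R^-1)) => m.
have [N mN'] := mset_bound m; have mN i : i \in m -> (i <= N.+1)%N by move=> /mN'/leqW.
have n0 : n`!%:R != 0 :> algC by rewrite pnatr_eq0 -lt0n fact_gt0.
transitivity (\sum_(nu <- parts n) class_density n nu * coef (pw (psumN algC N.+1) nu) m -
              \sum_(nu <- parts n) (zee nu)%:R^-1 * coef (pw (psumN algC N.+1) nu) m).
  by rewrite -sumrB; apply: eq_bigr => nu _; rewrite mulrBl (pw_trunc nu mN).
apply/eqP; rewrite subr_eq0 -(sum_ctype n (fun nu => coef (pw (psumN algC N.+1) nu) m)); apply/eqP.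
transitivity (coef (cindex (@fpsC nat algC) (psumN algC N.+1) n) m); last first.
  by rewrite /cindex fcoef_sum; apply: eq_bigr => nu _; rewrite fcoefCM.
rewrite (cindex_hx _ (fun i => fpsX algC i.+1)).
apply: (mulfI n0); rewrite mulVKf // -fcoefCM rmorph_nat.
rewrite -(coef_prod_geom (fun i => fpsX algC i.+1) _ (leqnn n)).
rewrite -(cyc_sum _ ord0 (fun i : 'I_N.+1 => fpsX algC (i : nat).+1)) fcoef_sum.
by apply: eq_bigr => s _; rewrite cyc_pw.
Qed.

(** * Schur functions with specialised power sums *)

Section SpecialisedSchur.
Variables (R : comNzRingType) (f : {rmorphism algC -> R}).
Local Notation iz nu := (f (zee nu)%:R^-1).

(* The Schur function of [mu] with its power sums p_n specialised to [a n]. *)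
Definition sch (a : nat -> R) (mu : part) : R :=
  \sum_(nu <- parts (psize mu)) f (chi mu nu / (zee nu)%:R) * pw a nu.

Lemma pw_sch a nu n : psize nu = n -> pw a nu = \sum_(mu <- parts n) f (chi mu nu) * sch a mu.
Proof.
move=> nn; transitivity (\sum_(mu <- parts n) \sum_(nu' <- parts n)
    f (chi mu nu * (class_density n nu' * chi mu nu')) * pw a nu'); last first.
  apply: eq_big_seq => mu; rewrite mem_parts => /eqP mn; rewrite /sch mn mulr_sumr.
  apply: eq_big_seq => nu'; rewrite mem_parts => /eqP nn'.
  by rewrite aa_zee // !rmorphM; ring.
rewrite exchange_big /= (bigD1_seq nu) ?mem_parts ?nn ?parts_uniq //=.
rewrite -mulr_suml -rmorph_sum chi_orth2 // eqxx rmorph1 mul1r big1_seq ?addr0 // => nu' /andP[ne].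
rewrite mem_parts => /eqP nn'; rewrite -mulr_suml -rmorph_sum chi_orth2 // eq_sym (negPf ne).
by rewrite rmorph0 mul0r.
Qed.

Lemma cauchy_sch a b n :
  \sum_(la <- parts n) sch a la * sch b la = cindex f (fun k => a k * b k) n.
Proof.
transitivity (\sum_(la <- parts n) \sum_(nu <- parts n) iz nu * pw b nu * (f (chi la nu) * sch a la)).
  apply: eq_big_seq => la; rewrite mem_parts => /eqP ln; rewrite {2}/sch ln mulr_sumr.
  by apply: eq_bigr => nu _; rewrite rmorphM; ring.
rewrite exchange_big /=; apply: eq_big_seq => nu; rewrite mem_parts => /eqP nn.
rewrite -mulr_sumr -(pw_sch a nn) -mulrA; congr (_ * _).
by rewrite mulrC /pw -big_split.
Qed.

End SpecialisedSchur.

(** The scalar product of the restriction of the character of [rho] with the product of those of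
    [mu] and [nu], written with 1/z weights: an explicit candidate for [lr], which is given only by
    its defining property. *)
Definition lrc (rho mu nu : part) : algC :=
  if psize rho == (psize mu + psize nu)%N then
    \sum_(al <- parts (psize mu)) \sum_(be <- parts (psize nu))
      chi mu al / (zee al)%:R * (chi nu be / (zee be)%:R) * chi rho (pcat al be)
  else 0.

Lemma sch_mul_lrc (R : comNzRingType) (f : {rmorphism algC -> R}) a mu nu :
  sch f a mu * sch f a nu =
  \sum_(rho <- parts (psize mu + psize nu)) f (lrc rho mu nu) * sch f a rho.
Proof.
rewrite {1 2}/sch big_distrlr /=.
transitivity (\sum_(al <- parts (psize mu)) \sum_(be <- parts (psize nu))
  \sum_(rho <- parts (psize mu + psize nu))
     f (chi mu al / (zee al)%:R * (chi nu be / (zee be)%:R) * chi rho (pcat al be)) * sch f a rho).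
  apply: eq_big_seq => al; rewrite mem_parts => /eqP an; apply: eq_big_seq => be.
  rewrite mem_parts => /eqP bn; rewrite mulrACA -rmorphM -pw_pcat.
  rewrite (@pw_sch R f a (pcat al be) (psize mu + psize nu)) ?psize_pcat ?an ?bn // mulr_sumr.
  by apply: eq_bigr => rho _; rewrite !rmorphM; ring.
rewrite (eq_bigr _ (fun al _ => exchange_big _ _ _ _ _ _)) /=.
rewrite exchange_big /=; apply: eq_big_seq => rho; rewrite mem_parts => rn.
rewrite /lrc rn rmorph_sum mulr_suml; apply: eq_bigr => al _.
by rewrite rmorph_sum mulr_suml.
Qed.

Lemma schur_sch mu : schur mu = sch (@fpsC nat algC) (@psum algC) mu.
Proof.
apply: fpsP => m; rewrite (@schur_frob (psize mu)) // /sch fcoef_sum; apply: eq_big_seq => nu.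
by rewrite mem_parts => /eqP nn; rewrite fcoefCM aa_zee //; ring.
Qed.

Lemma coef_schur_sum (c : part -> algC) m :
  coef (fps_sum [set: part] (fun rho => fpsC nat (c rho) * schur rho)) m =
  \sum_(rho <- parts (size (enum_mset m))) c rho * coef (schur rho) m.
Proof.
rewrite (@fcoef_fps_sum_seq _ _ _ _ (parts (size (enum_mset m)))) //.
- by apply: eq_bigr => rho _; rewrite fcoefCM.
- exact: parts_uniq.
move=> rho _; rewrite mem_parts fcoefCM => h; apply/eqP; rewrite mulf_eq0; apply/orP; right.
by apply: contraNT h => /schur_coef_size ->.
Qed.

(** [lrc] has the defining property, and the independence of Schur functions of each size makes it
    the only such family, so [xget] can return nothing else. *)
Lemma lrE rho mu nu : lr rho mu nu = lrc rho mu nu.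
Proof.
have lrcP : schur mu * schur nu =
    fps_sum [set: part] (fun rho => fpsC nat (lrc rho mu nu) * schur rho).
  apply: fpsP => m; rewrite coef_schur_sum.
  rewrite {1}schur_sch {1}schur_sch sch_mul_lrc fcoef_sum.
  under eq_bigr => r _ do rewrite -schur_sch fcoefCM.
  have [->//|ne] := eqVneq (size (enum_mset m)) (psize mu + psize nu)%N.
  rewrite big1_seq; last first.
    move=> r /andP[_]; rewrite mem_parts => /eqP rn.
    apply/eqP; rewrite mulf_eq0; apply/orP; right; apply: contraNT ne => /schur_coef_size ->.
    by rewrite rn.
  rewrite big1_seq // => r /andP[_]; rewrite mem_parts => /eqP rn.
  by rewrite /lrc rn (negPf ne) mul0r.
rewrite /lr; case: xgetP => [c _ cP0|/(_ (fun rho => lrc rho mu nu))//].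
have cP : schur mu * schur nu = fps_sum [set: part] (fun rho => fpsC nat (c rho) * schur rho) := cP0.
have : (c rho - lrc rho mu nu) = 0.
  apply: (@schur_free (psize rho) (fun r => c r - lrc r mu nu)) => // m.
  have [e|ne] := eqVneq (size (enum_mset m)) (psize rho); last first.
    rewrite big1_seq // => r /andP[_]; rewrite mem_parts => /eqP rn.
    apply/eqP; rewrite mulf_eq0; apply/orP; right; apply: contraNT ne => /schur_coef_size ->.
    by rewrite rn.
  under eq_bigr => r _ do rewrite mulrBl.
  by rewrite sumrB -e -!coef_schur_sum -lrcP -cP subrr.
by move/eqP; rewrite subr_eq0 => /eqP.
Qed.

Lemma sch_mul (R : comNzRingType) (f : {rmorphism algC -> R}) a mu nu :
  sch f a mu * sch f a nu =
  \sum_(rho <- parts (psize mu + psize nu)) f (lr rho mu nu) * sch f a rho.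
Proof. by rewrite sch_mul_lrc; apply: eq_bigr => rho _; rewrite lrE. Qed.

(** [cindex_add] weighted by [chi mu] expands the left side in products p_al[a] p_be[b]; rewriting
    these in Schur functions produces the coefficient [lrc]. The coproduct thus has the structure
    constants of the product. *)
Lemma sch_add (R : comNzRingType) (f : {rmorphism algC -> R}) a b mu N : (psize mu <= N)%N ->
  sch f (fun k => a k + b k) mu =
  \sum_(la <- allparts N) \sum_(rho <- allparts N) f (lr mu la rho) * (sch f a la * sch f b rho).
Proof.
move=> mN; have := cindex_add f a b (fun nu => f (chi mu nu)) mN.
have -> : addL f a b N (fun nu => f (chi mu nu)) (psize mu) = sch f (fun k => a k + b k) mu.
  rewrite /addL /sch (sum_parts _ _ mN) [RHS]big_mkcond; apply: eq_bigr => nu _; rewrite andbT.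
  by case: eqP => _; [rewrite rmorphM mul1r; ring | rewrite !mul0r mulr0].
rewrite /addQ => ->.
have pwE c (al : part) : al \in allparts N ->
    pw c al = \sum_(la <- allparts N) (psize la == psize al)%:R * (f (chi la al) * sch f c la).
  rewrite mem_allparts => aN; rewrite (@pw_sch R f c al (psize al)) // (sum_parts _ _ aN) big_mkcond.
  by apply: eq_bigr => la _; rewrite andbT; case: eqP => _; rewrite ?mul1r ?mul0r.
transitivity (\sum_(la <- allparts N) \sum_(rho <- allparts N)
  \sum_(al <- allparts N) \sum_(be <- allparts N)
   f (zee be)%:R^-1 * (f (zee al)%:R^-1 * ((psize al + psize be == psize mu)%N%:R * f (chi mu (pcat al be)) *
    (((psize la == psize al)%:R * (f (chi la al) * sch f a la)) *
     ((psize rho == psize be)%:R * (f (chi rho be) * sch f b rho)))))); last first.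
  apply: eq_big_seq => la; rewrite mem_allparts => lN; apply: eq_big_seq => rho; rewrite mem_allparts => rN.
  transitivity (\sum_(al <- parts (psize la)) \sum_(be <- parts (psize rho))
     f (zee be)%:R^-1 * (f (zee al)%:R^-1 * ((psize la + psize rho == psize mu)%N%:R * f (chi mu (pcat al be)) *
    ((f (chi la al) * sch f a la) * (f (chi rho be) * sch f b rho))))).
    rewrite (sum_parts _ _ lN) [RHS]big_mkcond; apply: eq_bigr => al _; rewrite andbT [psize la == _]eq_sym.
    case: eqP => [->|_]; last by rewrite big1 // => be _; rewrite !mul0r !mulr0.
    rewrite (sum_parts _ _ rN) [RHS]big_mkcond; apply: eq_bigr => be _; rewrite andbT [psize rho == _]eq_sym.
    by case: (psize be =P psize rho) => [->|_]; [rewrite !mul1r | rewrite !mul0r !mulr0].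
  rewrite lrE /lrc eq_sym; case: eqP => e; last first.
    by rewrite (rmorph0 f) mul0r big1 // => al _; rewrite big1 // => be _; rewrite !mul0r !mulr0.
  rewrite rmorph_sum mulr_suml; apply: eq_bigr => al _.
  rewrite rmorph_sum mulr_suml; apply: eq_bigr => be _.
  by rewrite !rmorphM mul1r; ring.
under [RHS]eq_bigr => la _ do rewrite exchange_big.
under [RHS]eq_bigr => la _ do under eq_bigr => al _ do rewrite exchange_big.
rewrite [RHS]exchange_big; apply: eq_big_seq => al alN.
rewrite [RHS]exchange_big; apply: eq_big_seq => be beN.
rewrite (pwE a al alN) (pwE b be beN) big_distrlr /= !mulr_sumr; apply: eq_bigr => la _.
by rewrite !mulr_sumr.
Qed.

(** * Principal specialisation *)

Local Notation cst := Defs.cst.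

Fact cst_is_zmod_morphism : zmod_morphism cst.
Proof. by move=> a b; rewrite /cst polyCB tofracB. Qed.

Fact cst_is_monoid_morphism : monoid_morphism cst.
Proof. by split=> [|a b]; rewrite /cst ?polyC1 ?tofrac1 // polyCM tofracM. Qed.

HB.instance Definition _ := GRing.isZmodMorphism.Build algC Kq cst cst_is_zmod_morphism.
HB.instance Definition _ := GRing.isMonoidMorphism.Build algC Kq cst cst_is_monoid_morphism.

Lemma qh_neq0 : qh != 0.
Proof. by rewrite /qh tofrac_eq0 polyX_eq0. Qed.

Lemma at_qhVM A B : at_qhV (A * B) = at_qhV A * at_qhV B.
Proof. by rewrite /at_qhV rmorphM hornerM. Qed.

Lemma at_qhVD A B : at_qhV (A + B) = at_qhV A + at_qhV B.
Proof. by rewrite /at_qhV rmorphD hornerD. Qed.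

Lemma at_qhVB A B : at_qhV (A - B) = at_qhV A - at_qhV B.
Proof. by rewrite /at_qhV rmorphB hornerD hornerN. Qed.

Lemma at_qhVC c : at_qhV c%:P = cst c.
Proof. by rewrite /at_qhV map_polyC hornerC. Qed.

Lemma at_qhVXn n : at_qhV 'X^n = qh^-1 ^+ n.
Proof. by rewrite /at_qhV map_polyXn hornerXn. Qed.

Lemma at_qhV_neq0 B : B != 0 -> at_qhV B != 0.
Proof.
move=> B0; pose n := (size B).-1.
have nS : size B = n.+1 by rewrite /n prednK // size_poly_gt0.
(* Multiplying by q^(n/2) reverses the coefficients and gives a polynomial whose constant term is
   the leading coefficient of [B]. *)
have e : at_qhV B * qh ^+ n = tofrac (\sum_(i < n.+1) B`_i *: 'X^(n - i)).
  rewrite /at_qhV (horner_coef_wide _ (n := n.+1)); last by rewrite -nS size_poly.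
  rewrite mulr_suml rmorph_sum; apply: eq_bigr => i _; have ni := ltn_ord i.
  transitivity (cst B`_i * qh ^+ (n - i)); last first.
    by rewrite -[RHS]/(tofrac (B`_i *: 'X^(n - i))) -mul_polyC tofracM tofracXn.
  rewrite coef_map -mulrA; congr (_ * _).
  by rewrite exprVn -[in qh ^+ n](subnKC (_ : i <= n)%N) // exprD mulKf // expf_neq0 // qh_neq0.
apply: contraTneq isT => h; move: e; rewrite h mul0r => /esym/eqP; rewrite tofrac_eq0 => /eqP /(congr1 (fun p : {poly algC} => p`_0)).
rewrite coef0 coef_sum big_ord_recr /= subnn expr0 coefZ coef1 mulr1 big1 ?add0r.
  by move/eqP; rewrite -[n]/((size B).-1) -lead_coefE lead_coef_eq0 (negPf B0).
move=> i _; rewrite coefZ coefXn; have := ltn_ord i; rewrite -subn_gt0.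
by case: (n - i)%N => // k _; rewrite mulr0.
Qed.

Definition tr N (a : nat -> algC) : {poly algC} := \poly_(i < N) a i.

Lemma coef_conv (B : {poly algC}) a m N : (m < N)%N ->
  \sum_(k < m.+1) B`_k * a (m - k)%N = (B * tr N a)`_m.
Proof.
move=> mN; rewrite coefM; apply: eq_bigr => k _; rewrite coef_poly ifT //.
by apply: leq_ltn_trans mN; exact: leq_subr.
Qed.

Lemma eq_coefM (A A' B B' : {poly algC}) m : (forall k, (k <= m)%N -> A`_k = A'`_k) ->
  (forall k, (k <= m)%N -> B`_k = B'`_k) -> (A * B)`_m = (A' * B')`_m.
Proof.
move=> h h'; rewrite !coefM; apply: eq_bigr => k _.
by rewrite h ?h' ?leq_subr // -ltnS.
Qed.

(** Degree by degree, [A * B'] and [A' * B] both have the coefficients of [B * B'] times the series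
    [a]. *)
Lemma represents_unique a f g : represents a f -> represents a g -> f = g.
Proof.
move=> [A [B [B0 fB AE]]] [A' [B' [B'0 gB AE']]].
have e : A * B' = A' * B.
  apply/polyP => m; have h k : (k <= m)%N -> A`_k = (B * tr m.+1 a)`_k by move=> km; rewrite AE (@coef_conv _ _ _ m.+1).
  have h' k : (k <= m)%N -> A'`_k = (B' * tr m.+1 a)`_k by move=> km; rewrite AE' (@coef_conv _ _ _ m.+1).
  rewrite (eq_coefM h (fun _ _ => erefl)) (eq_coefM h' (fun _ _ => erefl)).
  by apply: (congr1 (fun p : {poly algC} => p`_m)); ring.
apply: (mulIf (at_qhV_neq0 B0)); apply: (mulIf (at_qhV_neq0 B'0)).
by rewrite fB -at_qhVM e at_qhVM -gB; ring.
Qed.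

Lemma eq_represents a b f : a =1 b -> represents a f -> represents b f.
Proof.
move=> ab [A [B [B0 fB AE]]]; exists A, B; split=> // m; rewrite AE.
by apply: eq_bigr => k _; rewrite ab.
Qed.

Definition conv (a b : nat -> algC) m : algC := \sum_(k < m.+1) a k * b (m - k)%N.

Lemma conv_tr a b m N : (m < N)%N -> conv a b m = (tr N a * tr N b)`_m.
Proof.
move=> mN; rewrite -(coef_conv _ _ mN); apply: eq_bigr => k _; rewrite coef_poly ifT //.
by apply: leq_ltn_trans mN; rewrite -ltnS.
Qed.

Lemma representsM a b f g : represents a f -> represents b g -> represents (conv a b) (f * g).
Proof.
move=> [A [B [B0 fB AE]]] [A' [B' [B'0 gB AE']]]; exists (A * A'), (B * B'); split.
- by rewrite mulf_neq0.
- by rewrite !at_qhVM -fB -gB; ring.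
move=> m; have h k : (k <= m)%N -> A`_k = (B * tr m.+1 a)`_k by move=> km; rewrite AE (@coef_conv _ _ _ m.+1).
have h' k : (k <= m)%N -> A'`_k = (B' * tr m.+1 b)`_k by move=> km; rewrite AE' (@coef_conv _ _ _ m.+1).
rewrite (eq_coefM h h') (@coef_conv _ _ _ m.+1) //.
have -> : B * tr m.+1 a * (B' * tr m.+1 b) = B * B' * (tr m.+1 a * tr m.+1 b) by ring.
by apply: eq_coefM => // k km; rewrite coef_poly ltnS km (@conv_tr _ _ _ m.+1).
Qed.

Lemma representsD a b f g : represents a f -> represents b g ->
  represents (fun m => a m + b m) (f + g).
Proof.
move=> [A [B [B0 fB AE]]] [A' [B' [B'0 gB AE']]]; exists (A * B' + A' * B), (B * B'); split.
- by rewrite mulf_neq0.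
- by rewrite at_qhVD !at_qhVM -fB -gB; ring.
move=> m; have h k : (k <= m)%N -> A`_k = (B * tr m.+1 a)`_k by move=> km; rewrite AE (@coef_conv _ _ _ m.+1).
have h' k : (k <= m)%N -> A'`_k = (B' * tr m.+1 b)`_k by move=> km; rewrite AE' (@coef_conv _ _ _ m.+1).
rewrite coefD (eq_coefM h (fun _ _ => erefl)) (eq_coefM h' (fun _ _ => erefl)).
rewrite [RHS](@coef_conv _ (fun m => a m + b m) _ m.+1) // -coefD; have -> : B * tr m.+1 a * B' + B' * tr m.+1 b * B = B * B' * (tr m.+1 a + tr m.+1 b) by ring.
by apply: eq_coefM => // k km; rewrite coefD !coef_poly ltnS km.
Qed.

Lemma representsZ c a f : represents a f -> represents (fun m => c * a m) (cst c * f).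
Proof.
move=> [A [B [B0 fB AE]]]; exists (c%:P * A), B; split=> //; first by rewrite at_qhVM at_qhVC -fB mulrA.
move=> m; rewrite coefCM AE mulr_sumr; apply: eq_bigr => k _; ring.
Qed.

Lemma represents1 : represents (fun m => (m == 0%N)%:R) 1.
Proof.
exists 1, 1; split; rewrite ?oner_neq0 ?mul1r // => m; rewrite coef1.
rewrite (bigD1 ord0) //= coef1 mul1r subn0 big1 ?addr0 // => k k0.
by rewrite coef1 (_ : (k == 0%N :> nat) = false) ?mul0r //; apply/negbTE.
Qed.

Lemma represents0 : represents (fun=> 0) 0.
Proof.
exists 0, 1; split; rewrite ?oner_neq0 ?mul0r //; first by rewrite /at_qhV rmorph0 horner0.
by move=> m; rewrite coef0 big1 // => k _; rewrite mulr0.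
Qed.

Lemma represents_sum (T : eqType) (r : seq T) (a : T -> nat -> algC) (f : T -> Kq) :
  (forall x, x \in r -> represents (a x) (f x)) ->
  represents (fun m => \sum_(x <- r) a x m) (\sum_(x <- r) f x).
Proof.
elim: r => [_|x r IH h].
  by rewrite big_nil; apply: eq_represents represents0 => m; rewrite big_nil.
rewrite big_cons; apply: (@eq_represents (fun m => a x m + \sum_(y <- r) a y m)).
  by move=> m; rewrite big_cons.
apply: representsD; first by apply: h; rewrite mem_head.
by apply: IH => y yr; apply: h; rewrite inE yr orbT.
Qed.

Lemma qint_neq0 n : (0 < n)%N -> qint n != 0.
Proof.
move=> n0; have -> : qint n = (qh ^+ n.*2 - 1) / qh ^+ n.
  by rewrite mulrBl mul1r -addnn exprD mulfK // expf_neq0 // qh_neq0.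
have -> : qh ^+ n.*2 - 1 = tofrac ('X^(n.*2) - 1) by rewrite tofracB tofracXn tofrac1.
apply: mulf_neq0; last by rewrite invr_eq0; apply: expf_neq0; exact: qh_neq0.
rewrite tofrac_eq0; apply/eqP => /(congr1 (fun p : {poly algC} => p`_0)); rewrite coefB coefXn coef1 coef0 /=.
rewrite eq_sym double_eq0 gtn_eqF // sub0r => /eqP.
by rewrite oppr_eq0 oner_eq0.
Qed.

(* 1 / [n] is the sum of q^(- n k / 2) over odd k. *)
Definition psum_coef (n m : nat) : algC := ((n %| m) && odd (m %/ n))%N%:R.

Lemma represents_psum n : (0 < n)%N -> represents (psum_coef n) (qint n)^-1.
Proof.
(* With t = q^(-1/2), 1/[n] = t^n / (1 - t^(2n)). *)
move=> n0; exists 'X^n, (1 - 'X^(n.*2)); split.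
- apply/eqP => /(congr1 (fun p : {poly algC} => p`_0)); rewrite coefB coefXn coef1 coef0 /=.
  by rewrite eq_sym double_eq0 gtn_eqF // subr0 => /eqP; rewrite oner_eq0.
- rewrite at_qhVB -(polyC1 algC) at_qhVC rmorph1 !at_qhVXn.
  have q0 : qh ^+ n != 0 by rewrite expf_neq0 // qh_neq0.
  apply: (mulfI (qint_neq0 n0)); rewrite mulVKf ?qint_neq0 // /qint -addnn exprD !exprVn.
  by rewrite mulrBl mulfV.
move=> m; rewrite coefXn.
transitivity (psum_coef n m - (if (n.*2 <= m)%N then psum_coef n (m - n.*2) else 0)).
  rewrite /psum_coef; case: leqP => h.
    have mE : m = (m - n.*2 + 2 * n)%N by lia.
    have mn : m != n by apply/eqP; move: h; lia.
    rewrite (negPf mn) [in X in X - _]mE dvdn_addl ?dvdn_mull // divnDMl //.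
    by rewrite oddD addbF subrr.
  rewrite subr0; case: eqP => [->|mn]; first by rewrite dvdnn divnn n0.
  case: (boolP (n %| m)%N) => //= /dvdnP[k mk]; move: h mn; rewrite mk mulnK //.
  by case: k {mk} => [|[|k]] //; rewrite ?mul1n // => h; exfalso; move: h; rewrite -mul2n ltn_mul2r; lia.
under eq_bigr => k _ do rewrite coefB coef1 coefXn mulrBl.
rewrite sumrB (bigD1 ord0) //= mul1r subn0 big1 ?addr0; last first.
  by move=> k k0; rewrite (_ : (k == 0%N :> nat) = false) ?mul0r //; apply/negbTE.
congr (_ - _); case: leqP => h.
  rewrite (bigD1 (Ordinal (h : (n.*2 < m.+1)%N))) //= eqxx mul1r big1 ?addr0 // => k k0.
  by rewrite (_ : (k == n.*2 :> nat) = false) ?mul0r //; apply/negbTE.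
rewrite big1 // => k _; rewrite (_ : (k == n.*2 :> nat) = false) ?mul0r //.
by apply/negbTE; rewrite neq_ltn; apply/orP; left; apply: leq_ltn_trans h; rewrite -ltnS.
Qed.

(** * Evaluation at x_i = q^(-i + 1/2) by weight *)

Local Notation mon := {mset nat}%mset.

Definition wt (al : mon) : nat := (\sum_(i <- enum_mset al) (i.*2).-1)%N.

Lemma wt_seq (s : seq nat) : wt (seq_mset s) = (\sum_(i <- s) (i.*2).-1)%N.
Proof. exact/perm_big/perm_eq_seq_mset. Qed.

Lemma wtD (a b : mon) : wt (msetD a b) = (wt a + wt b)%N.
Proof.
rewrite /wt -big_cat; apply: perm_big; apply/seq.permP => P.
rewrite -!sum1_count; apply: perm_big; rewrite /perm_eq; apply/allP => x _.
by apply/eqP; rewrite /= count_cat !count_mem_mset msetE2.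
Qed.

Lemma count_wt (al : mon) i : (al i * (i.*2).-1 <= wt al)%N.
Proof.
rewrite /wt -count_mem_mset; elim: (enum_mset al) => [|x s IH]; first by rewrite big_nil.
by rewrite big_cons /= mulnDl leq_add //; case: eqP => [->|_]; rewrite ?mul1n.
Qed.

(** A finite box holding every monomial of weight at most [N] without the variable 0. That variable
    is kept out because [(0.*2).-1] is 0, so the weight does not bound its exponent. *)
Definition wbox N : seq mon :=
  submsets (seq_mset (flatten [seq nseq N i | i <- iota 1 N])).

Lemma count_box N i : count_mem i (flatten [seq nseq N i | i <- iota 1 N]) = ((0 < i <= N) * N)%N.
Proof.
rewrite count_flatten -map_comp (eq_map (g := fun k => (k == i) * N)%N); last first.
  by move=> k; rewrite /= count_nseq.
rewrite sumnE big_map -big_distrl /=; congr (_ * _)%N.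
transitivity (count_mem i (iota 1 N)); first by rewrite -sum1_count [RHS]big_mkcond; apply: eq_bigr => k _; rewrite /=; case: (k == i).
by rewrite count_uniq_mem ?iota_uniq // mem_iota add1n ltnS.
Qed.

Lemma wbox_uniq N : uniq (wbox N).
Proof. exact: fset_uniq. Qed.

Lemma mem_wbox N (al : mon) : (al \in wbox N) -> forall i, i \in al -> (0 < i <= N)%N.
Proof.
rewrite mem_submsets => /msubsetP h i; rewrite in_mset => ai; have := leq_trans ai (h i).
by rewrite mset_seqE count_box; case: (0 < i <= N)%N.
Qed.

Lemma wbox_wt N (al : mon) : 0%N \notin al -> (wt al <= N)%N -> al \in wbox N.
Proof.
move=> a0 aN; rewrite mem_submsets; apply/msubsetP => i; rewrite mset_seqE count_box.
have [->|i0] := posnP i; first by move: a0; rewrite -mset_eq0 => /eqP ->.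
have [ai|ai] := posnP (al i); first by rewrite ai.
have h := leq_trans (count_wt al i) aN.
have h1 : (al i <= N)%N by apply: leq_trans h; rewrite leq_pmulr //; lia.
have h2 : (i <= N)%N by apply: leq_trans h; apply: leq_trans (leq_pmull _ ai); lia.
by rewrite h2 mul1n.
Qed.

Definition principal_eval (g : fps nat algC) m : algC := \sum_(al <- wbox m | wt al == m) coef g al.

Lemma pcs_wide (F : mon -> algC) m N : (m <= N)%N ->
  \sum_(al <- wbox m | wt al == m) F al = \sum_(al <- wbox N | wt al == m) F al.
Proof.
move=> mN; rewrite -big_filter -[RHS]big_filter; apply: perm_big; apply: uniq_perm; [exact/filter_uniq/wbox_uniq|exact/filter_uniq/wbox_uniq|].
have no0 K (al : mon) : al \in wbox K -> 0%N \notin al by move=> aK; apply/negP => /(mem_wbox aK).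
move=> al; rewrite !mem_filter; case: eqP => //= am.
by apply/idP/idP => /no0 a0; apply: wbox_wt; rewrite // am.
Qed.

Lemma pcs1 m : principal_eval 1 m = (m == 0%N)%:R.
Proof.
rewrite /principal_eval; have z : wt mset0 = 0%N by rewrite /wt enum_mset0 big_nil.
under eq_bigr => al _ do rewrite fcoef1.
have [->|m0] := posnP m.
  rewrite -big_filter (bigD1_seq mset0) ?filter_uniq ?wbox_uniq //=; last first.
    by rewrite mem_filter z eqxx; apply: wbox_wt; rewrite ?z // in_mset0.
  by rewrite eqxx big1 ?addr0 // => al /negPf ->.
rewrite big1 // => al /eqP am; case: eqP => // a0; move: am m0.
by rewrite a0 z => <-.
Qed.

Lemma pcsCM c g m : principal_eval (fpsC nat c * g) m = c * principal_eval g m.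
Proof. by rewrite /principal_eval mulr_sumr; apply: eq_bigr => al _; rewrite fcoefCM. Qed.

Lemma pcs_sum (T : Type) (r : seq T) (F : T -> fps nat algC) m :
  principal_eval (\sum_(x <- r) F x) m = \sum_(x <- r) principal_eval (F x) m.
Proof. by rewrite /principal_eval exchange_big; apply: eq_bigr => al _; rewrite fcoef_sum. Qed.

Lemma pcsM g h m : principal_eval (g * h) m = conv (principal_eval g) (principal_eval h) m.
Proof.
pose U := wbox m; pose F a b := coef g a * coef h b.
transitivity (\sum_(a <- U) \sum_(b <- U) (wt a + wt b == m)%N%:R * F a b).
  transitivity (\sum_(al <- U | wt al == m) \sum_(a <- U) \sum_(b <- U) (msetD a b == al)%:R * F a b).
    rewrite /principal_eval big_seq_cond [RHS]big_seq_cond; apply: eq_bigr => al /andP[aU /eqP am].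
    rewrite fcoefM -(@big_allpairs _ _ _ _ _ _ _ (fun p : mon * mon => (msetD p.1 p.2 == al)%:R * F p.1 p.2)) /=.
    rewrite [RHS](eq_bigr (fun p : mon * mon => if msetD p.1 p.2 == al then F p.1 p.2 else 0)); last first.
      by move=> p _; case: eqP => _; rewrite ?mul1r ?mul0r.
    rewrite -[RHS]big_mkcond -[RHS]big_filter; apply: perm_big; apply: uniq_perm; first exact: splits_uniq.
      by rewrite filter_uniq // allpairs_uniq ?wbox_uniq // => -[? ?] [? ?] _ _ [-> ->].
    move=> p; rewrite mem_splits mem_filter; case: eqP => //= e; apply/esym/allpairsP; exists p.
    have h0 i : i \in (al : mon) -> (0 < i)%N by move/(mem_wbox aU)/andP => [].
    split; last by case: (p).
      apply: wbox_wt; last by rewrite -am -e wtD leq_addr.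
      by apply/negP => h1; have := h0 0%N; rewrite -e in_msetD h1 => /(_ isT).
    apply: wbox_wt; last by rewrite -am -e wtD leq_addl.
    by apply/negP => h1; have := h0 0%N; rewrite -e in_msetD h1 orbT => /(_ isT).
  rewrite exchange_big; apply: eq_big_seq => a aU /=; rewrite exchange_big; apply: eq_big_seq => b bU /=.
  rewrite -mulr_suml; congr (_ * _); rewrite -wtD.
  rewrite -big_filter; case: eqP => e; last first.
    rewrite big1_seq // => al /andP[_]; rewrite mem_filter => /andP[/eqP am _].
    by case: eqP => // h1; case: e; rewrite h1.
  rewrite (bigD1_seq (msetD a b)) ?filter_uniq ?wbox_uniq //=; last first.
    rewrite mem_filter e eqxx; apply: wbox_wt; rewrite ?e // in_msetD negb_or.
    by apply/andP; split; [apply/negP => /(mem_wbox aU)|apply/negP => /(mem_wbox bU)].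
  by rewrite eqxx big1 ?addr0 // => al; rewrite eq_sym => /negPf ->.
rewrite /conv.
transitivity (\sum_(k < m.+1) \sum_(a <- U) \sum_(b <- U)
   ((wt a == k)%:R * (wt b == m - k)%N%:R) * F a b); last first.
  apply: eq_bigr => k _; have km : (k <= m)%N by rewrite -ltnS.
  rewrite /principal_eval (pcs_wide _ km) (pcs_wide _ (leq_subr k m)) !(big_mkcond (fun al => wt al == _)) big_distrlr.
  apply: eq_bigr => a _; apply: eq_bigr => b _ /=.
  by case: eqP => _; case: eqP => _; rewrite ?mul1r ?mulr1 ?mul0r ?mulr0 ?mul0r.
rewrite [RHS]exchange_big; apply: eq_bigr => a _; rewrite [RHS]exchange_big; apply: eq_bigr => b _ /=.
rewrite -[RHS]mulr_suml; congr (_ * _); case: eqP => e.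
  have am : (wt a < m.+1)%N by rewrite ltnS -e leq_addr.
  have bE : (m - wt a)%N = wt b by rewrite -e addKn.
  rewrite (bigD1 (Ordinal am)) //= eqxx bE eqxx mulr1 big1 ?addr0 // => k.
  rewrite -val_eqE eq_sym => /negPf /= ->; exact: mul0r.
rewrite big1 // => k _; have km := ltn_ord k; case: eqP => [ak|_]; last by rewrite mul0r.
by case: eqP => [bk|_]; rewrite ?mulr0 //; case: e; lia.
Qed.

(** The monomial x_(i+1)^n has weight n (2 i + 1), which equals [m] exactly when [n] divides [m]
    with quotient 2 i + 1. *)
Lemma pcs_psum n m : (0 < n)%N -> principal_eval (@psum algC n) m = psum_coef n m.
Proof.
move=> n0; transitivity (\sum_(i < m) (n * (i.*2).+1 == m)%N%:R : algC).
  transitivity (\sum_(al <- wbox m | wt al == m) \sum_(i < m) (al == msetn n i.+1)%:R : algC).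
    rewrite /principal_eval big_seq_cond [RHS]big_seq_cond; apply: eq_bigr => al /andP[aU _].
    rewrite (@psum_trunc algC m n n0); last by move=> i /(mem_wbox aU)/andP[].
    by rewrite /psumN fcoef_sum; apply: eq_bigr => i _; rewrite fpsX_exp.
  rewrite exchange_big; apply: eq_bigr => i _ /=.
  have wE : wt (msetn n i.+1) = (n * (i.*2).+1)%N.
    by rewrite /wt enum_msetn big_nseq iter_addn_0 mulnC.
  rewrite -big_filter -wE; case: eqP => e.
    rewrite (bigD1_seq (msetn n i.+1)) ?filter_uniq ?wbox_uniq //=; last first.
      by rewrite mem_filter e eqxx; apply: wbox_wt; rewrite ?e // in_msetn negb_and orbT.
    by rewrite eqxx big1 ?addr0 // => al /negPf ->.
  rewrite big1_seq // => al /andP[_]; rewrite mem_filter => /andP[/eqP am _].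
  by case: eqP => // h; case: e; rewrite -h.
rewrite /psum_coef; case: (boolP (n %| m)%N) => /= [/dvdnP[k mk]|nm]; last first.
  by rewrite big1 // => i _; case: eqP => // e; case/negP: nm; rewrite -e dvdn_mulr.
rewrite mk mulnK //; case: (boolP (odd k)) => ok.
  have km : (k./2 < k * n)%N by case: k ok {mk} => // k _; nia.
  rewrite (bigD1 (Ordinal km)) //= (_ : (n * _ == _)%N = true) ?big1 ?addr0 //; last first.
    by apply/eqP; rewrite mulnC; congr (_ * _)%N; have := odd_double_half k; rewrite ok add1n.
  move=> i; rewrite -val_eqE /= => ik; case: eqP => //; rewrite mulnC => /eqP.
  by rewrite eqn_pmul2r // => /eqP e; exfalso; move/eqP: ik; apply; move: e; lia.
rewrite big1 // => i _; case: eqP => //; rewrite mulnC => /eqP; rewrite eqn_pmul2r // => /eqP e.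
by move: ok; rewrite -e /= odd_double.
Qed.

Lemma schur_coef0 mu (al : mon) : 0%N \in al -> coef (schur mu) al = 0.
Proof.
move=> a0; apply/eqP; apply: contraTT a0 => /schur_coef_neq0[T [_ T0 _ _] <-].
by rewrite in_mset mset_seqE -has_count; apply/hasPn => k /T0; case: k.
Qed.

Lemma principal_coef_pcs mu m : principal_coef mu m = principal_eval (schur mu) m.
Proof.
rewrite /principal_eval -big_filter; apply: fsbig_seqE => [|al|al /= aw].
- exact/filter_uniq/wbox_uniq.
- by rewrite mem_filter => /andP[/eqP].
have [a0 _|a0] := boolP (0%N \in (al : mon)); first exact: schur_coef0.
by rewrite mem_filter negb_and wbox_wt -?aw ?leqnn //= eqxx.
Qed.

Definition qintV n : Kq := (qint n)^-1.

Lemma represents_pcs_pw nu : represents (principal_eval (pw (@psum algC) nu)) (pw qintV nu).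
Proof.
rewrite /pw; have := @part_gt0 nu; elim: (Defs.pval nu) => [|k s IH] h.
  by rewrite !big_nil; apply: eq_represents represents1 => m; rewrite pcs1.
rewrite !big_cons; apply: (@eq_represents (conv (psum_coef k) (principal_eval (\prod_(j <- s) psum algC j)))).
  move=> m; rewrite pcsM; apply: eq_bigr => i _; rewrite pcs_psum //; apply: h; exact: mem_head.
apply: representsM; first by apply: represents_psum; apply: h; exact: mem_head.
by apply: IH => j js; apply: h; rewrite inE js orbT.
Qed.

(** Expansion in power sums reduces the claim to p_n, whose specialisation is 1/[n]; sums and
    products respect [represents]. *)
Lemma represents_principal mu : represents (principal_coef mu) (sch cst qintV mu).
Proof.
apply: (@eq_represents (fun m => \sum_(nu <- parts (psize mu)) (chi mu nu / (zee nu)%:R) * principal_eval (pw (@psum algC) nu) m)).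
  move=> m; rewrite principal_coef_pcs schur_sch /sch pcs_sum; apply: eq_bigr => nu _.
  by rewrite pcsCM.
by apply: represents_sum => nu _; apply: representsZ; exact: represents_pcs_pw.
Qed.

Lemma W1E mu : W1 mu = sch cst qintV mu.
Proof.
rewrite /W1; case: xgetP => [f _ fP|/(_ (sch cst qintV mu)) h].
  exact: (represents_unique fP (represents_principal mu)).
by case: h; exact: represents_principal.
Qed.

Definition wtT (T : seq (seq nat)) : nat := wt (seq_mset (flatten T)).

Lemma principal_coef_tabs mu m N : (m <= N)%N ->
  principal_coef mu m = (count (fun T => wtT T == m) (tabs N mu))%:R.
Proof.
move=> mN; rewrite principal_coef_pcs /principal_eval.
transitivity (\sum_(al <- wbox m | wt al == m)
   (\sum_(T <- tabs N mu) (al == seq_mset (flatten T)))%:R : algC).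
  rewrite big_seq_cond [RHS]big_seq_cond; apply: eq_bigr => al /andP[aU _].
  by apply: schur_coefE => i /(mem_wbox aU)/andP[_ im]; exact: leq_trans im mN.
rewrite -natr_sum exchange_big -sum1_count [in RHS]big_mkcond /=; congr (_%:R).
apply: eq_big_seq => T; rewrite mem_tabs => /andP[/asboolP[_ T0 _ _] _].
rewrite -big_filter; case: eqP => e.
  rewrite (bigD1_seq (seq_mset (flatten T))) ?filter_uniq ?wbox_uniq //=; last first.
    rewrite mem_filter -/(wtT T) e eqxx; apply: wbox_wt; rewrite -/(wtT T) ?e //.
    by rewrite -mset_eq0 mset_seqE -leqn0 leqNgt -has_count; apply/hasPn => k /T0; case: k.
  by rewrite eqxx big1 // => al /negPf ->.
rewrite big1_seq // => al /andP[_]; rewrite mem_filter => /andP[/eqP am _].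
by case: eqP => // h; case: e; rewrite /wtT -h.
Qed.

(* Transposing a tableau and adding the content restores row and column
   monotonicity, and shifts the weight by [kappa]. *)
Definition tabflip mu (T : seq (seq nat)) :=
  mktab (trp mu) (fun i j => tb T j i + i - j)%N.

Lemma wt_mktab mu f B : (psize mu <= B)%N -> (forall i j, (j < prow mu i)%N -> (0 < f i j)%N) ->
  (wtT (mktab mu f))%:Z =
  \sum_(i < B) \sum_(j < B | (j < prow mu i)%N) (2 * (f i j)%:Z - 1).
Proof.
move=> mB f0; rewrite /wtT wt_seq (@big_mktab _ _ _ _ _ _ B) ?(leq_trans (size_le_psize mu)) //.

rewrite (big_morph Posz PoszD (erefl 0%:Z)); apply: eq_bigr => i _.
rewrite (big_morph Posz PoszD (erefl 0%:Z)).
rewrite (big_ord_widen B (fun j => ((f i j).*2.-1)%:Z)) ?(leq_trans (row_le_psize _ _)) //.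
by apply: eq_bigr => j /f0 h; lia.
Qed.

Lemma tabflipP mu f : istab mu f ->
  let g := (fun i j => f j i + i - j)%N in
  [/\ tabflip mu (mktab mu f) = mktab (trp mu) g, istab (trp mu) g,
    (wtT (mktab (trp mu) g))%:Z = (wtT (mktab mu f))%:Z + kappa mu
    & tabflip (trp mu) (mktab (trp mu) g) = mktab mu f].
Proof.
(* Columns are strict, so an entry of row [j] exceeds [j]; the natural subtraction in [g] is exact
   and leaves positive entries. *)
move=> h g; have ge i j : (j < prow (trp mu) i)%N -> (j < f j i)%N.
  by rewrite ltn_prow_trp; exact: istab_geS.
have gt : istab (trp mu) g.
  move=> i j ij; have fj := ge i j ij; have ij' := ij; rewrite ltn_prow_trp in ij'.
  have [_ h2 h3] := h j i ij'; rewrite /g; split; first by lia.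
    by apply/implyP; rewrite ltn_prow_trp => l; move: h3; rewrite l /=; lia.
  by apply/implyP; rewrite ltn_prow_trp => l; move: h2; rewrite l /=; lia.
split=> //.
- by apply: eq_mktab => i j; rewrite ltn_prow_trp => ij; rewrite nth_mktab.
(* The entry of a cell changes by its content and its weight by twice that, which adds up to
   [kappa mu]. *)
- rewrite (@wt_mktab (trp mu) g (psize mu)) ?psize_trp //; last by move=> i j /gt[].
  rewrite (@wt_mktab mu f (psize mu)) //; last by move=> i j /h[].
  rewrite (@kappa_cells mu (psize mu)) // (exchange_big_dep xpredT) //= -big_split.
  apply: eq_bigr => i _ /=; rewrite -big_split; apply: eq_big => j; first by rewrite ltn_prow_trp.
  move=> ij; have := ge j i ij; rewrite /g => l.
  by rewrite -[RHS]/(2 * (f i j)%:Z - 1 + 2 * ((j : nat)%:Z - (i : nat)%:Z)); lia.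
rewrite /tabflip trpK; apply: eq_mktab => i j ij; rewrite nth_mktab ?ltn_prow_trp //.
by rewrite /g; have := istab_geS h ij; lia.
Qed.

Lemma entries_le_wt (T : seq (seq nat)) N : (wtT T <= N)%N -> all (leq^~ N) (flatten T).
Proof.
move=> TN; apply/allP => k kT; have [->//|k0] := posnP k.
apply: leq_trans TN; apply: leq_trans (count_wt (seq_mset (flatten T)) k).
have h : (0 < seq_mset (flatten T) k)%N by rewrite mset_seqE -has_count has_pred1.
by apply: leq_trans (leq_pmull _ h); lia.
Qed.

Lemma count_tabflip mu m m' N : (m <= N)%N -> (m' <= N)%N -> m'%:Z = m%:Z + kappa mu ->
  (count (fun T => wtT T == m) (tabs N mu) <= count (fun T => wtT T == m') (tabs N (trp mu)))%N.
Proof.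
move=> mN m'N e; rewrite -!size_filter -(size_map (tabflip mu)); apply: uniq_leq_size.
  rewrite map_inj_in_uniq ?filter_uniq ?tabs_uniq // => T T'; rewrite !mem_filter.
  move=> /andP[_ /tabs_mktab[f [-> hf _]]] /andP[_ /tabs_mktab[f' [-> hf' _]]].
  have [-> _ _ e1] := tabflipP hf; have [-> _ _ e2] := tabflipP hf'.
  by rewrite -e1 -e2 => ->.
move=> T' /mapP[T]; rewrite mem_filter => /andP[/eqP wT /tabs_mktab[f [TE hf _]]] ->.
rewrite TE; have [-> hg wg _] := tabflipP hf.
have wE : wtT (mktab (trp mu) (fun i j => f j i + i - j)%N) = m'.
  by apply/eqP; rewrite -eqz_nat wg -TE wT e.
by rewrite mem_filter wE eqxx mem_tabs entries_le_wt ?wE // andbT; apply/asboolP/ssyt_mktab.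
Qed.

(** Flipping is injective in both directions, so the two finite sets of tableaux have equal
    cardinality. *)
Lemma principal_coef_trp mu m m' : m'%:Z = m%:Z + kappa mu ->
  principal_coef (trp mu) m' = principal_coef mu m.
Proof.
move=> e; rewrite (@principal_coef_tabs _ m' (m + m')) ?leq_addl //.
rewrite (@principal_coef_tabs _ m (m + m')) ?leq_addr //; congr (_%:R).
apply/eqP; rewrite eqn_leq count_tabflip ?leq_addl ?leq_addr // andbT.
have := @count_tabflip (trp mu) m' m (m + m'); rewrite trpK; apply; rewrite ?leq_addl ?leq_addr //.
by rewrite kappa_trp e addrK.
Qed.

(** Flipping a tableau of weight [m] back would give the negative weight [m - kappa mu]. *)
Lemma principal_coef_trp0 mu m : (m%:Z < kappa mu)%R -> principal_coef (trp mu) m = 0.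
Proof.
move=> lt; rewrite (@principal_coef_tabs _ m m) //; case E: (count _ _) => [//|k]; have : (0 < count (fun T => wtT T == m) (tabs m (trp mu)))%N by rewrite E.
rewrite -has_count => /hasP[T /tabs_mktab[f [-> hf _]] /eqP wT]; exfalso.
by have [_ _] := tabflipP hf; rewrite wT kappa_trp trpK => wE _; move: wE lt; lia.
Qed.

Lemma represents_qhV k : represents (fun m => (m == k)%:R) (qh^-1 ^+ k).
Proof.
exists 'X^k, 1; split; first exact: oner_neq0.
  by rewrite at_qhVXn -(polyC1 algC) at_qhVC rmorph1 mulr1.
move=> m; rewrite coefXn (bigD1 ord0) //= coef1 mul1r subn0 big1 ?addr0 // => i i0.
by rewrite coef1 (_ : (i == 0%N :> nat) = false) ?mul0r //; apply/negbTE.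
Qed.

Lemma represents_W1 mu : represents (principal_coef mu) (W1 mu).
Proof. by rewrite W1E; exact: represents_principal. Qed.

(** Multiplication by q^(-k/2) shifts the expansion by [k] places. For negative [kappa] the shift
    would go backwards; that case follows by exchanging the two shapes. *)
Lemma W1_trp_ge0 mu k : kappa mu = k%:Z -> W1 (trp mu) = qh ^ (- kappa mu) * W1 mu.
Proof.
move=> muk; apply: (represents_unique (represents_W1 (trp mu))).
rewrite muk -exprnN -exprVn; apply: (eq_represents _ (representsM (represents_qhV k) (represents_W1 mu))).
move=> m; rewrite /conv; have [km|mk] := leqP k m.
  rewrite (bigD1 (Ordinal (km : (k < m.+1)%N))) //= eqxx mul1r big1 ?addr0; last first.
    by move=> i ik; rewrite (_ : (i == k :> nat) = false) ?mul0r //; apply/negbTE.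
  by apply/esym/principal_coef_trp; rewrite muk; lia.
rewrite principal_coef_trp0 ?muk // big1 // => i _; have := ltn_ord i.
by case: eqP => [->|_ _]; [lia|rewrite mul0r].
Qed.

Lemma W1_trp mu : W1 (trp mu) = qh ^ (- kappa mu) * W1 mu.
Proof.
case E : (kappa mu) => [k|k]; first by rewrite -E; exact: W1_trp_ge0 E.
have E' : kappa (trp mu) = k.+1%:Z by rewrite kappa_trp E NegzE opprK.
have := W1_trp_ge0 E'; rewrite trpK => ->; rewrite -E kappa_trp opprK mulrA -expfzDr ?qh_neq0 //.
by rewrite addNr expr0z mul1r.
Qed.

Lemma lr_eq0 rho mu nu : psize rho != (psize mu + psize nu)%N -> lr rho mu nu = 0.
Proof. by move=> h; rewrite lrE /lrc (negPf h). Qed.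

Lemma WskewE N mu nu : (psize mu <= N)%N ->
  Wskew mu nu = \sum_(lam <- allparts N) cst (lr mu nu lam) * W1 lam.
Proof.
move=> mN; apply: fsbig_seqE => [||lam _]; [exact: allparts_uniq|by []|].
rewrite mem_allparts => lN; rewrite lr_eq0 ?rmorph0 ?mul0r //.
by apply/eqP; move: mN lN; lia.
Qed.

Lemma Wskew_eq0 mu nu : (psize mu < psize nu)%N -> Wskew mu nu = 0.
Proof.
move=> lt; rewrite (@WskewE (psize mu)) // big1 // => lam _.
by rewrite lr_eq0 ?rmorph0 ?mul0r //; apply/eqP; lia.
Qed.

(** The framing factors of an edge cancel the prefactor of [W2], and the sum stops at [N] because
    the skew function vanishes for larger [lam]. *)
Lemma W2E N mu nu : (psize mu <= N)%N ->
  qh ^ (- kappa mu) * W2 mu nu * qh ^ (- kappa nu) =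
  \sum_(lam <- allparts N) Wskew (trp mu) lam * Wskew (trp nu) lam.
Proof.
move=> mN; rewrite /W2 !mulrA -expfzDr ?qh_neq0 // addrA addNr add0r mulrAC.
rewrite -expfzDr ?qh_neq0 // subrr expr0z mul1r.
apply: fsbig_seqE => [||lam _]; [exact: allparts_uniq|by []|].
by rewrite mem_allparts -ltnNge => lN; rewrite Wskew_eq0 ?mul0r // psize_trp (leq_ltn_trans mN).
Qed.

(* The summation variables rho^1 and rho^3 trade places. *)
Lemma W3_trp mu1 mu2 mu3 :
  qh ^ (kappa mu1 + kappa mu2 + kappa mu3) * W3 (trp mu3) (trp mu2) (trp mu1) =
  W3 mu1 mu2 mu3.
Proof.
rewrite /W3 !trpK W1_trp mulrA -expfzDr ?qh_neq0 //.
(* The factor with [kappa mu2] on the right is supplied on the left by [W1_trp], applied to the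
   denominator. *)
have -> : kappa mu1 + kappa mu2 + kappa mu3 + (kappa (trp mu2) + kappa (trp mu1)) = kappa mu3.
  by rewrite !kappa_trp; ring.
rewrite [in RHS]expfzDr ?qh_neq0 // [qh ^ kappa mu2 * _]mulrC -[RHS]mulrA; congr (_ * _).
rewrite mulr_fsumr.
rewrite (@reindex_fsbigT _ _ _ _ _ (fun r : part * part * part => (r.1.1, r.2, r.1.2))); last first.
  by exists (fun r : part * part * part => (r.1.1, r.2, r.1.2)) => -[[]].
apply: eq_fsbigr => -[[r r1] r3] _ /=.
by rewrite invfM invr_expz opprK; set a := qh ^ _; set b := (W1 mu2)^-1; ring.
Qed.

(** * Power series up to a given degree *)

Section Degree.
Variables (I : choiceType) (R : comNzRingType).
Local Notation mon := {mset I}%mset.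
Implicit Types (f g : fps I R) (m : mon).

Definition msize m : nat := size (enum_mset m).

Lemma msizeD a b : msize (msetD a b) = (msize a + msize b)%N.
Proof.
rewrite /msize -size_cat; apply: perm_size; apply/allP => x _.
by apply/eqP; rewrite /= count_cat !count_mem_mset msetE2.
Qed.

Definition low d f : Prop := forall m, (msize m < d)%N -> coef f m = 0.

Lemma low0 d : low d 0.
Proof. by move=> m _; rewrite fcoef0. Qed.

Lemma lowW d d' f : (d' <= d)%N -> low d f -> low d' f.
Proof. by move=> dd h m md; apply: h; exact: leq_trans md dd. Qed.

Lemma lowD d f g : low d f -> low d g -> low d (f + g).
Proof. by move=> h h' m md; rewrite fcoefD h ?h' ?addr0. Qed.

Lemma low_sum d (T : eqType) (r : seq T) (P : pred T) (F : T -> fps I R) :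
  (forall x, x \in r -> P x -> low d (F x)) -> low d (\sum_(x <- r | P x) F x).
Proof.
move=> h; rewrite big_seq_cond; apply: (big_ind (low d)); [exact: low0|exact: lowD|].
by move=> x /andP[]; exact: h.
Qed.

Lemma lowM d d' f g : low d f -> low d' g -> low (d + d') (f * g).
Proof.
move=> h h' m md; rewrite fcoefM big1_seq // => -[a b] /andP[_]; rewrite mem_splits /= => /eqP e.
move: md; rewrite -e msizeD => md; have [ad|da] := ltnP (msize a) d; first by rewrite h ?mul0r.
by rewrite h' ?mulr0 //; move: md da; lia.
Qed.

Lemma low_any f : low 0 f.
Proof. by []. Qed.

Lemma lowMl d f g : low d f -> low d (g * f).
Proof. by move=> h; have := lowM (@low_any g) h. Qed.

Lemma lowMr d f g : low d f -> low d (f * g).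
Proof. by move=> h; rewrite mulrC; exact: lowMl. Qed.

Lemma low_prod (T : eqType) (r : seq T) (d : T -> nat) (F : T -> fps I R) :
  (forall x, x \in r -> low (d x) (F x)) -> low (\sum_(x <- r) d x)%N (\prod_(x <- r) F x).
Proof.
elim: r => [|x r IH] h; first by rewrite !big_nil.
rewrite !big_cons; apply: lowM; first by apply: h; rewrite mem_head.
by apply: IH => y yr; apply: h; rewrite inE yr orbT.
Qed.

Lemma lowX d f n : low d f -> low (n * d) (f ^+ n).
Proof. by move=> h; elim: n => // n IH; rewrite exprS mulSn; exact: lowM. Qed.

Lemma low_fpsX i : low 1 (fpsX R i).
Proof.
move=> m; rewrite /= ltnS leqn0 => m0; case: eqP => // e; move: m0.
by rewrite e /msize enum_msetn.
Qed.

Lemma low_fpsXn i n : low n (fpsX R i ^+ n).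
Proof. by rewrite -[n in low n]muln1; apply: lowX; exact: low_fpsX. Qed.

(** Equality modulo degree above [B], under which infinite sums may be replaced by finite ones. *)
Definition eqd B f g : Prop := forall m, (msize m <= B)%N -> coef f m = coef g m.

Lemma eqd_refl B f : eqd B f f. Proof. by []. Qed.

Lemma eqd_sym B f g : eqd B f g -> eqd B g f.
Proof. by move=> h m mB; rewrite h. Qed.

Lemma eqd_trans B g f h : eqd B f g -> eqd B g h -> eqd B f h.
Proof. by move=> e e' m mB; rewrite e ?e'. Qed.

Lemma eqdD B f g f' g' : eqd B f f' -> eqd B g g' -> eqd B (f + g) (f' + g').
Proof. by move=> e e' m mB; rewrite !fcoefD e ?e'. Qed.

Lemma eqdM B f g f' g' : eqd B f f' -> eqd B g g' -> eqd B (f * g) (f' * g').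
Proof.
move=> e e' m mB; rewrite !fcoefM; apply: eq_big_seq => -[a b]; rewrite mem_splits /= => /eqP ab.
by move: mB; rewrite -ab msizeD => mB; rewrite e ?e' //; apply: leq_trans mB; rewrite ?leq_addr ?leq_addl.
Qed.

Lemma eqd_sum B (T : eqType) (r : seq T) (P : pred T) (F G : T -> fps I R) :
  (forall x, x \in r -> P x -> eqd B (F x) (G x)) ->
  eqd B (\sum_(x <- r | P x) F x) (\sum_(x <- r | P x) G x).
Proof.
move=> h m mB; rewrite !fcoef_sum big_seq_cond [RHS]big_seq_cond; apply: eq_bigr => x /andP[xr Px].
exact: h.
Qed.

Lemma eqd_low B d f : (B < d)%N -> low d f -> eqd B f 0.
Proof. by move=> Bd h m mB; rewrite h ?fcoef0 //; exact: leq_ltn_trans Bd. Qed.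

Lemma eqd_drop B (T : eqType) (r : seq T) (P : pred T) (F : T -> fps I R) :
  (forall x, x \in r -> ~~ P x -> low B.+1 (F x)) ->
  eqd B (\sum_(x <- r) F x) (\sum_(x <- r | P x) F x).
Proof.
move=> h; rewrite (bigID P) /= -[X in eqd _ _ X]addr0; apply: eqdD; first exact: eqd_refl.
by apply: (@eqd_low _ B.+1) => //; apply: low_sum.
Qed.

Section Graded.
Variable f : {rmorphism algC -> fps I R}.
Local Notation iz nu := (f (zee nu)%:R^-1).

(** Under this condition p_nu[a] and s_mu[a] start in degrees |nu| and |mu|, which makes sums over
    partitions locally finite. *)
Definition graded (a : nat -> fps I R) : Prop := forall k, low k (a k).

Lemma low_pw a nu : graded a -> low (psize nu) (pw a nu).
Proof. by move=> h; rewrite /psize sumnE /pw; apply: low_prod. Qed.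

Lemma low_sch a mu : graded a -> low (psize mu) (sch f a mu).
Proof.
move=> h; apply: low_sum => nu; rewrite mem_parts => /eqP <- _; apply: lowMl; exact: low_pw.
Qed.

(* The exponential of the sum of the [a n / n], up to degree [B]. *)
Definition cexp B a : fps I R := \sum_(n < B.+1) cindex f a n.

Lemma cexpE B a : cexp B a = \sum_(nu <- allparts B) iz nu * pw a nu.
Proof.
rewrite /cexp; transitivity (\sum_(n < B.+1) \sum_(nu <- allparts B) (psize nu == n)%:R * (iz nu * pw a nu)).
  apply: eq_bigr => n _; rewrite /cindex (@sum_parts _ n B); last by rewrite -ltnS.
  by rewrite big_mkcond; apply: eq_bigr => nu _; rewrite andbT; case: eqP => _; rewrite ?mul1r ?mul0r.
rewrite exchange_big; apply: eq_big_seq => nu; rewrite mem_allparts => nB /=.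
rewrite (bigD1 (Ordinal (nB : (psize nu < B.+1)%N))) //= eqxx mul1r big1 ?addr0 // => n.
by rewrite -val_eqE eq_sym => /negPf /= ->; rewrite mul0r.
Qed.

Lemma eq_cexp B a b : (forall k, (0 < k)%N -> a k = b k) -> cexp B a = cexp B b.
Proof.
move=> ab; rewrite !cexpE; apply: eq_bigr => nu _; apply: (congr1 (fun x => _ * x)).
by apply: eq_big_seq => k /part_gt0; exact: ab.
Qed.

Lemma cexp0 B : cexp B (fun=> 0) = 1.
Proof.
rewrite cexpE (bigD1_seq part0) ?mem_allparts ?allparts_uniq //= big1 ?addr0.
  by rewrite /pw big_nil mulr1 /zee big_nil invr1 rmorph1.
move=> nu; rewrite -psize_eq0 => nu0; rewrite /pw; case: nu nu0 => -[|k s] i // _.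
by rewrite big_cons mul0r mulr0.
Qed.

(** [cindex_add] with weight 1 gives the pairs with |al| + |be| at most [B]; the further pairs of
    the product have degree above [B]. *)
Lemma cexp_add B a b : graded a -> graded b ->
  eqd B (cexp B (fun k => a k + b k)) (cexp B a * cexp B b).
Proof.
move=> ga gb; pose D (al be : part) := (psize al + psize be <= B)%N.
apply: (@eqd_trans _ (\sum_(al <- allparts B) \sum_(be <- allparts B | D al be) iz be * (iz al * (pw a al * pw b be)))).
  suff <- : cexp B (fun k => a k + b k) =
    \sum_(al <- allparts B) \sum_(be <- allparts B | D al be) iz be * (iz al * (pw a al * pw b be)) by [].
  transitivity (\sum_(n < B.+1) addQ f a b B (fun=> 1) n).
    apply: eq_bigr => n _; have nB : (n <= B)%N by rewrite -ltnS.
    rewrite -cindex_add // /addL /cindex (@sum_parts _ _ B) // big_mkcond.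
    by apply: eq_bigr => nu _; rewrite andbT; case: eqP => _; rewrite ?mul1r ?mul0r ?mulr0.
  rewrite /addQ exchange_big; apply: eq_bigr => al _; rewrite exchange_big [RHS]big_mkcond.
  apply: eq_bigr => be _ /=; rewrite /D; have [h|h] := leqP (psize al + psize be) B.
    rewrite (bigD1 (Ordinal (h : (psize al + psize be < B.+1)%N))) //= eqxx !mul1r big1 ?addr0 // => n.
    by rewrite -val_eqE eq_sym => /negPf /= ->; rewrite !mul0r !mulr0.
  rewrite big1 // => n _; have nB := ltn_ord n; case: eqP => [e|_].
    by move: h; rewrite e ltnNge -ltnS nB.
  by rewrite !mul0r !mulr0.
rewrite !cexpE big_distrlr /=; apply: eqd_sum => al _ _; apply: eqd_sym.
rewrite (eq_bigr (fun be => iz be * (iz al * (pw a al * pw b be)))) => [|be _]; last by ring.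
apply: eqd_drop => be _; rewrite /D -ltnNge => h; apply: lowMl; apply: lowMl.
by apply: lowW h _; apply: lowM; exact: low_pw.
Qed.

Lemma cexp_sum B (T : eqType) (r : seq T) (a : T -> nat -> fps I R) :
  (forall x, x \in r -> graded (a x)) ->
  eqd B (cexp B (fun k => \sum_(x <- r) a x k)) (\prod_(x <- r) cexp B (a x)).
Proof.
elim: r => [|x r IH] h.
  by rewrite big_nil (@eq_cexp _ _ (fun=> 0)) ?cexp0 // => k _; rewrite big_nil.
rewrite big_cons (@eq_cexp _ _ (fun k => a x k + \sum_(y <- r) a y k)); last by move=> k _; rewrite big_cons.
have h' y : y \in r -> graded (a y) by move=> yr; apply: h; rewrite inE yr orbT.
apply: (@eqd_trans _ (cexp B (a x) * cexp B (fun k => \sum_(y <- r) a y k))); last first.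
  by apply: eqdM; [exact: eqd_refl|exact: IH].
apply: cexp_add; first by apply: h; rewrite mem_head.
by move=> k; apply: low_sum => y /h' g _; exact: g.
Qed.

End Graded.
End Degree.

(** * The exponential in terms of power sums *)

Section Exponential.
Variables (I : choiceType) (K : fieldType) (c : {rmorphism algC -> K}).
Local Notation f := (@fpsC I K \o c : {rmorphism algC -> fps I K}).
Local Notation iz nu := (f (zee nu)%:R^-1).
Variables (B : nat) (a : nat -> fps I K) (F : fps I K).
Hypotheses (ga : graded a) (F1 : low 1 F).
Hypothesis FE : eqd B F (\sum_(k < B) f k.+1%:R^-1 * a k.+1).

(** The contribution to [cexp] of the partitions with [k] parts; up to degree [B] it is F^k / k!. *)
Definition lpart k : fps I K :=
  \sum_(nu <- allparts B) iz nu * ((size (Defs.pval nu) == k)%:R * pw a nu).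

Lemma lpart0 : lpart 0 = 1.
Proof.
rewrite /lpart (bigD1_seq part0) ?mem_allparts ?allparts_uniq //= big1 ?addr0.
  by rewrite /pw big_nil !mulr1 /zee big_nil invr1 !rmorph1.
move=> nu /negPf nu0; case: eqP => [/size0nil e|_]; last by rewrite mul0r mulr0.
by move: nu0; rewrite -psize_eq0 /psize e.
Qed.

(** [sum_insert] with weight 1 counts the parts of [nu]; the terms it leaves out of the product on
    the right have degree above [B]. *)
Lemma lpartS k : eqd B (k.+1%:R * lpart k.+1) (F * lpart k).
Proof.
apply: (@eqd_trans _ _ _ ((\sum_(k < B) f k.+1%:R^-1 * a k.+1) * lpart k)); last first.
  by apply: eqdM; [exact: eqd_sym|exact: eqd_refl].
have -> : k.+1%:R * lpart k.+1 = \sum_(j < B) f j.+1%:R^-1 *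
    \sum_(nu <- allparts B | (j.+1 + psize nu <= B)%N) iz nu *
      ((size (Defs.pval nu) == k)%:R * (a j.+1 * pw a nu)).
  have := sum_insert f (fun=> 1) (fun nu => (size (Defs.pval nu) == k.+1)%:R * pw a nu) B.
  have -> : \sum_(nu <- allparts B) (\sum_(k <- Defs.pval nu) 1) *
    (iz nu * ((size (Defs.pval nu) == k.+1)%:R * pw a nu)) = k.+1%:R * lpart k.+1.
    rewrite /lpart mulr_sumr; apply: eq_bigr => nu _; rewrite big_const_seq count_predT iter_addr_0.
    by case: eqP => [->//|_]; rewrite !mul0r !mulr0.
  move=> ->; apply: eq_bigr => j _; rewrite mul1r; congr (_ * _); apply: eq_bigr => nu _.
  by rewrite pw_padd // (perm_size (perm_padd nu _)).
rewrite mulr_suml; apply: eqd_sum => j _ _; rewrite -mulrA; apply: eqdM; first exact: eqd_refl.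
rewrite /lpart mulr_sumr; apply: eqd_sym.
rewrite (eq_bigr (fun nu => iz nu * ((size (Defs.pval nu) == k)%:R * (a j.+1 * pw a nu)))) => [|nu _]; last by ring.
apply: eqd_drop => nu _; rewrite -ltnNge => h; apply: lowMl; apply: lowMl; apply: lowW h _.
by apply: lowM; [exact: ga|exact: low_pw].
Qed.

Lemma lpart_exp k : eqd B (F ^+ k) (k`!%:R * lpart k).
Proof.
elim: k => [|k IH]; first by rewrite lpart0 mulr1; exact: eqd_refl.
rewrite exprS factS natrM; apply: (@eqd_trans _ _ _ (F * (k`!%:R * lpart k))).
  by apply: eqdM; [exact: eqd_refl|exact: IH].
have -> : k.+1%:R * k`!%:R * lpart k.+1 = k`!%:R * (k.+1%:R * lpart k.+1) by ring.
rewrite mulrCA; apply: eqdM; first exact: eqd_refl.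
by apply: eqd_sym; exact: lpartS.
Qed.

(** [F] has no constant term, so F^k starts in degree [k] and the exponential series can be cut at
    [B]. *)
Lemma fps_expE : eqd B (fps_exp F) (cexp f B a).
Proof.
have lowF k m : (msize m < k)%N -> coef (fpsC I (k`!%:R)^-1 * F ^+ k) m = 0.
  by move=> mk; rewrite fcoefCM (_ : coef (F ^+ k) m = 0) ?mulr0 //; apply: (@lowX _ _ 1 F k F1); rewrite muln1.
apply: (@eqd_trans _ _ _ (\sum_(k < B.+1) fpsC I (k`!%:R)^-1 * F ^+ k)).
  move=> m mB; rewrite fcoef_sum (@fcoef_fps_sum_seq _ _ _ _ (iota 0 B.+1)) ?iota_uniq //.
    by rewrite -{1}[B.+1]subn0 -/(index_iota 0 B.+1) big_mkord.
  by move=> k _; rewrite mem_iota add0n ltnS -ltnNge => Bk; apply: lowF; exact: leq_ltn_trans Bk.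
apply: (@eqd_trans _ _ _ (\sum_(k < B.+1) lpart k)).
  apply: eqd_sum => k _ _; have -> : lpart k = fpsC I (k`!%:R)^-1 * (k`!%:R * lpart k).
    have k0 : k`!%:R != 0 :> K by rewrite -(rmorph_nat c) fmorph_eq0 pnatr_eq0 -lt0n fact_gt0.
    by rewrite mulrA -(rmorph_nat (@fpsC I K)) -rmorphM mulVf // rmorph1 mul1r.
  by apply: eqdM; [exact: eqd_refl|exact: lpart_exp].
suff -> : \sum_(k < B.+1) lpart k = cexp f B a by exact: eqd_refl.
rewrite cexpE exchange_big; apply: eq_big_seq => nu; rewrite mem_allparts => nB /=.
have sB : (size (Defs.pval nu) < B.+1)%N by rewrite ltnS (leq_trans (size_le_psize nu)).
rewrite (bigD1 (Ordinal sB)) //= eqxx mul1r big1 ?addr0 // => n.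
by rewrite -val_eqE eq_sym => /negPf /= ->; rewrite mul0r mulr0.
Qed.

End Exponential.

(** * Summation along a leg *)

Lemma sch_rmorph (R S : comNzRingType) (f : {rmorphism algC -> R}) (g : {rmorphism R -> S}) a mu :
  g (sch f a mu) = sch (g \o f : {rmorphism algC -> S}) (fun k => g (a k)) mu.
Proof.
rewrite /sch rmorph_sum; apply: eq_bigr => nu _.
by rewrite rmorphM (@pw_rmorph _ _ g).
Qed.

Lemma sch_homog (R : comNzRingType) (f : {rmorphism algC -> R}) (c : R) a mu :
  sch f (fun k => c ^+ k * a k) mu = c ^+ psize mu * sch f a mu.
Proof.
rewrite /sch mulr_sumr; apply: eq_big_seq => nu; rewrite mem_parts => /eqP <-.
have -> : pw (fun k => c ^+ k * a k) nu = c ^+ psize nu * pw a nu.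
  rewrite /pw big_split; apply: (congr1 (fun x => x * _)); rewrite /psize.
  by elim: (Defs.pval nu) => [|k s IH]; [rewrite big_nil|rewrite big_cons /= IH exprD].
by ring.
Qed.

Lemma chi_part0 : chi part0 part0 = 1.
Proof.
have := kostka1 part0; rewrite schur_sch.
have -> : sch (@fpsC nat algC) (@psum algC) part0 =
    fpsC nat (chi part0 part0 / (zee part0)%:R) * pw (@psum algC) part0.
  rewrite /sch (bigD1_seq part0) ?mem_parts ?parts_uniq // big1_seq; first exact: addr0.
  by move=> nu /andP[n0]; rewrite mem_parts psize_eq0 (negPf n0).
rewrite fcoefCM /pw big_nil fcoef1 /zee big_nil divr1; case: eqP => _; rewrite ?mulr1 // mulr0 => /eqP.
by rewrite eq_sym oner_eq0.
Qed.

Lemma sch0 (R : comNzRingType) (f : {rmorphism algC -> R}) mu :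
  sch f (fun=> 0) mu = (mu == part0)%:R.
Proof.
rewrite /sch; case: eqP => [->|mu0].
  rewrite (bigD1_seq part0) ?mem_parts ?parts_uniq //= big1_seq ?addr0.
    by rewrite /pw big_nil /zee big_nil divr1 chi_part0 rmorph1 mulr1.
  by move=> nu /andP[n0]; rewrite mem_parts psize_eq0 (negPf n0).
rewrite big1_seq // => nu /andP[_]; rewrite mem_parts => /eqP nm.
case: nu nm => -[|k s] i nm; last by rewrite /pw big_cons mul0r mulr0.
by case: mu0; apply/eqP; rewrite -psize_eq0 -nm.
Qed.

Lemma eq_sch (R : comNzRingType) (f : {rmorphism algC -> R}) a b mu :
  (forall k, (0 < k)%N -> a k = b k) -> sch f a mu = sch f b mu.
Proof.
move=> ab; apply: eq_bigr => nu _; apply: (congr1 (fun x => _ * x)).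
by apply: eq_big_seq => k /part_gt0; exact: ab.
Qed.

Lemma trp0 : trp part0 = part0.
Proof. by apply/eqP; rewrite -psize_eq0 psize_trp. Qed.

Lemma sum_trp (V : nmodType) B (F : part -> V) :
  \sum_(nu <- allparts B) F (trp nu) = \sum_(nu <- allparts B) F nu.
Proof.
apply: (@big_bij _ _ _ _ _ _ _ trp trp) => [||nu nB _|nu nB _|//]; try exact: allparts_uniq.
  by rewrite mem_allparts psize_trp -mem_allparts trpK.
by rewrite mem_allparts psize_trp -mem_allparts trpK.
Qed.

Section Strip.
Variables (I : choiceType) (R : comNzRingType) (f : {rmorphism algC -> fps I R}) (B : nat).
Implicit Types (a b w : nat -> fps I R).

Lemma cauchy_cexp a b :
  \sum_(rho <- allparts B) sch f a rho * sch f b rho = cexp f B (fun k => a k * b k).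
Proof.
rewrite /cexp; transitivity (\sum_(n < B.+1) \sum_(rho <- allparts B)
    (psize rho == n)%:R * (sch f a rho * sch f b rho)); last first.
  apply: eq_bigr => n _; rewrite -cauchy_sch (@sum_parts _ n B); last by rewrite -ltnS.
  by rewrite [RHS]big_mkcond; apply: eq_bigr => nu _; rewrite andbT; case: eqP => _; rewrite ?mul1r ?mul0r.
rewrite exchange_big; apply: eq_big_seq => nu; rewrite mem_allparts => nB /=.
rewrite (bigD1 (Ordinal (nB : (psize nu < B.+1)%N))) //= eqxx mul1r big1 ?addr0 // => n.
by rewrite -val_eqE eq_sym => /negPf /= ->; rewrite mul0r.
Qed.

Variable x : nat -> fps I R.

(** The skew Schur function s_(mu/lam)[x], provided that |mu| is at most [B]. *)
Definition skewsch mu lam : fps I R :=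
  \sum_(rho <- allparts B) f (lr mu lam rho) * sch f x rho.

(** For fixed [rho], the sum over [nu] is the product s_lam[w] s_rho[w]; the Cauchy identity then
    sums over [rho]. *)
Lemma skewsch_sum w lam : graded w ->
  eqd B (\sum_(nu <- allparts B) skewsch nu lam * sch f w nu)
        (cexp f B (fun k => x k * w k) * sch f w lam).
Proof.
move=> gw; have -> : \sum_(nu <- allparts B) skewsch nu lam * sch f w nu =
    \sum_(rho <- allparts B) sch f x rho *
      \sum_(nu <- allparts B) f (lr nu lam rho) * sch f w nu.
  transitivity (\sum_(nu <- allparts B) \sum_(rho <- allparts B)
      sch f x rho * (f (lr nu lam rho) * sch f w nu)).
    by apply: eq_bigr => nu _; rewrite mulr_suml; apply: eq_bigr => rho _; ring.
  by rewrite exchange_big; apply: eq_bigr => rho _; rewrite mulr_sumr.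
rewrite -cauchy_cexp mulr_suml.
apply: eqd_sum => rho _ _; rewrite -mulrA; apply: eqdM; first exact: eqd_refl.
(* If |lam| + |rho| exceeds [B], no [nu] in range contributes and the product has degree above
   [B]. *)
rewrite mulrC sch_mul; have [h|h] := leqP (psize lam + psize rho) B.
  rewrite (sum_parts _ _ h) [X in eqd _ _ X]big_mkcond /=.
  rewrite (eq_bigr (fun nu => if (psize nu == psize lam + psize rho)%N && true
     then f (lr nu lam rho) * sch f w nu else 0)); first exact: eqd_refl.
  move=> nu _; rewrite andbT; case: eqP => // /eqP ne.
  by rewrite lr_eq0 // rmorph0 mul0r.
rewrite big1_seq; last first.
  move=> nu /andP[_]; rewrite mem_allparts => nB; rewrite lr_eq0 ?rmorph0 ?mul0r //.
  by apply/eqP; move: h nB; lia.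
apply: eqd_sym; apply: (@eqd_low _ _ _ B.+1) => //; apply: low_sum => nu.
rewrite mem_parts => /eqP nE _; apply: lowMl; apply: (@lowW _ _ (psize nu)); first by rewrite nE.
exact: low_sch.
Qed.

Variable edge : part -> part -> fps I R.
Hypothesis edgeE : forall mu nu, (psize mu <= B)%N -> (psize nu <= B)%N ->
  edge mu nu = \sum_(lam <- allparts B) skewsch (trp mu) lam * skewsch (trp nu) lam.

(* The Cauchy identity sums over [nu], the addition formula over [lam]. *)
Lemma edge_sum w mu : (psize mu <= B)%N -> graded w ->
  eqd B (\sum_(nu <- allparts B) edge mu nu * sch f w (trp nu))
        (cexp f B (fun k => x k * w k) * sch f (fun k => w k + x k) (trp mu)).
Proof.
move=> mB gw; have -> : \sum_(nu <- allparts B) edge mu nu * sch f w (trp nu) =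
   \sum_(lam <- allparts B) skewsch (trp mu) lam *
     \sum_(nu <- allparts B) skewsch nu lam * sch f w nu.
  transitivity (\sum_(lam <- allparts B) \sum_(nu <- allparts B)
     skewsch (trp mu) lam * (skewsch (trp nu) lam * sch f w (trp nu))); last first.
    apply: eq_bigr => lam _; rewrite -(sum_trp _ (fun nu => skewsch nu lam * sch f w nu)).
    by rewrite mulr_sumr.
  rewrite exchange_big; apply: eq_big_seq => nu; rewrite mem_allparts => nB.
  by rewrite edgeE // mulr_suml; apply: eq_bigr => lam _; rewrite mulrA.
rewrite (@sch_add _ f w x (trp mu) B) ?psize_trp // mulr_sumr.
apply: eqd_sum => lam _ _.
apply: (@eqd_trans _ _ _ (skewsch (trp mu) lam * (cexp f B (fun k => x k * w k) * sch f w lam))).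
  by apply: eqdM; [exact: eqd_refl|exact: skewsch_sum].
have -> : \sum_(rho <- allparts B) f (lr (trp mu) lam rho) * (sch f w lam * sch f x rho) =
   skewsch (trp mu) lam * sch f w lam.
  by rewrite mulr_suml; apply: eq_bigr => rho _; ring.
by rewrite mulrCA; exact: eqd_refl.
Qed.

(** [edge_sum] at w = 0, where only the empty [nu] survives and the exponential is 1. *)
Lemma edge0 mu : (psize mu <= B)%N -> eqd B (edge mu part0) (sch f x (trp mu)).
Proof.
move=> mB; have := @edge_sum (fun=> 0) mu mB (fun=> @low0 _ _ _).
rewrite (bigD1_seq part0) ?mem_allparts ?allparts_uniq //= sch0.
rewrite trp0 eqxx mulr1 big1 ?addr0; last first.
  move=> nu n0; rewrite sch0 (_ : (trp nu == part0) = false) ?mulr0 //.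
  by apply/negbTE; apply: contraNneq n0 => e; rewrite -[nu]trpK e trp0.
rewrite (@eq_cexp _ _ f B _ (fun=> 0)); last by move=> k _; rewrite mulr0.
by rewrite cexp0 mul1r (@eq_sch _ f _ x) // => k _; rewrite add0r.
Qed.

Variable q : nat -> fps I R.
Hypothesis q1 : forall j, low 1 (q j).

(** [n] is the number of partitions still to be summed and [j] the index of the innermost one. Once
    they are summed, the leg has become a Schur function at the power sums [legv], times the
    exponential of the terms collected in [lege]. *)
Fixpoint legv n j : nat -> fps I R :=
  if n is n'.+1 then fun k => q j ^+ k * legv n' j.+1 k + x k else x.

Fixpoint lege n j : nat -> fps I R :=
  if n is n'.+1 then fun k => x k * (q j ^+ k * legv n' j.+1 k) + lege n' j.+1 k
  else fun=> 0.

Fixpoint legsum n j (p : part) : fps I R :=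
  if n is n'.+1 then
    \sum_(nu <- allparts B) edge p nu * q j ^+ psize nu * legsum n' j.+1 nu
  else edge p part0.

Lemma graded_expt j a : graded (fun k => q j ^+ k * a k).
Proof. by move=> k; apply: lowMr; rewrite -[k in low k]muln1; apply: lowX. Qed.

Lemma graded_lege n j : graded (lege n j).
Proof.
elim: n j => [|n IH] j k; first exact: low0.
by apply: lowD; [apply: lowMl; exact: graded_expt|exact: IH].
Qed.

(** Induction from the outer end: the inner sum becomes a Schur function at [legv n j.+1],
    homogeneity absorbs [q j ^+ psize nu] into its power sums, and [edge_sum] sums over [nu]. *)
Lemma legsumE n j p : (psize p <= B)%N ->
  eqd B (legsum n j p) (cexp f B (lege n j) * sch f (legv n j) (trp p)).
Proof.
elim: n j p => [|n IH] j p pB; first by rewrite /= cexp0 mul1r; exact: edge0.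
pose w k := q j ^+ k * legv n j.+1 k.
apply: (@eqd_trans _ _ _ (cexp f B (lege n j.+1) *
   \sum_(nu <- allparts B) edge p nu * sch f w (trp nu))).
  rewrite mulr_sumr; apply: eqd_sum => nu; rewrite mem_allparts => nB _.
  rewrite /w sch_homog psize_trp.
  apply: (@eqd_trans _ _ _ (edge p nu * q j ^+ psize nu *
      (cexp f B (lege n j.+1) * sch f (legv n j.+1) (trp nu)))).
    by apply: eqdM; [exact: eqd_refl|exact: IH].
  suff -> : edge p nu * q j ^+ psize nu * (cexp f B (lege n j.+1) * sch f (legv n j.+1) (trp nu)) =
     cexp f B (lege n j.+1) * (edge p nu * (q j ^+ psize nu * sch f (legv n j.+1) (trp nu))).
    exact: eqd_refl.
  by ring.
apply: (@eqd_trans _ _ _ (cexp f B (lege n j.+1) * (cexp f B (fun k => x k * w k) *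
   sch f (fun k => w k + x k) (trp p)))).
  by apply: eqdM; [exact: eqd_refl|apply: edge_sum => //; exact: graded_expt].
rewrite mulrA; apply: eqdM; last exact: eqd_refl.
rewrite mulrC; apply: eqd_sym; apply: cexp_add; last exact: graded_lege.
by move=> k; apply: lowMl; exact: graded_expt.
Qed.

Lemma leg_tail n j k :
  \sum_(j <= k1 < j + n.+1) (\prod_(j <= l < k1.+1) q l) ^+ k =
  q j ^+ k * (1 + \sum_(j.+1 <= k1 < j + n.+1) (\prod_(j.+1 <= l < k1.+1) q l) ^+ k).
Proof.
have jn : (j < j + n.+1)%N by rewrite addnS ltnS leq_addr.
rewrite (big_ltn jn) big_nat1 mulrDr mulr1 mulr_sumr; congr (_ + _).
by apply: eq_big_nat => k1 /andP[jk _]; rewrite big_ltn ?exprMn // ltnW.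
Qed.

Lemma legvE n j k : legv n j k =
  x k * (1 + \sum_(j <= k1 < j + n) (\prod_(j <= l < k1.+1) q l) ^+ k).
Proof.
elim: n j => [|n IH] j; first by rewrite addn0 big_geq // addr0 mulr1.
by rewrite /= IH addSnnS leg_tail; ring.
Qed.

(** The recursion step at [j] contributes the intervals with left end [j], which [leg_tail]
    collects. *)
Lemma legeE n j k : lege n j k =
  \sum_(j <= k1 < j + n) \sum_(k1 <= k2 < j + n)
     x k ^+ 2 * (\prod_(k1 <= l < k2.+1) q l) ^+ k.
Proof.
elim: n j => [|n IH] j; first by rewrite addn0 big_geq.
have jn : (j < j + n.+1)%N by rewrite addnS ltnS leq_addr.
rewrite /= IH addSnnS (big_ltn jn) legvE addSnnS -mulr_sumr leg_tail; congr (_ + _).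
by ring.
Qed.

End Strip.

(** * The vertex *)

Definition sc : {rmorphism algC -> tser} := (@fpsC ('I_3 * nat)%type Kq) \o cst.

Definition xs k : tser := scal (qintV k).

Lemma scalM a b : scal (a * b) = scal a * scal b.
Proof. by rewrite /scal rmorphM. Qed.

Lemma sch_xs mu : sch sc xs mu = scal (W1 mu).
Proof. by rewrite W1E [RHS](@sch_rmorph _ _ cst (@fpsC ('I_3 * nat)%type Kq)). Qed.

Definition edge mu nu : tser := scal (qh ^ (- kappa mu) * W2 mu nu * qh ^ (- kappa nu)).

Lemma skew_xs B nu lam : (psize nu <= B)%N -> skewsch sc B xs nu lam = scal (Wskew nu lam).
Proof.
move=> nB; rewrite (WskewE lam nB) /scal rmorph_sum; apply: eq_bigr => rho _.
by rewrite sch_xs rmorphM.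
Qed.

Lemma edge_skewsch B mu nu : (psize mu <= B)%N -> (psize nu <= B)%N ->
  edge mu nu =
  \sum_(lam <- allparts B) skewsch sc B xs (trp mu) lam * skewsch sc B xs (trp nu) lam.
Proof.
move=> mB nB; rewrite /edge (W2E _ mB) /scal rmorph_sum; apply: eq_bigr => lam _.
by rewrite !skew_xs ?psize_trp // rmorphM.
Qed.

Lemma schur_uE i N mu : schur_u i N mu = sch sc (u_pow i N) mu.
Proof.
apply: fpsP => m; rewrite (@fcoef_fps_sum_seq _ _ _ _ (parts (psize mu))).
- by rewrite /sch fcoef_sum; apply: eq_bigr.
- exact: parts_uniq.
- by move=> nu; rewrite mem_parts => /eqP.
by move=> nu /= nm; rewrite mem_parts nm eqxx.
Qed.

Lemma u_powE i n : u_pow i n.+1 = legv xs (expt i) n 2.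
Proof. by apply/funext => k; rewrite legvE. Qed.

Lemma prod3 (R : comNzRingType) (F : 'I_3 -> R) :
  \prod_(i < 3) F i = F leg1 * (F leg2 * F leg3).
Proof.
rewrite !big_ord_recl big_ord0 mulr1.
by congr (F _ * (F _ * F _)); apply: val_inj.
Qed.

Definition pick3 (T : Type) (a b c : T) (i : 'I_3) : T :=
  if i == leg1 then a else if i == leg2 then b else c.

Lemma ord3P (P : 'I_3 -> Prop) : P leg1 -> P leg2 -> P leg3 -> forall i, P i.
Proof.
move=> h1 h2 h3 [[|[|[|//]]] h].
- by rewrite (_ : Ordinal h = leg1) //; exact: val_inj.
- by rewrite (_ : Ordinal h = leg2) //; exact: val_inj.
by rewrite (_ : Ordinal h = leg3) //; exact: val_inj.
Qed.

Lemma pick3E (T : Type) (g : 'I_3 -> T) : pick3 (g leg1) (g leg2) (g leg3) = g.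
Proof. by apply/funext; apply: ord3P. Qed.

Section Chain.
Variables (R : comNzRingType) (edge : part -> part -> R) (q : nat -> R).

(** The last factor has no power of [q], because the outermost partition is empty. *)
Fixpoint chain j p (s : seq part) : R :=
  if s is nu :: s' then edge p nu * q j ^+ psize nu * chain j.+1 nu s'
  else edge p part0.

Lemma chainE j p s : chain j p s =
  \prod_(j <= l < j + (size s).+1)
    (edge (nth part0 (p :: s) (l - j)) (nth part0 s (l - j)) *
     q l ^+ psize (nth part0 s (l - j))).
Proof.
elim: s j p => [|nu s IH] j p.
  by rewrite addn1 big_nat1 subnn /= expr0 mulr1.
have jl : (j < j + (size (nu :: s)).+1)%N by rewrite addnS ltnS leq_addr.
rewrite (big_ltn jl) subnn (_ : (j + (size (nu :: s)).+1 = j.+1 + (size s).+1)%N); last by rewrite addSnnS.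
transitivity (edge p nu * q j ^+ psize nu * chain j.+1 nu s); first by [].
congr (_ * _); rewrite IH.
by apply: eq_big_nat => l /andP[jl' _]; rewrite (_ : (l - j)%N = (l - j.+1).+1) //; lia.
Qed.

Lemma chain_legE s n : size s == n -> (0 < n)%N ->
  \prod_(2 <= j < n.+2) (edge (nth part0 s j.-2) (nth part0 s j.-1) * q j ^+ psize (nth part0 s j.-1)) =
  chain 2 (head part0 s) (behead s).
Proof.
case: s => [|p s] /eqP <- // _; rewrite -[(size (p :: s)).+2]/(2 + (size s).+1)%N.
rewrite -[chain _ _ _]/(chain 2 p s) chainE.
by apply: eq_big_nat => -[|[|j]] // _; rewrite subn2.
Qed.

End Chain.

(** Lists are numbered from 0 and [j] from 1; past the end of a list the default is the empty
    partition, as [families] requires. *)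
Definition family (a b c : seq part) : 'I_3 -> nat -> part :=
  fun i j => if j is j'.+1 then nth part0 (pick3 a b c i) j' else part0.

Lemma family_chain (R : comNzRingType) (edge : part -> part -> R) (q : 'I_3 -> nat -> R)
    (N : 'I_3 -> nat) a b c : (forall i, (1 <= N i)%N) ->
  size a == N leg1 -> size b == N leg2 -> size c == N leg3 ->
  \prod_(i < 3) \prod_(2 <= j < (N i).+2)
    (edge (family a b c i j.-1) (family a b c i j) * q i j ^+ psize (family a b c i j)) =
  chain edge (q leg1) 2 (head part0 a) (behead a) *
  (chain edge (q leg2) 2 (head part0 b) (behead b) *
   chain edge (q leg3) 2 (head part0 c) (behead c)).
Proof.
move=> hN an bn cn.
have fE i j : (2 <= j)%N -> family a b c i j.-1 = nth part0 (pick3 a b c i) j.-2 by case: j => [|[|j]].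
have fE' i j : (2 <= j)%N -> family a b c i j = nth part0 (pick3 a b c i) j.-1 by case: j => [|[|j]].
rewrite prod3 -(chain_legE _ _ an) // -(chain_legE _ _ bn) // -(chain_legE _ _ cn) //.
by congr (_ * (_ * _)); apply: eq_big_nat => j /andP[j2 _]; rewrite fE // fE'.
Qed.

Lemma vertex_rearrange (R : comNzRingType) (s p k w c1 c2 c3 : R) :
  s * p * k * w * (c1 * (c2 * c3)) = c1 * (c2 * (c3 * (s * p * (k * w)))).
Proof. by ring. Qed.

Section Legs.
Variable B : nat.

Fixpoint legs n : seq (seq part) :=
  if n is n'.+1 then [seq p :: s | p <- allparts B, s <- legs n'] else [:: [::]].

Lemma legs_uniq n : uniq (legs n).
Proof.
elim: n => //= n IH; rewrite allpairs_uniq ?allparts_uniq //.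
by move=> [a b] [c d] _ _ /= [-> ->].
Qed.

Lemma mem_legs n s :
  (s \in legs n) = (size s == n) && all (fun p => psize p <= B)%N s.
Proof.
elim: n s => [|n IH] s; first by rewrite inE; case: s.
apply/allpairsP/idP => [[[p t] /= [pB]]|].
  by rewrite IH => /andP[/eqP tn tB] ->; rewrite /= tn eqxx -mem_allparts pB tB.
case: s => [//|p t] /= /andP[tn /andP[pB tB]]; exists (p, t); split=> //.
  by rewrite mem_allparts.
by rewrite IH tB andbT.
Qed.

Section LegSum.
Variables (I : choiceType) (R : comNzRingType).
Variables (edge : part -> part -> fps I R) (q : nat -> fps I R).

Lemma legsum_chain n j p :
  legsum B edge q n j p = \sum_(s <- legs n) chain edge q j p s.
Proof.
elim: n j p => [|n IH] j p; first by rewrite big_seq1.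
rewrite /= big_allpairs_dep; apply: eq_bigr => nu _ /=.
by rewrite IH mulr_sumr.
Qed.

Lemma legs_sum n (X : part -> fps I R) :
  \sum_(s <- legs n.+1) chain edge q 2 (head part0 s) (behead s) * X (head part0 s) =
  \sum_(p <- allparts B) legsum B edge q n 2 p * X p.
Proof.
rewrite /= big_allpairs_dep; apply: eq_bigr => p _ /=.
by rewrite legsum_chain mulr_suml.
Qed.

End LegSum.

Lemma legsum_u i n p : (psize p <= B)%N ->
  eqd B (legsum B edge (expt i) n 2 p)
        (cexp sc B (lege xs (expt i) n 2) * schur_u i n.+1 (trp p)).
Proof.
move=> pB; rewrite schur_uE u_powE; apply: legsumE => //; first exact: edge_skewsch.
by move=> j; exact: low_fpsX.
Qed.

End Legs.

Definition zterm (N : 'I_3 -> nat) (mu : 'I_3 -> nat -> part) : tser :=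
  (-1) ^+ (\sum_(i < 3) psize (mu i 1%N))%N *
  \prod_(i < 3) expt i 1 ^+ psize (mu i 1%N) *
  scal (qh ^ (\sum_(i < 3) kappa (mu i 1%N))) *
  scal (W3 (trp (mu leg3 1%N)) (trp (mu leg2 1%N)) (trp (mu leg1 1%N))) *
  \prod_(i < 3) \prod_(2 <= j < (N i).+2)
    (edge (mu i j.-1) (mu i j) * expt i j ^+ psize (mu i j)).

Definition rterm (N : 'I_3 -> nat) (mu : 'I_3 -> part) : tser :=
  scal (W3 (mu leg1) (mu leg2) (mu leg3)) *
  \prod_(i < 3)
    ((-1) ^+ psize (mu i) * expt i 1 ^+ psize (mu i) * schur_u i (N i) (trp (mu i))).

(** Each partition carries its own variable to the power of its size, so only families of partitions
    of size at most [B] contribute up to degree [B]. *)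
Lemma low_zterm N mu i j : (1 <= j <= N i)%N -> low (psize (mu i j)) (zterm N mu).
Proof.
case/andP => j1 jN; have [je|j2] := eqVneq j 1%N.
  rewrite je; do 3 apply: lowMr; apply: lowMl; rewrite (bigD1 i) //=; apply: lowMr.
  exact: low_fpsXn.
apply: lowMl; rewrite (bigD1 i) //=; apply: lowMr.
rewrite (bigD1_seq j) ?iota_uniq //=; last by rewrite mem_index_iota; lia.
by apply: lowMr; apply: lowMl; exact: low_fpsXn.
Qed.

Lemma low_rterm N mu i : low (psize (mu i)) (rterm N mu).
Proof.
apply: lowMl; rewrite (bigD1 i) //=; apply: lowMr; apply: lowMr; apply: lowMl.
exact: low_fpsXn.
Qed.

Section Truncate.
Variables (N : 'I_3 -> nat) (hN : forall i, (1 <= N i)%N) (B : nat).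
Local Notation aB := (allparts B).

Definition vtx p1 p2 p3 : tser :=
  (-1) ^+ (psize p1 + (psize p2 + psize p3))%N *
  (expt leg1 1 ^+ psize p1 * (expt leg2 1 ^+ psize p2 * expt leg3 1 ^+ psize p3)) *
  scal (W3 p1 p2 p3).

(** [W3_trp] absorbs the powers of q at the vertex; everything else factors along the legs, which
    meet only in [vtx]. *)
Lemma zterm_family a b c : a \in legs B (N leg1) -> b \in legs B (N leg2) ->
  c \in legs B (N leg3) ->
  zterm N (family a b c) =
  chain edge (expt leg1) 2 (head part0 a) (behead a) * (chain edge (expt leg2) 2 (head part0 b) (behead b) *
   (chain edge (expt leg3) 2 (head part0 c) (behead c) * vtx (head part0 a) (head part0 b) (head part0 c))).
Proof.
rewrite !mem_legs => /andP[an _] /andP[bn _] /andP[cn _].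
have hE i : family a b c i 1 = head part0 (pick3 a b c i) by rewrite /= nth0.
have sumE (V : nmodType) (F : 'I_3 -> V) : \sum_(i < 3) F i = F leg1 + (F leg2 + F leg3).
  rewrite !big_ord_recl big_ord0 addr0.
  by congr (F _ + (F _ + F _)); apply: val_inj.
rewrite /zterm (family_chain _ _ hN an bn cn) prod3 vertex_rearrange.
do 3 apply: (congr1 (fun x => _ * x)).
have -> : (\sum_(i < 3) psize (family a b c i 1) = psize (head part0 a) + (psize (head part0 b) + psize (head part0 c)))%N.
  by rewrite -[RHS](sumE _ (fun i => psize (family a b c i 1))) // !hE.
rewrite sumE !hE -[pick3 a b c leg1]/a -[pick3 a b c leg2]/b -[pick3 a b c leg3]/c /vtx.
suff -> : scal (qh ^ (kappa (head part0 a) + (kappa (head part0 b) + kappa (head part0 c)))) *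
   scal (W3 (trp (head part0 c)) (trp (head part0 b)) (trp (head part0 a))) =
   scal (W3 (head part0 a) (head part0 b) (head part0 c)) by [].
by rewrite -scalM addrA W3_trp.
Qed.

(** Triples of lists correspond to the families of partitions of size at most [B]; any other family
    contains a larger partition and starts above degree [B]. *)
Lemma Zvertex_trunc : eqd B (Zvertex N)
  (\sum_(a <- legs B (N leg1)) \sum_(b <- legs B (N leg2)) \sum_(c <- legs B (N leg3))
     zterm N (family a b c)).
Proof.
move=> m mB; pose f (t : seq part * (seq part * seq part)) := family t.1 t.2.1 t.2.2.
pose L := [seq (a, t) | a <- legs B (N leg1), t <- [seq (b, c) | b <- legs B (N leg2), c <- legs B (N leg3)]].
have LP t : t \in L = [&& t.1 \in legs B (N leg1), t.2.1 \in legs B (N leg2) & t.2.2 \in legs B (N leg3)].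
  apply/allpairsP/and3P => [[[a bc] /= [aL /allpairsP[[b c] /= [bL cL ->]] ->]]|[h1 h2 h3]].
    by [].
  exists t; split=> //; last by case: t {h1 h2 h3}.
  by apply/allpairsP; exists t.2; split=> //; case: t {h1 h2 h3} => ? [].
have Lu : uniq L.
  rewrite allpairs_uniq ?legs_uniq //; last by move=> [? ?] [? ?] _ _ /= [-> ->].
  by rewrite allpairs_uniq ?legs_uniq // => -[? ?] [? ?] _ _ /= [-> ->].
have sz s i : s \in legs B (N i) -> size s = N i by rewrite mem_legs => /andP[/eqP].
have fK t : t \in L -> (mkseq (fun k => f t leg1 k.+1) (N leg1),
   (mkseq (fun k => f t leg2 k.+1) (N leg2), mkseq (fun k => f t leg3 k.+1) (N leg3))) = t.
  rewrite LP => /and3P[/sz s1 /sz s2 /sz s3]; case: t s1 s2 s3 => a [b c] /= s1 s2 s3.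
  by rewrite -s1 -s2 -s3 !mkseq_nth.
transitivity (\sum_(mu <- [seq f t | t <- L]) coef (zterm N mu) m); last first.
  by rewrite big_map -fcoef_sum big_allpairs_dep; apply: (congr1 (fun x => coef x m));
    apply: eq_bigr => a _; rewrite big_allpairs_dep.
apply: fcoef_fps_sum_seq.
- by rewrite map_inj_in_uniq // => t t' /fK {2}<- /fK {2}<- ->.
- move=> _ /mapP[t tL ->] i j; rewrite /f /family; case: j => [//|j]; rewrite -ltnNge ltnS => Nj.
  rewrite nth_default //; move: tL; rewrite LP => /and3P[/sz s1 /sz s2 /sz s3].
  by move: i Nj; apply: ord3P; rewrite /pick3 /= ?s1 ?s2 ?s3.
move=> mu muF muL; have [h|h] := pselect (forall i j, (psize (mu i j) <= B)%N).
  case/negP: muL; apply/mapP.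
  exists (mkseq (fun k => mu leg1 k.+1) (N leg1),
   (mkseq (fun k => mu leg2 k.+1) (N leg2), mkseq (fun k => mu leg3 k.+1) (N leg3))).
    by rewrite LP /= !mem_legs !size_mkseq !eqxx /=; apply/and3P; split; apply/allP => p /mapP[k _ ->].
  have e i : mu i =1 (fun j => if j is j'.+1 then nth part0 (mkseq (fun k => mu i k.+1) (N i)) j' else part0).
    case=> [|j]; first exact: muF.
    have [jN|Nj] := ltnP j (N i); first by rewrite nth_mkseq.
    by rewrite nth_default ?size_mkseq //; apply: muF; rewrite -ltnNge ltnS.
  by apply/funext; apply: ord3P; apply/funext => j; rewrite /f /family /pick3 /= e.
move/existsNP: h => [i /existsNP[j /negP]]; rewrite -ltnNge => Bj.
have jN : (1 <= j <= N i)%N.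
  by apply: contraTT Bj => /muF ->; rewrite -leqNgt.
exact: (@low_zterm N mu i j jN m (leq_ltn_trans mB Bj)).
Qed.

Lemma rsum_trunc : eqd B (fps_sum [set: 'I_3 -> part] (rterm N))
  (\sum_(p1 <- aB) \sum_(p2 <- aB) \sum_(p3 <- aB) rterm N (pick3 p1 p2 p3)).
Proof.
move=> m mB; pose f (t : part * (part * part)) := pick3 t.1 t.2.1 t.2.2.
pose L := [seq (a, t) | a <- aB, t <- [seq (b, c) | b <- aB, c <- aB]].
have Lu : uniq L.
  rewrite allpairs_uniq ?allparts_uniq //; last by move=> [? ?] [? ?] _ _ /= [-> ->].
  by rewrite allpairs_uniq ?allparts_uniq // => -[? ?] [? ?] _ _ /= [-> ->].
transitivity (\sum_(mu <- [seq f t | t <- L]) coef (rterm N mu) m); last first.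
  by rewrite big_map -fcoef_sum big_allpairs_dep; apply: (congr1 (fun x => coef x m));
    apply: eq_bigr => a _; rewrite big_allpairs_dep.
apply: fcoef_fps_sum_seq => //.
- rewrite map_inj_in_uniq // => -[a [b c]] [a' [b' c']] _ _ e.
  have := congr1 (fun g => (g leg1, (g leg2, g leg3))) e.
  by rewrite /f /pick3 /=.
move=> mu _ muL; have [h|h] := pselect (forall i, (psize (mu i) <= B)%N).
  case/negP: muL; apply/mapP; exists (mu leg1, (mu leg2, mu leg3)); last by rewrite /f /= pick3E.
  apply/allpairsP; exists (mu leg1, (mu leg2, mu leg3)); split=> //; first by rewrite mem_allparts /= h.
  by apply/allpairsP; exists (mu leg2, mu leg3); rewrite !mem_allparts /= !h.
move/existsNP: h => [i /negP]; rewrite -ltnNge => Bi.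
exact: (@low_rterm N mu i m (leq_ltn_trans mB Bi)).
Qed.

End Truncate.

Section CombineLegs.
Variables (I : choiceType) (R : comNzRingType) (r : seq part).
Variables (A : part -> part -> part -> fps I R).

Lemma leg_factor (E1 E2 E3 : fps I R) (S1 S2 S3 : part -> fps I R) :
  \sum_(p1 <- r) E1 * S1 p1 * (\sum_(p2 <- r) E2 * S2 p2 * (\sum_(p3 <- r) E3 * S3 p3 * A p1 p2 p3)) =
  E1 * (E2 * E3) * \sum_(p1 <- r) \sum_(p2 <- r) \sum_(p3 <- r) S1 p1 * (S2 p2 * (S3 p3 * A p1 p2 p3)).
Proof.
rewrite mulr_sumr; apply: eq_bigr => p1 _; rewrite !mulr_sumr; apply: eq_bigr => p2 _.
by rewrite !mulr_sumr; apply: eq_bigr => p3 _; ring.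
Qed.

Lemma eqd_legs B (T1 T2 T3 U1 U2 U3 : part -> fps I R) :
  (forall p, p \in r -> eqd B (T1 p) (U1 p)) -> (forall p, p \in r -> eqd B (T2 p) (U2 p)) ->
  (forall p, p \in r -> eqd B (T3 p) (U3 p)) ->
  eqd B (\sum_(p1 <- r) T1 p1 * (\sum_(p2 <- r) T2 p2 * (\sum_(p3 <- r) T3 p3 * A p1 p2 p3)))
        (\sum_(p1 <- r) U1 p1 * (\sum_(p2 <- r) U2 p2 * (\sum_(p3 <- r) U3 p3 * A p1 p2 p3))).
Proof.
move=> h1 h2 h3; apply: eqd_sum => p1 r1 _; apply: eqdM; first exact: h1.
apply: eqd_sum => p2 r2 _; apply: eqdM; first exact: h2.
by apply: eqd_sum => p3 r3 _; apply: eqdM; [exact: h3|exact: eqd_refl].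
Qed.

End CombineLegs.

Lemma legs_sum_pred (I : choiceType) (R : comNzRingType) B (edge : part -> part -> fps I R)
    (q : nat -> fps I R) n (n0 : (0 < n)%N) (X : part -> fps I R) :
  \sum_(s <- legs B n) chain edge q 2 (head part0 s) (behead s) * X (head part0 s) =
  \sum_(p <- allparts B) legsum B edge q n.-1 2 p * X p.
Proof. by case: n n0 => // n _; exact: legs_sum. Qed.

Lemma rterm_rearrange (R : comNzRingType) (w s1 s2 s3 e1 e2 e3 u1 u2 u3 : R) :
  u1 * (u2 * (u3 * (s1 * (s2 * s3) * (e1 * (e2 * e3)) * w))) =
  w * (s1 * e1 * u1 * (s2 * e2 * u2 * (s3 * e3 * u3))).
Proof. by ring. Qed.

(** The power sums for which [cexp] is, up to degree [B], the product of the three leg factors. *)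
Definition expo (N : 'I_3 -> nat) n : tser :=
  \sum_(i < 3) lege xs (expt i) (N i).-1 2 n.

Lemma graded_expo N : graded (expo N).
Proof.
move=> k; apply: low_sum => i _ _; apply: graded_lege => j; exact: low_fpsX.
Qed.

Section Vertex.
Variables (N : 'I_3 -> nat) (hN : forall i, (1 <= N i)%N).

Definition expterm n : tser :=
  scal (n%:R * qint n ^+ 2)^-1 *
  \sum_(i < 3) \sum_(2 <= k1 < (N i).+1) \sum_(k1 <= k2 < (N i).+1)
    (\prod_(k1 <= k < k2.+1) expt i k) ^+ n.

(** The factor 1/[n]^2 is the square of [xs n] in [legeE], and 1/n is the weight of the n-th power
    sum in the exponential. *)
Lemma exptermE n : expterm n = sc n%:R^-1 * expo N n.
Proof.
have sE : scal (n%:R * qint n ^+ 2)^-1 = sc n%:R^-1 * xs n ^+ 2.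
  by rewrite /sc /xs /scal /= -rmorphXn -rmorphM /qintV invfM exprVn fmorphV rmorph_nat.
rewrite /expterm sE -mulrA; apply: (congr1 (fun x => _ * x)); rewrite /expo mulr_sumr.
apply: eq_bigr => i _; rewrite legeE.
have -> : (2 + (N i).-1 = (N i).+1)%N by have := hN i; lia.
rewrite mulr_sumr; apply: eq_bigr => k1 _.
by rewrite mulr_sumr.
Qed.

Lemma low_expterm n : low n (expterm n).
Proof. by rewrite exptermE; apply: lowMl; exact: graded_expo. Qed.

Lemma expsum_low : low 1 (fps_sum [set n : nat | (1 <= n)%N] expterm).
Proof.
move=> m m1; rewrite (@fcoef_fps_sum_seq _ _ _ _ [::]) ?big_nil // => n n1 _.
by apply: low_expterm; exact: leq_trans m1 n1.
Qed.

Lemma expsum_trunc B : eqd B (fps_sum [set n : nat | (1 <= n)%N] expterm)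
  (\sum_(k < B) sc k.+1%:R^-1 * expo N k.+1).
Proof.
move=> m mB; rewrite (@fcoef_fps_sum_seq _ _ _ _ (iota 1 B)) ?iota_uniq //.
- have -> : iota 1 B = [seq k.+1 | k <- index_iota 0 B].
    by rewrite /index_iota subn0 -[1%N]addn0 iotaDl.
  by rewrite fcoef_sum big_map big_mkord; apply: eq_bigr => k _; rewrite exptermE.
- by move=> n; rewrite mem_iota => /andP[].
move=> n /= n1; rewrite mem_iota n1 /= add1n ltnS -ltnNge => Bn.
by apply: low_expterm; exact: leq_ltn_trans Bn.
Qed.

(** The legs are summed one inside the other, each with the heads of the outer ones fixed. Their
    exponential factors do not depend on the heads and come out in front. *)
Lemma vertex_legs B : eqd B
  (\sum_(a <- legs B (N leg1)) \sum_(b <- legs B (N leg2)) \sum_(c <- legs B (N leg3))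
     zterm N (family a b c))
  (\prod_(i < 3) cexp sc B (lege xs (expt i) (N i).-1 2) *
   \sum_(p1 <- allparts B) \sum_(p2 <- allparts B) \sum_(p3 <- allparts B)
     rterm N (pick3 p1 p2 p3)).
Proof.
have NE i : N i = (N i).-1.+1 by rewrite prednK.
have -> : \sum_(a <- legs B (N leg1)) \sum_(b <- legs B (N leg2)) \sum_(c <- legs B (N leg3))
     zterm N (family a b c) =
   \sum_(p1 <- allparts B) legsum B edge (expt leg1) (N leg1).-1 2 p1 *
    (\sum_(p2 <- allparts B) legsum B edge (expt leg2) (N leg2).-1 2 p2 *
     (\sum_(p3 <- allparts B) legsum B edge (expt leg3) (N leg3).-1 2 p3 * vtx p1 p2 p3)).
  transitivity (\sum_(a <- legs B (N leg1)) chain edge (expt leg1) 2 (head part0 a) (behead a) *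
   (\sum_(b <- legs B (N leg2)) chain edge (expt leg2) 2 (head part0 b) (behead b) *
    (\sum_(c <- legs B (N leg3)) chain edge (expt leg3) 2 (head part0 c) (behead c) *
      vtx (head part0 a) (head part0 b) (head part0 c)))).
    apply: eq_big_seq => a aL; rewrite mulr_sumr; apply: eq_big_seq => b bL.
    rewrite !mulr_sumr; apply: eq_big_seq => c cL; exact: (zterm_family hN aL bL cL).
  rewrite (legs_sum_pred _ _ _ (hN leg1) (fun p1 => \sum_(b <- legs B (N leg2)) chain edge (expt leg2) 2 (head part0 b) (behead b) *
    (\sum_(c <- legs B (N leg3)) chain edge (expt leg3) 2 (head part0 c) (behead c) *
      vtx p1 (head part0 b) (head part0 c)))).
  apply: eq_bigr => p1 _; apply: (congr1 (fun x => _ * x)).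
  rewrite (legs_sum_pred _ _ _ (hN leg2) (fun p2 =>
    (\sum_(c <- legs B (N leg3)) chain edge (expt leg3) 2 (head part0 c) (behead c) *
      vtx p1 p2 (head part0 c)))).
  apply: eq_bigr => p2 _; apply: (congr1 (fun x => _ * x)).
  by rewrite (legs_sum_pred _ _ _ (hN leg3) (fun p3 => vtx p1 p2 p3)).
pose U i p := cexp sc B (lege xs (expt i) (N i).-1 2) * schur_u i (N i) (trp p).
have hU i p : p \in allparts B -> eqd B (legsum B edge (expt i) (N i).-1 2 p) (U i p).
  by rewrite mem_allparts => pB; rewrite /U {3}(NE i); exact: legsum_u.
refine (eqd_trans (eqd_legs _ (hU leg1) (hU leg2) (hU leg3)) _).
rewrite /U leg_factor prod3.
suff -> : \sum_(p1 <- allparts B) \sum_(p2 <- allparts B) \sum_(p3 <- allparts B)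
    schur_u leg1 (N leg1) (trp p1) * (schur_u leg2 (N leg2) (trp p2) *
      (schur_u leg3 (N leg3) (trp p3) * vtx p1 p2 p3)) =
   \sum_(p1 <- allparts B) \sum_(p2 <- allparts B) \sum_(p3 <- allparts B)
     rterm N (pick3 p1 p2 p3) by exact: eqd_refl.
apply: eq_bigr => p1 _; apply: eq_bigr => p2 _; apply: eq_bigr => p3 _.
rewrite /rterm prod3 -[pick3 p1 p2 p3 leg1]/p1 -[pick3 p1 p2 p3 leg2]/p2 -[pick3 p1 p2 p3 leg3]/p3.
by rewrite /vtx !exprD rterm_rearrange.
Qed.

End Vertex.

Theorem proposition20 (N : 'I_3 -> nat) (hN : forall i, (1 <= N i)%N) :
  Zvertex N =
  fps_exp (fps_sum [set n : nat | (1 <= n)%N] (fun n =>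
    scal (n%:R * qint n ^+ 2)^-1 *
    \sum_(i < 3) \sum_(2 <= k1 < (N i).+1) \sum_(k1 <= k2 < (N i).+1)
      (\prod_(k1 <= k < k2.+1) expt i k) ^+ n)) *
  fps_sum [set: 'I_3 -> part] (fun mu =>
    scal (W3 (mu leg1) (mu leg2) (mu leg3)) *
    \prod_(i < 3)
      ((-1) ^+ psize (mu i) * expt i 1 ^+ psize (mu i)
       * schur_u i (N i) (trp (mu i)))).
Proof.
(* [B] is the degree of the monomial under comparison, so agreement up to degree [B] decides this
   coefficient. *)
apply: fpsP => m; set B := msize m.
suff h : eqd B (Zvertex N)
    (fps_exp (fps_sum [set n : nat | (1 <= n)%N] (expterm N)) *
     fps_sum [set: 'I_3 -> part] (rterm N)) by exact: (h m (leqnn _)).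
refine (eqd_trans (@Zvertex_trunc N B) _); refine (eqd_trans (@vertex_legs N hN B) _).
apply: eqd_sym; apply: eqdM; last exact: rsum_trunc.
apply: (@eqd_trans _ _ _ (cexp sc B (expo N))).
  exact: (@fps_expE _ _ cst B (expo N) _ (@graded_expo N) (expsum_low hN) (@expsum_trunc N hN B)).
by apply: cexp_sum => i _; apply: graded_lege => j; exact: low_fpsX.
Qed.
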